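(* Let $T:[0,1)\to[0,1)$ be a right-continuous interval exchange transformation (IET), let $\mathcal A_f\subset(0,1)$ be a nonempty finite set, and let $f:[0,1)\setminus\mathcal A_f\to[0,\infty)$ be a function that is $C^2$ on $(0,1)\setminus\mathcal A_f$ and has an infinite singularity at each $x\in\mathcal A_f$: $$\lim_{y\to x^-}f(y)=\lim_{y\to x^+}f(y)=\infty .$$ Suppose additionally that (i) every discontinuity of $T$ belongs to $\mathcal A_f$; (ii) $f$ is of at least logarithmic growth: there are $B,C>0$ such that $$f''(x)\ \ge\ \frac{C}{\min_{y\in\mathcal A_f}|x-y|^2}-B$$ for every $x\in(0,1)\setminus\mathcal A_f$. Then $T$ is ergodic (with respect to Lebesgue measure) if and only if the special flow $T^f$ over $T$ and under the roof function $f$ is weakly mixing.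
   Context: A right-continuous IET $T:[0,1)\to[0,1)$ is a bijection for which there are $N\ge1$, points $0=a_0<a_1<\dots<a_N=1$ and $\sigma_1,\dots,\sigma_N\in\mathbb R$ with $Tx=x+\sigma_i$ for $x\in[a_{i-1},a_i)$, $i=1,\dots,N$. It preserves Lebesgue measure. The special flow $T^f=(T^f_t)_{t\in\mathbb R}$ acts on $\{(x,u): x\in[0,1)\setminus\mathcal A_f,\ 0\le u<f(x)\}$ (up to null sets) by moving points vertically with unit speed and identifying $(x,f(x))$ with $(Tx,0)$; it preserves the product Lebesgue measure. Weak mixing of $T^f$ means that $T^f$ is ergodic and has no non-trivial measurable eigenfunctions, i.e. there is no $s\in\mathbb R\setminus\{0\}$ and measurable $g$ with $|g|=1$ such that for every $t\in\mathbb R$, $g\circ T^f_t=e^{2\pi i s t}g$ almost everywhere. *)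

(* Defs.v *)
From HB Require Import structures.
From mathcomp Require Import all_boot all_order all_algebra.
From mathcomp Require Import all_classical all_reals all_analysis.
From mathcomp Require Import complex.

Set Implicit Arguments.
Unset Strict Implicit.
Unset Printing Implicit Defensive.

Import Order.TTheory GRing.Theory Num.Theory.
Import numFieldNormedType.Exports.

Local Open Scope classical_set_scope.
Local Open Scope ring_scope.

(* Maps of [0,1) are total functions R -> R; every definition below only looks
   at their values on [0,1). *)
Definition is_IET {R : realType} (T : R -> R) : Prop :=
  set_bij `[0, 1[ `[0, 1[ T /\
  exists (N : nat) (a sigma : nat -> R),
    [/\ (1 <= N)%N, a 0%N = 0, a N = 1,
        forall i : nat, (i < N)%N -> a i < a i.+1 &
        forall i : nat, (i < N)%N ->
          forall x, a i <= x < a i.+1 -> T x = x + sigma i].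

(* Discontinuities of T as a map of the space [0,1): one-sided at 0. *)
Definition discontinuities {R : realType} (T : R -> R) : set R :=
  [set x : R | 0 <= x < 1 /\ ~ (T @ within `[0, 1[ (nbhs x) --> T x)].

(* For a nonempty finite set A the infimum is attained: this is min_{y in A} |x - y|. *)
Definition dist_to {R : realType} (A : set R) (x : R) : R :=
  inf [set `|x - y| | y in A].

Definition C2_on {R : realType} (U : set R) (f : R -> R) : Prop :=
  forall x, U x ->
    [/\ derivable f x 1, derivable (f^`())%classic x 1 & {for x, continuous (f^`()^`())%classic}].

(* Ergodicity of a self-map of D; A ranges over the measurable subsets of D. *)
Definition ergodic_map d (X : measurableType d) (R : realType)
    (mu : {measure set X -> \bar R}) (D : set X) (T : X -> X) : Prop :=
  forall A : set X, measurable A -> A `<=` D -> D `&` T @^-1` A = A ->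
    mu A = 0%E \/ mu (D `\` A) = 0%E.

(* Flows (Phi t)_t on D that are only defined up to null sets; mu D may be infinite. *)
Definition ergodic_flow d (X : measurableType d) (R : realType)
    (mu : {measure set X -> \bar R}) (D : set X) (Phi : R -> X -> X) : Prop :=
  forall A : set X, measurable A -> A `<=` D ->
    (forall t, {ae mu, forall p, D p -> (A (Phi t p) <-> A p)}) ->
    mu A = 0%E \/ mu (D `\` A) = 0%E.

Definition cmeasurable_fun d (X : measurableType d) (R : realType)
    (D : set X) (g : X -> R[i]) : Prop :=
  measurable_fun D (fun p => complex.Re (g p)) /\
  measurable_fun D (fun p => complex.Im (g p)).

(* exp (i theta) *)
Definition expi {R : realType} (theta : R) : R[i] := Complex (cos theta) (sin theta).

Definition is_eigenfunction d (X : measurableType d) (R : realType)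
    (mu : {measure set X -> \bar R}) (D : set X) (Phi : R -> X -> X)
    (s : R) (g : X -> R[i]) : Prop :=
  [/\ cmeasurable_fun D g,
      forall p, D p -> `|g p| = 1 &
      forall t, {ae mu, forall p, D p -> g (Phi t p) = expi (2 * pi * s * t) * g p}].

Definition weakly_mixing_flow d (X : measurableType d) (R : realType)
    (mu : {measure set X -> \bar R}) (D : set X) (Phi : R -> X -> X) : Prop :=
  ergodic_flow mu D Phi /\
  ~ (exists (s : R) (g : X -> R[i]), s != 0 /\ is_eigenfunction mu D Phi s g).

Section SpecialFlow.
Context {R : realType} (T : R -> R) (A : set R) (f : R -> R).

Definition flow_space : set (R * R) :=
  [set p | [/\ 0 <= p.1 < 1, ~ A p.1 & 0 <= p.2 < f p.1]].

(* Moving up for time t >= 0 from p, with (x, f x) identified with (T x, 0), one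
   arrives at q after crossing the roof n times. There is no roof over A, so the
   orbit has to avoid A. Since f >= 0, at most one q qualifies. *)
Definition flows_to (t : R) (p q : R * R) : Prop :=
  [/\ flow_space p, flow_space q &
      exists n : nat,
        [/\ forall k : nat, (k < n)%N -> ~ A (iter k T p.1),
            q.1 = iter n T p.1 &
            q.2 = p.2 + t - \sum_(0 <= k < n) f (iter k T p.1)]].

(* The time-t map; for t < 0 it inverts the time-(-t) map. Where it is undefined
   (a null set of p in the flow space) it takes the dummy value p. *)
Definition special_flow (t : R) (p : R * R) : R * R :=
  xget p [set q | if 0 <= t then flows_to t p q else flows_to (- t) q p].

End SpecialFlow.

(* Main.v *)
Require Import Defs.
From HB Require Import structures.
From mathcomp Require Import all_boot all_order all_algebra.
From mathcomp Require Import all_classical all_reals all_analysis.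
From mathcomp Require Import measurable_realfun complex.
From mathcomp Require Import ring lra zify.

(* Eigenfunctions (and, for frequency 0, invariant sets) of the special flow correspond
   to solutions G of G (T x) = exp (i om f x) G x on the base, by a Fubini argument along
   the flow lines; for om = 0, ergodicity of T makes G constant. For om <> 0, passing to
   powers of G makes om large. Since T is ergodic, the preimages of the singularities are
   dense, and a Rokhlin tower over a short interval yields heights h and lengths l with
   l h <= 1 such that a set of points of measure bounded below approaches the
   singularities within l in time 3 h. By logarithmic growth the Birkhoff sum of f has
   there, up to constants, second derivative at least l^-2 at scale l, so that the van der
   Corput estimate forces its exponential to oscillate, while Lebesgue density makes
   G (T^n x) / G x nearly constant at that scale.
   Conversely, a T-invariant set lifts to a flow-invariant one. This detects the measure
   of the set because f > 0 near the singularities, and an orbit staying away from all of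
   them would be periodic together with an interval ending at a singularity, which gives
   arbitrarily small invariant sets charging every neighbourhood of it. *)

Set Implicit Arguments.
Unset Strict Implicit.
Unset Printing Implicit Defensive.

Import Order.TTheory GRing.Theory Num.Theory.
Import numFieldNormedType.Exports.

Local Open Scope classical_set_scope.
Local Open Scope ring_scope.

(** * Maps acting as translations between finitely many cuts *)

(** Hypothesis (i) is what allows calculus along orbits: an interval whose iterates avoid the
    singularities moves rigidly, and the Birkhoff sums of f are C^2 on it. The scales balance as
    follows. One approach within l of a singularity gives f'' a size of order at least C / l^2,
    while each of the n steps costs at most B. As n = 3 h <= 3 / l, the total cost 3 B / l is
    negligible against l^-2 for small l. At scale rho = eta l the phase then has second derivative
    at least ka / rho^2 with ka independent of l, so a fixed large frequency suffices at all scales.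
    Orbits coming closer than rho to a singularity would tear the interval; their starting points
    have measure of order eta n l <= 3 eta, so a small fixed eta leaves enough points of X. Two
    features of f shape the rest. It may fail to be integrable, so the flow space may have infinite
    measure and the arguments use null sets and functions of modulus 1. It may also vanish, so the
    flow does not see the base points with f = 0, and unboundedness of the Birkhoff sums has to be
    proved. *)

Section CutMap.
Context {R : realType}.
Implicit Types (T : R -> R) (As : seq R).

(** By right-continuity a cut belongs to the piece on its right, hence the half-open test
    [x < a <= y] in [cut_shift]. [T] acts on all of R so that preimages need no restriction to [[0,
    1[]. *)
Record cut_translation T As : Prop := CutTranslation {
  cut_in : forall a, a \in As -> 0 < a < 1;
  cut_inj : injective T;
  cut_unit : forall x, (0 <= T x < 1) = (0 <= x < 1);
  cut_shift : forall x y, 0 <= x -> x <= y -> y < 1 ->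
    (forall a, a \in As -> ~~ (x < a <= y)) -> T y - T x = y - x;
  cut_measurable : measurable_fun [set: R] T;
  cut_preserving : forall B : set R, measurable B ->
    lebesgue_measure (T @^-1` B) = lebesgue_measure B }.

Lemma seq_min (I : eqType) (F : I -> R) (s : seq I) : s != [::] ->
  exists2 i, i \in s & forall j, j \in s -> F i <= F j.
Proof.
elim: s => // i s IH _; have [->|s0] := eqVneq s [::].
  by exists i => [|j]; rewrite inE // => /eqP ->.
have [k ks kmin] := IH s0; have [ik|ki] := leP (F i) (F k).
  exists i; first by rewrite inE eqxx.
  by move=> j; rewrite inE => /predU1P[->//|/kmin]; exact: le_trans.
exists k; first by rewrite inE ks orbT.
by move=> j; rewrite inE => /predU1P[->|/kmin//]; exact: ltW.
Qed.

Context (T : R -> R) (As : seq R) (hT : cut_translation T As).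

Lemma iter_unit n x : (0 <= iter n T x < 1) = (0 <= x < 1).
Proof. by elim: n => //= n IH; rewrite (cut_unit hT). Qed.

Lemma iter_inj n : injective (iter n T).
Proof. by elim: n => [x y //|n IH x y /= /(cut_inj hT) /IH]. Qed.

(** Two orbits keep their distance until a cut first falls between them; the second alternative
    records that time. *)
Lemma iter_shift_or_cut n x y : 0 <= x -> x <= y -> y < 1 ->
  iter n T y - iter n T x = y - x \/
  exists2 k, (k < n)%N & iter k T y - iter k T x = y - x /\
    exists2 a, a \in As & iter k T x < a <= iter k T y.
Proof.
move=> x0 xy y1; elim: n => [|n [IH|[k kn H]]]; first by left.
- have x01 : 0 <= iter n T x < 1 by rewrite iter_unit x0 (le_lt_trans xy).
  have y01 : 0 <= iter n T y < 1 by rewrite iter_unit y1 (le_trans x0).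
  have [[a aA ha]|na] := pselect (exists2 a, a \in As & iter n T x < a <= iter n T y).
    by right; exists n => //; split => //; exists a.
  left; rewrite /= (cut_shift hT) ?IH//; [by lra|by lra|by lra|].
  by move=> a aA; apply/negP => ha; apply: na; exists a.
- by right; exists k => //; exact: ltnW.
Qed.

(** A cut separating the two orbits would lie within [|z - x| < r] of the orbit of [x]. *)
Lemma iter_shift_near n x z r : 0 <= x < 1 -> 0 <= z < 1 -> `|z - x| < r ->
  (forall k a, (k < n)%N -> a \in As -> r <= `|iter k T x - a|) ->
  iter n T z - iter n T x = z - x.
Proof.
move=> /andP[x0 x1] /andP[z0 z1] zr far; have [xz|/ltW zx] := leP x z.
  have [//|[k kn [e [a aA ha]]]] := iter_shift_or_cut n x0 xz z1.
  have := far _ _ kn aA; rewrite ler0_norm; last by lra.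
  by move: zr; rewrite ger0_norm; lra.
have [|[k kn [e [a aA ha]]]] := iter_shift_or_cut n z0 zx x1; first by lra.
have := far _ _ kn aA; rewrite ger0_norm; last by lra.
by move: zr; rewrite ler0_norm; lra.
Qed.

Lemma unit_pigeonhole (u : nat -> R) r : 0 < r ->
  (forall n, 0 <= u n < 1) -> exists i j, (i < j)%N /\ `|u j - u i| < r.
Proof.
move=> r0 u01; pose M := (Num.truncn r^-1).+1.
have hM i : (Num.truncn (u i / r) < M)%N.
  have := u01 i => /andP[ui0 ui1].
  rewrite -(@ltr_nat R); apply: (@le_lt_trans _ _ (u i / r)).
    by rewrite truncn_le divr_ge0// ltW.
  apply: (@lt_trans _ _ r^-1); last exact: truncnS_gt.
  by rewrite -[ltRHS]mul1r ltr_pM2r// invr_gt0.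
pose F (i : 'I_M.+1) : 'I_M := Ordinal (hM i).
have : ~~ injectiveb F.
  by apply/negP => /injectiveP /leq_card; rewrite !card_ord ltnn.
move=> /injectivePn[i [j ij Fij]].
have close : `|u j - u i| < r.
  have /(congr1 val)/= e := Fij.
  have b k : (Num.truncn (u k / r))%:R <= u k / r < (Num.truncn (u k / r)).+1%:R.
    by apply: truncn_itv; rewrite divr_ge0 ?(ltW r0)//; case/andP: (u01 k).
  have := b i; have := b j; rewrite -e => /andP[b1 b2] /andP[b3 b4].
  have : `|u j / r - u i / r| < 1.
    by rewrite -natr1 in b2 b4; rewrite ltr_norml; apply/andP; split; lra.
  rewrite -mulrBl normrM [X in _ * X]gtr0_norm ?invr_gt0//.
  by rewrite ltr_pdivrMr// mul1r.
have [lt|lt|e] := ltngtP i j.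
- by exists i, j.
- by exists j, i; split => //; rewrite distrC.
- by move: ij; rewrite (ord_inj e) eqxx.
Qed.

(** Two orbit points closer than [r] differ by some [s], and since no cut comes near the orbit the
    jump repeats: each further [T^q] adds [s]. Staying in [[0, 1[] forces [s = 0], and injectivity
    carries the period back to [x]. *)
Lemma far_orbit_periodic x r : 0 <= x < 1 -> 0 < r ->
  (forall k a, a \in As -> r <= `|iter k T x - a|) ->
  exists2 q, (0 < q)%N & iter q T x = x.
Proof.
move=> x01 r0 far.
have [i [j [ij close]]] := @unit_pigeonhole (fun n => iter n T x) r r0
  (fun n => etrans (iter_unit n x) x01).
pose q := (j - i)%N; pose w := iter i T x.
have q0 : (0 < q)%N by rewrite subn_gt0.
have qw : iter q T w = iter j T x by rewrite -iterD subnK// ltnW.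
pose s := iter q T w - w.
have step k : iter (k * q) T w = w + s *+ k.
  elim: k => [|k IH]; first by rewrite mulr0n addr0.
  rewrite mulSn addnC iterD mulrS addrCA -IH.
  have <- : iter (k * q) T (iter q T w) - iter (k * q) T w = s.
    apply: (@iter_shift_near _ _ _ r) => //; rewrite ?iter_unit//.
      by rewrite qw.
    by move=> k' a _ aA; rewrite -iterD; exact: far.
  by rewrite subrK.
exists q => //; apply: (@iter_inj i); rewrite -iterD addnC iterD.
apply/eqP; rewrite -subr_eq0 -/w -/s; apply/negP => /negP s0.
have w01 : 0 <= w < 1 by rewrite iter_unit.
have kb k : `|s| *+ k < 1.
  have : 0 <= w + s *+ k < 1 by rewrite -step !iter_unit.
  rewrite -normrMn => wk; rewrite ltr_norml; apply/andP; split; lra.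
have := kb (Num.truncn `|s|^-1).+1; apply/negP; rewrite -leNgt.
rewrite -mulr_natl -ler_pdivrMr ?normr_gt0// mul1r.
exact/ltW/truncnS_gt.
Qed.

(** Among the finitely many orbit points take the one, [w], closest to a cut, at distance [d]. Its
    ball of radius [d] moves rigidly forever, hence shares the period of [w], and one side of it
    reaches the cut. *)
Lemma far_orbit_periodic_interval x r : 0 <= x < 1 -> 0 < r -> As != [::] ->
  (forall k a, a \in As -> r <= `|iter k T x - a|) ->
  exists q a e, [/\ (0 < q)%N, a \in As, 0 < e &
    (forall z, a - e < z < a -> 0 <= z < 1 /\ iter q T z = z) \/
    (forall z, a < z < a + e -> 0 <= z < 1 /\ iter q T z = z)].
Proof.
move=> x01 r0 A0 far; have [q q0 qx] := far_orbit_periodic x01 r0 far.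
pose s := [seq (k, a) | k <- iota 0 q, a <- As].
pose F (p : nat * R) := `|iter p.1 T x - p.2|.
have s0 : s != [::].
  rewrite -size_eq0 size_allpairs size_iota muln_eq0 negb_or size_eq0 A0 andbT.
  by rewrite -lt0n.
have [[k a] /allpairsP[[k' a'] [kq aA [-> ->]]] kmin] := seq_min F s0.
move: kq aA kmin => /=; rewrite mem_iota add0n /= => kq aA kmin.
set w := iter k' T x; pose d := `|w - a'|.
have d0 : 0 < d by apply: lt_le_trans r0 _; exact: far.
have iq m : iter (m * q) T x = x by elim: m => // m IH; rewrite mulSn iterD IH.
have dmin j b : b \in As -> d <= `|iter j T w - b|.
  move=> bA; rewrite -iterD (divn_eq (j + k') q) addnC iterD iq.
  apply: (kmin (_, b)); apply/allpairsP; exists ((j + k') %% q, b)%N; split => //=.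
  by rewrite mem_iota add0n ltn_mod.
have w01 : 0 <= w < 1 by rewrite iter_unit.
have qw : iter q T w = w by rewrite -iterD addnC iterD qx.
have per z : 0 <= z < 1 -> `|z - w| < d -> iter q T z = z.
  move=> z01 zw.
  have := iter_shift_near w01 z01 zw (fun j b _ bA => dmin j b bA) : iter q T _ - _ = _.
  by rewrite qw => h; apply: (addIr (- w)).
exists q, a', d; split => //.
have [a0 a1] := andP (cut_in hT aA); have [w0 w1] := andP w01.
have [wa|/ltW aw] := leP w a'.
  have dE : d = a' - w by rewrite /d ler0_norm; lra.
  left => z; rewrite dE => zi; have z01 : 0 <= z < 1 by lra.
  by split => //; apply: per => //; rewrite dE ger0_norm; lra.
have dE : d = w - a' by rewrite /d ger0_norm; lra.
right => z; rewrite dE => zi; have z01 : 0 <= z < 1 by lra.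
by split => //; apply: per => //; rewrite dE ler0_norm; lra.
Qed.
End CutMap.

(** * Invariance of Lebesgue measure and recurrence *)

Section Measure.
Context {R : realType}.
Notation mu := (@lebesgue_measure R).

Lemma le_lebesgue (A B : set R) : measurable A -> measurable B ->
  A `<=` B -> (mu A <= mu B)%E.
Proof. by move=> mA mB AB; apply: le_measure; rewrite ?inE. Qed.

Lemma lebesgue_bigcup_seq_const_le (I : choiceType) (s : seq I) (F : I -> set R) (c : R) :
  (forall i, i \in s -> measurable (F i)) ->
  (forall i, i \in s -> (mu (F i) <= c%:E)%E) ->
  (mu (\bigcup_(i in [set` s]) F i) <= (c *+ size s)%:E)%E.
Proof.
rewrite bigcup_seq; elim: s => [|i s IH] mF Fc.
  by rewrite big_nil measure0 mulr0n.
have mB : measurable (\big[setU/set0]_(j <- s) F j).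
  by rewrite big_seq; apply: bigsetU_measurable => j js; apply: mF; rewrite inE js orbT.
rewrite big_cons /= mulrS EFinD.
apply: le_trans (measureU2 mu (mF i (mem_head _ _)) mB) _; apply: leeD.
  by apply: Fc; rewrite mem_head.
by apply: IH => j js; [apply: mF|apply: Fc]; rewrite inE js orbT.
Qed.

Lemma lebesgue_measure_shift (c : R) (B : set R) : measurable B ->
  mu ((fun x => x + c) @^-1` B) = mu B.
Proof.
move=> mB.
have mS : measurable_fun [set: R] (fun x : R => x + c : measurableTypeR R).
  exact: measurable_funD.
have -> : mu ((fun x => x + c) @^-1` B) = pushforward mu (fun x : R => x + c : measurableTypeR R) B by [].
apply/esym; move: B mB.
apply: (@lebesgue_measure_unique _ (pushforward mu (fun x : R => x + c : measurableTypeR R))) => _ [[a b]] _ <-.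
have E : (fun x : R => x + c) @^-1` `]a, b]%classic = `]a - c, b - c]%classic.
  by apply/seteqP; split => x /=; rewrite !in_itv/= => ?; lra.
apply: (@etrans _ _ (mu `]a - c, b - c]%classic)); last by rewrite -E.
rewrite !lebesgue_measure_itv/= !lte_fin ltrD2r; case: ifPn => // _.
by rewrite -!EFinB; congr (_%:E); ring.
Qed.

Context (T : R -> R) (As : seq R) (hT : cut_translation T As).

Lemma measurable_iter n : measurable_fun [set: R] (iter n T).
Proof.
elim: n => [|n IH]; first exact: measurable_id.
exact: (measurableT_comp (cut_measurable hT) IH).
Qed.

Lemma measurable_preimage_iter n (B : set R) : measurable B ->
  measurable (iter n T @^-1` B).
Proof. by move=> mB; rewrite -[X in measurable X]setTI; exact: measurable_iter. Qed.

Lemma measure_preimage_iter n (B : set R) : measurable B ->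
  mu (iter n T @^-1` B) = mu B.
Proof.
elim: n B => // n IH B mB.
have -> : iter n.+1 T @^-1` B = iter n T @^-1` (T @^-1` B) by [].
rewrite IH ?(cut_preserving hT)//; exact: (measurable_preimage_iter 1).
Qed.

Lemma measure_unit : mu (`[0, 1[ : set R) = 1%E.
Proof. by rewrite lebesgue_measure_itv/= lte_fin ltr01 oppr0 adde0. Qed.

Definition recurrent (F : set R) : set R :=
  [set x | `[0, 1[%classic x /\ forall m, exists2 k, (m <= k)%N & F (iter k T x)].

Lemma recurrent_bigcap (F : set R) : F `<=` `[0, 1[ ->
  recurrent F = \bigcap_m \bigcup_(k in [set k | (m <= k)%N]) (iter k T @^-1` F).
Proof.
move=> F01; apply/seteqP; split => x /=.
  by move=> [_ h] m _; have [k mk Fk] := h m; exists k.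
move=> h; split; last by move=> m; have [k /= mk Fk] := h m I; exists k.
by have [k _ /F01/=] := h 0%N I; rewrite !in_itv/= (iter_unit hT).
Qed.

Lemma measurable_recurrent (F : set R) : measurable F -> F `<=` `[0, 1[ -> measurable (recurrent F).
Proof.
move=> mF F01; rewrite recurrent_bigcap//; apply: bigcap_measurable => [|m _]; first by exists 0%N.
by apply: bigcup_measurable => k _; exact: measurable_preimage_iter.
Qed.

(** The tail unions decrease and each contains a preimage of [F], of the same measure; continuity
    from above applies because they lie in [[0, 1[]. *)
Lemma measure_recurrent (F : set R) : measurable F -> F `<=` `[0, 1[ -> (mu F <= mu (recurrent F))%E.
Proof.
move=> mF F01; rewrite recurrent_bigcap//.
set U := fun m => \bigcup_(k in [set k | (m <= k)%N]) (iter k T @^-1` F).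
have mU m : measurable (U m).
  by apply: bigcup_measurable => k _; exact: measurable_preimage_iter.
have FU m : (mu F <= mu (U m))%E.
  rewrite -(measure_preimage_iter m mF); apply: le_lebesgue => //.
    exact: measurable_preimage_iter.
  by move=> x Fx; exists m => /=.
have cU : mu (U m) @[m --> \oo] --> mu (\bigcap_m U m).
  apply: nonincreasing_cvg_mu => //.
  - apply: (@le_lt_trans _ _ (mu (`[0, 1[%classic : set R))); last by rewrite measure_unit ltry.
    apply: le_lebesgue => // x [k _ /F01/=].
    by rewrite !in_itv/= (iter_unit hT).
  - exact: bigcapT_measurable.
  - move=> m n mn; apply/subsetPset => x [k /= nk Fk]; exists k => //=.
    exact: leq_trans nk.
apply: (cvge_to_ge cU).
by near=> m; exact: FU.
Unshelve. all: by end_near.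
Qed.
End Measure.

Section Ergodic.
Context {R : realType} (T : R -> R) (As : seq R) (hT : cut_translation T As).
Notation mu := (@lebesgue_measure R).

Lemma recurrent_invariant (F : set R) x : `[0, 1[%classic x -> recurrent T F (T x) <-> recurrent T F x.
Proof.
move=> x01; split => -[_ h]; split.
- by [].
- move=> m; have [k mk Fk] := h m; exists k.+1; first exact: leqW.
  by rewrite iterSr.
- by move: x01; rewrite /= !in_itv/= (cut_unit hT).
- move=> m; have [[//|k] mk Fk] := h m.+1; exists k => //.
  by rewrite -iterSr.
Qed.

Lemma recurrent_sub (F : set R) : recurrent T F `<=` `[0, 1[.
Proof. by move=> x []. Qed.

(** Visiting [F] infinitely often, unlike visiting it at least once, is an exactly invariant
    condition, as [ergodic_map] requires. *)
Lemma ergodic_recurrent (F : set R) : ergodic_map mu `[0, 1[ T ->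
  measurable F -> F `<=` `[0, 1[ -> (0 < mu F)%E ->
  mu (`[0, 1[ `\` recurrent T F) = 0%E.
Proof.
move=> erg mF F01 F0.
have [|||rec0|//] := erg (recurrent T F).
- exact: (measurable_recurrent hT).
- exact: recurrent_sub.
- apply/seteqP; split => x /=.
    by move=> [x01 /(recurrent_invariant _ x01)].
  by move=> rx; have x01 := recurrent_sub rx; split => //; apply/recurrent_invariant.
- by have := measure_recurrent hT mF F01; rewrite leNgt rec0 F0.
Qed.

(* A hole around the cuts left by one orbit makes T periodic next to a cut, and
   the saturation of a short interval there is a small invariant set. *)
Lemma far_orbit_split x r eta : 0 <= x < 1 -> 0 < r -> As != [::] ->
  (forall k a, a \in As -> r <= `|iter k T x - a|) -> 0 < eta ->
  exists K J : set R, [/\ measurable K /\ measurable J, K `<=` `[0, 1[,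
    forall z, 0 <= z < 1 -> K (T z) <-> K z,
    forall z, J z -> 0 <= z < 1 /\ exists2 a, a \in As & 0 < `|z - a| < eta &
    (0 < mu (J `&` K))%E /\ (0 < mu (J `\` K))%E].
Proof.
move=> x01 r0 A0 far eta0.
have [q [a [e [q0 aA e0 per]]]] := far_orbit_periodic_interval hT x01 r0 A0 far.
pose d := Num.min e eta.
have d0 : 0 < d by rewrite lt_min e0.
have de : d <= e by rewrite ge_min lexx.
have deta : d <= eta by rewrite ge_min lexx orbT.
(* With this width the [q] preimages of [I] have total measure at most d / 2, half that of [J]. *)
pose c := d / (2 * q%:R).
have q1 : (1 : R) <= q%:R by rewrite ler1n.
have c0 : 0 < c by rewrite divr_gt0// mulr_gt0// (lt_le_trans ltr01).
have cq : c *+ q = d / 2.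
  by rewrite /c -mulr_natr; field; rewrite gt_eqF// (lt_le_trans ltr01).
have cd : c < d.
  rewrite -[c]mulr1n; apply: (@le_lt_trans _ _ (c *+ q)); last by rewrite cq; lra.
  by rewrite ler_pMn2l//.
have [I [J [mI mJ IJ [muI muJ] Jp0]]] : exists I J : set R, [/\ measurable I, measurable J,
    I `<=` J, mu I = c%:E /\ mu J = d%:E & (forall z, J z -> (0 <= z < 1 /\ iter q T z = z) /\
      0 < `|z - a| < eta)].
  case: per => per; [exists `]a - c, a[%classic, `]a - d, a[%classic |
                     exists `]a, a + c[%classic, `]a, a + d[%classic]; split => //.
  - by move=> z /=; rewrite !in_itv/= => ?; lra.
  - rewrite !lebesgue_measure_itv/= !lte_fin !ifT; [|lra|lra].
    by rewrite -!EFinB; split; congr (_%:E); ring.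
  - move=> z /=; rewrite in_itv/= => zi; split; first by apply: per; lra.
    by rewrite ler0_norm; lra.
  - by move=> z /=; rewrite !in_itv/= => ?; lra.
  - rewrite !lebesgue_measure_itv/= !lte_fin !ifT; [|lra|lra].
    by rewrite -!EFinB; split; congr (_%:E); ring.
  - move=> z /=; rewrite in_itv/= => zi; split; first by apply: per; lra.
    by rewrite ger0_norm; lra.
have Jp z Jz := (Jp0 z Jz).1; have Jeta z Jz := (Jp0 z Jz).2.
(* All preimages together make [K] exactly invariant; as the points of [I] are [q]-periodic, the
   first [q] preimages already exhaust it. *)
pose K := \bigcup_(k in [set: nat]) (iter k T @^-1` I).
have KE : K = \bigcup_(k in [set` iota 0 q]) (iter k T @^-1` I).
  apply/seteqP; split => z; last by move=> [k _ Ik]; exists k.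
  move=> [k _]; rewrite {1}(divn_eq k q) => Ik; exists (k %% q)%N.
    by rewrite /= mem_iota add0n ltn_mod.
  elim: (k %/ q)%N Ik => // m IH.
  rewrite mulSn -addnA => Ik; apply: IH => /=; move: Ik.
  set w := iter (m * q + k %% q) T z; rewrite /= iterD -/w => Iw.
  have [_ /(iter_inj hT) e1] := Jp _ (IJ _ Iw).
  by move: Iw; rewrite e1.
have mpre k : measurable (iter k T @^-1` I) by exact: (measurable_preimage_iter hT).
have mK : measurable K by apply: bigcup_measurable => k _.
have muK : (mu K <= (d / 2)%:E)%E.
  rewrite KE -cq -[q in (c *+ q)](size_iota 0).
  apply: lebesgue_bigcup_seq_const_le => // k _.
  by rewrite (measure_preimage_iter hT)// muI.
have IK : I `<=` K by move=> z Iz; exists 0%N.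
exists K, J; split => //.
- move=> z [k _ /IJ/Jp[+ _]].
  by rewrite /= in_itv/= (iter_unit hT).
- move=> z z01; split => [[k _ Ik]|[k _ Ik]].
    by exists k.+1 => //; rewrite /preimage /mkset iterSr.
  case: k Ik => [/= Ik|k Ik]; last by exists k => //; rewrite /preimage /mkset -iterSr.
  exists q.-1 => //; rewrite /preimage /mkset -iterSr prednK//.
  by have [_ ->] := Jp _ (IJ _ Ik).
- by move=> z Jz; split; [exact: (Jp _ Jz).1 | exists a => //; exact: Jeta].
- split.
    apply: lt_le_trans (le_lebesgue mI (measurableI _ _ mJ mK) _).
      by rewrite muI lte_fin.
    by move=> z Iz; split; [exact: IJ|exact: IK].
  have e1 : mu J = (mu (J `\` K) + mu (J `&` K))%E := measureDI mu mJ mK.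
  rewrite lt0e measure_ge0 andbT; apply/eqP => e2.
  have : (mu (J `&` K) <= (d / 2)%:E)%E.
    by apply: le_trans muK; apply: le_lebesgue => //; exact: measurableI.
  by move: e1; rewrite muJ e2 add0e => <-; rewrite lee_fin; lra.
Qed.
End Ergodic.

(** * Density of the preimages of the cuts, and slowly returning intervals *)

Section Tower.
Context {R : realType} (T : R -> R) (As : seq R) (hT : cut_translation T As).
Notation mu := (@lebesgue_measure R).

(** As long as the interval moves rigidly, a cut between the images of [x] and [z] is itself the
    image of the intermediate point [x + (a - iter k T x)]. *)
Lemma iter_shift_uncut n x y : 0 <= x -> x <= y -> y < 1 ->
  (forall k z, (k < n)%N -> x < z <= y -> iter k T z \notin As) ->
  forall k z, (k <= n)%N -> x <= z <= y -> iter k T z - iter k T x = z - x.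
Proof.
move=> x0 xy y1 uncut; elim=> // k IH z kn /andP[xz zy].
have {}IH z' := IH z' (ltnW kn).
have b z' : 0 <= z' < 1 -> 0 <= iter k T z' < 1 by rewrite (iter_unit hT).
have x01 : 0 <= iter k T x < 1 by apply: b; lra.
have z01 : 0 <= iter k T z < 1 by apply: b; lra.
have e := IH z ltac:(lra); rewrite /= (cut_shift hT) //; [lra|lra|lra|].
move=> a aA; apply/negP => ha; pose z' := x + (a - iter k T x).
have hz' : x < z' <= y by rewrite /z'; lra.
have := IH z' ltac:(lra); rewrite {2}/z' => e'.
have := uncut k z' kn hz'; have -> : iter k T z' = a by lra.
by rewrite aA.
Qed.

(** If no point of the interval ever met a cut, the midpoint would stay half the length away from
    all cuts, and [far_orbit_split] would give an invariant set that is neither null nor conull. *)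
Lemma ergodic_cuts_dense u v : ergodic_map mu `[0, 1[ T -> As != [::] ->
  0 <= u -> u < v -> v <= 1 -> exists j z, u < z < v /\ iter j T z \in As.
Proof.
move=> erg A0 u0 uv v1; apply: contrapT => nocut.
have uncut k z : u < z < v -> iter k T z \notin As.
  by move=> uzv; apply/negP => hz; apply: nocut; exists k, z.
pose y := (u + v) / 2; pose r := (v - u) / 2.
have y01 : 0 <= y < 1 by rewrite /y; lra.
have r0 : 0 < r by rewrite /r; lra.
have far k a : a \in As -> r <= `|iter k T y - a|.
  move=> aA; rewrite leNgt; apply/negP => close.
  pose z := y + (a - iter k T y).
  have uzv : u < z < v.
    by move: close; rewrite ltr_norml /z /r /y => /andP[]; lra.
  suff e : iter k T z = a by have := uncut k z uzv; rewrite e aA.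
  have [yz|/ltW zy] := leP y z.
    have := @iter_shift_uncut k y z ltac:(lra) yz ltac:(lra)
      (fun k' z' _ hz' => uncut k' z' ltac:(rewrite /y in hz'; lra)) k z (leqnn k) ltac:(lra).
    by rewrite /z; lra.
  have := @iter_shift_uncut k z y ltac:(lra) zy ltac:(lra)
    (fun k' z' _ hz' => uncut k' z' ltac:(rewrite /y in hz'; lra)) k y (leqnn k) ltac:(lra).
  by rewrite /z; lra.
have [K [J [[mK mJ] K01 Kinv Jp [JK JDK]]]] := far_orbit_split hT y01 r0 A0 far ltr01.
have mJK : measurable (J `&` K) := measurableI _ _ mJ mK.
have mJDK : measurable (J `\` K) := measurableD mJ mK.
have [|||K0|K0] := erg K.
- exact: mK.
- exact: K01.
- apply/seteqP; split => z /=; first by rewrite in_itv/= => -[z01 /Kinv]; apply.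
  by move=> Kz; have := K01 _ Kz; rewrite /= in_itv/= => z01; split=> //; apply/Kinv.
- have : (mu (J `&` K) <= mu K)%E by apply: le_lebesgue => // z [].
  by rewrite leNgt K0 JK.
- have : (mu (J `\` K) <= mu (`[0%R, 1%R[ `\` K))%E.
    apply: le_lebesgue => //; first exact: measurableD.
    by move=> z [/Jp[z01 _] nK]; split => //; rewrite /= in_itv.
  by rewrite leNgt K0 JDK.
Qed.

Lemma cut_times_finite n : exists s : seq R, forall z,
  z \in s <-> exists2 j, (j < n)%N & iter j T z \in As.
Proof.
pose pre j a := xget 0 [set z | iter j T z = a].
pose s := [seq pre j a | j <- iota 0 n, a <- As].
(* The filter discards the default value 0 that [pre] takes when [a] has no preimage, unless 0
   itself qualifies. *)
exists [seq z <- s | `[< exists2 j, (j < n)%N & iter j T z \in As >]] => z.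
rewrite mem_filter; split => [/andP[/asboolP//]|[j jn hz]].
apply/andP; split; first by apply/asboolP; exists j.
apply/allpairsP; exists (j, iter j T z); split => //=; first by rewrite mem_iota.
rewrite /pre; case: xgetP => [w _ /= e|/(_ z)]; last by case.
exact/esym/(iter_inj hT e).
Qed.

(* The base is the shorter of the two halves of a gap between cuts of age < n,
   split by the first younger cut c, of age m: a return of the base before time
   m would produce a cut of age < m inside the gap. *)
Lemma ergodic_slow_base delta : ergodic_map mu `[0, 1[ T -> As != [::] -> 0 < delta ->
  exists al be m, [/\ 0 <= al < be /\ be < 1, be - al <= delta,
    forall a, a \in As -> ~~ (al < a < be),
    (exists2 i, (i <= m)%N & iter i T al \in As) /\
    (exists2 i, (i <= m)%N & iter i T be \in As) &
    forall x k, al <= x < be -> (0 < k <= m)%N -> ~~ (al <= iter k T x < be)].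
Proof.
move=> erg A0 delta0; pose d := Num.min delta 1.
have d0 : 0 < d by rewrite lt_min delta0 ltr01.
have d1 : d <= 1 by rewrite ge_min lexx orbT.
have dd : d <= delta by rewrite ge_min lexx.
have [j1 [z1 [hz1 cz1]]] := ergodic_cuts_dense erg A0 (lexx 0) d0 d1.
have [j2 [z2 [hz2 cz2]]] := @ergodic_cuts_dense z1 d erg A0 ltac:(lra) ltac:(lra) d1.
(* Both [z1] and [z2] meet a cut before time [n], so the shortest gap between such points is no
   longer than [delta]. *)
pose n := (maxn j1 j2).+1.
have [s sP] := cut_times_finite n.
pose pairs := [seq p <- [seq (x, y) | x <- s, y <- s] | [&& 0 <= p.1, p.1 < p.2 & p.2 < 1]].
have z12 : (z1, z2) \in pairs.
  rewrite mem_filter /=; apply/andP; split; first by apply/and3P; split; lra.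
  apply/allpairsP; exists (z1, z2); split => //=; apply/sP.
    by exists j1 => //; rewrite ltnS leq_maxl.
  by exists j2 => //; rewrite ltnS leq_maxr.
have pairs0 : pairs != [::] by apply: contraTneq z12 => ->.
have [[al be] + pmin] := seq_min (fun p : R * R => p.2 - p.1) pairs0.
rewrite mem_filter /= => /andP[/and3P[al0 albe be1] /allpairsP[[x' y'] [/= alS beS [ex ey]]]].
move: alS beS; rewrite -ex -ey => alS beS {x' y' ex ey}.
have old z : al < z < be -> z \notin s.
  move=> hz; apply/negP => zs; have : (al, z) \in pairs.
    rewrite mem_filter /=; apply/andP; split; first by apply/and3P; split; lra.
    by apply/allpairsP; exists (al, z).
  by move=> /pmin /=; lra.
have width : be - al <= delta by have := pmin _ z12; rewrite /=; lra.
have ex : exists m, `[< exists2 z, al < z < be & iter m T z \in As >].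
  have [m [z [hz cz]]] := ergodic_cuts_dense erg A0 al0 albe (ltW be1).
  by exists m; apply/asboolP; exists z.
case: (ex_minnP ex) => m /asboolP[c hc mc] mmin.
have young k z : (k < m)%N -> al < z < be -> iter k T z \notin As.
  move=> km hz; apply/negP => kz; have : (m <= k)%N by apply: mmin; apply/asboolP; exists z.
  by rewrite leqNgt km.
have nm : (n <= m)%N.
  by rewrite leqNgt; apply/negP => mn; have /negP := old _ hc; apply; apply/sP; exists m.
have shift x y k : al <= x -> x <= y -> y < be -> (k <= m)%N ->
    iter k T y - iter k T x = y - x.
  move=> alx xy ybe km; apply: (@iter_shift_uncut m x y) => //; [lra|lra| |lra].
  by move=> k' z k'm hz; apply: young => //; lra.
have noreturn k : (0 < k <= m)%N -> ~~ (al < iter k T c < be).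
  move=> /andP[k0 km]; apply/negP => hk.
  have lt : (m - k < m)%N by rewrite ltn_subrL k0 (leq_trans k0 km).
  by have := young _ _ lt hk; rewrite -iterD subnK// mc.
have noA a : a \in As -> ~~ (al < a < be).
  move=> aA; apply/negP => ha; have m0 : (0 < m)%N by apply: leq_trans nm.
  by have := young _ _ m0 ha; rewrite /= aA.
have ageal : exists2 i, (i <= m)%N & iter i T al \in As.
  by have /sP[i ii ia] := alS; exists i => //; exact: leq_trans (ltnW ii) nm.
have agebe : exists2 i, (i <= m)%N & iter i T be \in As.
  by have /sP[i ii ia] := beS; exists i => //; exact: leq_trans (ltnW ii) nm.
(* If [x] returned to the shorter half at time [k], then [c], at constant distance from [x], would
   be sent into the whole gap, because its distance to [x] is at most the length of the other half.
   This is what [noreturn] forbids. *)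
have [left|right] := leP (c - al) (be - c).
  exists al, c, m; split => //.
  - by split; lra.
  - lra.
  - by move=> a /noA; apply: contra; lra.
  - by split => //; exists m.
  - move=> x k hx hk; apply/negP => hkx; have /negP := noreturn k hk; apply.
    have := @shift x c k ltac:(lra) ltac:(lra) ltac:(lra) (andP hk).2; lra.
exists c, be, m; split => //.
- by split; lra.
- lra.
- by move=> a /noA; apply: contra; lra.
- by split => //; exists m.
- move=> x k hx hk; apply/negP => hkx; have /negP := noreturn k hk; apply.
  have := @shift c x k ltac:(lra) ltac:(lra) ltac:(lra) (andP hk).2; lra.
Qed.
End Tower.

(** * Orbits approaching a cut at the scale of a Rokhlin tower *)

Section CloseApproach.
Context {R : realType} (T : R -> R) (As : seq R) (hT : cut_translation T As).
Notation mu := (@lebesgue_measure R).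

Lemma measure_disjoint_preimages (P : set R) N : measurable P ->
  (forall y k, P y -> (0 < k < N)%N -> ~ P (iter k T y)) ->
  mu (\bigcup_(j in [set j | (j < N)%N]) (iter j T @^-1` P)) = (mu P *+ N)%E.
Proof.
move=> mP nr.
rewrite (_ : \bigcup_(j in _) _ = \big[setU/set0]_(j < N) (iter j T @^-1` P)); last first.
  exact: (bigcup_mkord N (fun j => iter j T @^-1` P)).
pose F (j : 'I_N) : set R := iter j T @^-1` P.
have mF j : measurable (F j) by exact: (measurable_preimage_iter hT).
have tF : trivIset [set: 'I_N] F.
  move=> i j _ _ [x [Fi Fj]]; apply/val_inj.
  wlog ij : i j Fi Fj / (i <= j)%N.
    by move=> wl; have [ij|/ltnW ij] := leqP i j; [exact: wl|apply/esym/wl].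
  move: ij; rewrite leq_eqVlt => /predU1P[//|ij]; exfalso.
  apply: (nr _ (j - i)%N Fi); first by rewrite subn_gt0 ij (leq_ltn_trans (leq_subr _ _)).
  by rewrite -iterD subnK// ltnW.
have := measure_bigsetU_ord mu xpredT mF tF; rewrite /F => ->.
transitivity (\sum_(j < N) mu P)%E; last by rewrite sumr_const card_ord.
by apply: eq_bigr => j _; exact: (measure_preimage_iter hT).
Qed.

Section Returns.
Context (al be : R) (al0 : 0 <= al) (albe : al < be) (be1 : be < 1).
Context (noA : forall a, a \in As -> ~~ (al < a < be)).

Let D z := al <= z < be.
Definition returns z k := D (iter k T z).
Definition no_return z k := forall j, (0 < j < k)%N -> ~~ returns z j.

Lemma no_return_le z j k : (j <= k)%N -> no_return z k -> no_return z j.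
Proof.
by move=> jk nk i /andP[i0 ij]; apply: nk; rewrite i0 (leq_trans ij jk).
Qed.

(* The first return to [al, be[ is locally a translation except at such points, for
   e = al, be or e in As, and there is at most one of them for each e. *)
Definition cut_at (e : R) : set R :=
  [set z | D z /\ exists2 k, (0 < k)%N & iter k T z = e /\ no_return z k].

(** If two points of [[al, be[] reach [e] at different times, the slower orbit passes through the
    faster point, by injectivity, and so returns too early. *)
Lemma cut_at_unique e z z' : cut_at e z -> cut_at e z' -> z = z'.
Proof.
wlog : z z' / exists k k', [/\ (0 < k <= k')%N, iter k T z = e, iter k' T z' = e,
    D z & no_return z' k'].
  move=> wl c c'; have [Dz [k k0 [ke nk]]] := c; have [Dz' [k' k0' [ke' nk']]] := c'.
  have [kk|kk] := leqP k k'; first by apply: wl => //; exists k, k'; rewrite k0.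
  by apply/esym; apply: wl => //; exists k', k; rewrite k0' (ltnW kk).
move=> [k [k' [/andP[k0 kk'] ke ke' Dz nk]]] _ _.
have e1 : z = iter (k' - k) T z'.
  by apply: (@iter_inj _ _ _ hT k); rewrite -iterD subnKC// ke'.
move: kk'; rewrite leq_eqVlt => /predU1P[kk|kk]; first by rewrite e1 kk subnn.
have lt : (0 < k' - k < k')%N by rewrite subn_gt0 kk ltn_subrL k0 (ltn_trans k0 kk).
by have := nk _ lt; rewrite /returns -e1 Dz.
Qed.

(** Induction on the time: whatever first breaks the rigid motion of [[x, y]], or separates its
    points with respect to [[al, be[], is the image of a point of the interval that has not returned
    yet, hence of a [cut_at] point. *)
Lemma uncut_returns x y k : D x -> x <= y -> D y ->
  (forall e z, e \in al :: be :: As -> x < z <= y -> ~ cut_at e z) ->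
  no_return x k ->
  forall z, x <= z <= y -> [/\ (forall j, (j <= k)%N -> iter j T z - iter j T x = z - x),
    no_return z k & returns z k = returns x k].
Proof.
move=> Dx xy Dy uncut; elim: k => [|k IH] nx z hz.
  split; [by case|by move=> j; rewrite ltn0 andbF|].
  by rewrite /returns/= [RHS]Dx; move: Dx Dy hz; rewrite /D; lra.
have {}IH := IH (no_return_le (leqnSn k) nx).
have Dz w : x <= w <= y -> D w by move: Dx Dy; rewrite /D; lra.
have nr w : x <= w <= y -> no_return w k.+1.
  move=> hw j hj; have [_ nw ek] := IH w hw.
  have /andP[j0] := hj; rewrite ltnS leq_eqVlt => /predU1P[jk|jk]; last by apply: nw; rewrite j0.
  by rewrite jk ek; apply: nx; rewrite -jk j0 ltnSn.
have sh w : x <= w <= y -> iter k.+1 T w - iter k.+1 T x = w - x.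
  move=> hw; have [tw _ _] := IH w hw; have e1 := tw k (leqnn k).
  have b v : x <= v <= y -> 0 <= iter k T v < 1.
    move=> hv; have := Dz v hv; rewrite (iter_unit hT) /D => /andP[v0 v1]; by rewrite (le_trans al0 v0) (lt_trans v1 be1).
  have b1 := b w hw; have xx : x <= x <= y by lra. have b2 := b x xx.
  rewrite /= (cut_shift hT) //; [lra|lra|lra|].
  move=> a aA; apply/negP => ha; pose v := x + (a - iter k T x).
  have hv : x < v <= y by rewrite /v; lra.
  have hv' : x <= v <= y by lra.
  have ev : iter k T v = a.
    by have [/(_ k (leqnn k)) + _ _] := IH v hv'; rewrite {2}/v; lra.
  (* [cut_at] only counts positive times; at time 0 the cut would lie inside []al, be[], against
     [noA]. *)
  have [k0|k0] := posnP k.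
    have := noA aA; apply/negP; rewrite negbK -ev k0 /=.
    by have := Dz v hv'; move: Dx; rewrite /D; lra.
  apply: (uncut a v) => //; first by rewrite !inE aA !orbT.
  split; first exact: Dz.
  by exists k => //; split => //; exact: no_return_le (nr v hv').
split; [|exact: nr|].
- move=> j; rewrite leq_eqVlt => /predU1P[->|]; first exact: sh.
  by rewrite ltnS; have [tw _ _] := IH z hz; exact: tw.
have e1 := sh z hz.
(* If only one of the two images is in [[al, be[], then [al] or [be] lies between them. *)
have hit e : e \in [:: al; be] -> iter k.+1 T x < e <= iter k.+1 T z -> False.
  move=> eab he; pose v := x + (e - iter k.+1 T x).
  have hv' : x <= v <= y by rewrite /v; lra.
  have ev : iter k.+1 T v = e by have := sh v hv'; rewrite {2}/v; lra.
  apply: (uncut e v); [by move: eab; rewrite !inE orbA => ->|by rewrite /v; lra|].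
  by split; [exact: Dz|exists k.+1 => //; split => //; exact: nr].
rewrite /returns; apply/idP/idP => h; apply: contrapT => /negP h'.
- apply: (hit al); first by rewrite !inE eqxx.
  have := Dz z hz; move: Dx h h'; rewrite /D; lra.
- apply: (hit be); first by rewrite !inE eqxx orbT.
  have := Dz z hz; move: Dx h h'; rewrite /D; lra.
Qed.


Context (m : nat).
Context (age : forall e, e \in al :: be :: As -> exists2 i, (i <= m)%N & iter i T e \in As).
Context (slow : forall x k, D x -> (0 < k <= m)%N -> ~~ D (iter k T x)).

(** When no point satisfies [cut_at e], [xget] falls back on [al], which is an end anyway. The list
    has length [size As + 3], the source of this number in the bounds below. *)
Definition piece_ends : seq R := al :: [seq xget al (cut_at e) | e <- al :: be :: As].

Definition piece (z : R) : set R :=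
  [set y | D y /\ z <= y /\ forall z', z' \in piece_ends -> ~~ (z < z' <= y)].

Lemma D_al : D al. Proof. by rewrite /D lexx albe. Qed.

Lemma piece_ends_D z : z \in piece_ends -> D z.
Proof.
rewrite inE => /predU1P[->|/mapP[e _ ->]]; first exact: D_al.
by case: xgetP => [w _ []//|_]; exact: D_al.
Qed.

Lemma cut_at_piece_ends e z : e \in al :: be :: As -> cut_at e z -> z \in piece_ends.
Proof.
move=> eE ce; rewrite inE; apply/orP; right; apply/mapP; exists e => //.
by case: xgetP => [w _ cw|/(_ z)//]; exact: (cut_at_unique ce cw).
Qed.

Lemma piece_cover y : D y -> exists2 z, z \in piece_ends & piece z y.
Proof.
move=> Dy; pose s := [seq z <- piece_ends | z <= y].
have als : al \in s by rewrite mem_filter inE eqxx andbT; case/andP: Dy.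
have s0 : s != [::] by apply: contraTneq als => ->.
have [z + zmax] := seq_min (fun z => - z) s0.
rewrite mem_filter => /andP[zy zP]; exists z => //; split => //; split => // z' z'P.
apply/negP => /andP[zz' z'y]; have : z' \in s by rewrite mem_filter z'y.
by move=> /zmax; rewrite lerN2 leNgt zz'.
Qed.

Lemma piece_interval z y w : z \in piece_ends -> piece z y -> z <= w <= y -> piece z w.
Proof.
move=> /piece_ends_D Dz [Dy [zy nz]] hw; split; first by move: Dz Dy; rewrite /D; lra.
by split; [lra|move=> z' /nz; apply: contra; lra].
Qed.

Lemma measurable_piece z : z \in piece_ends -> measurable (piece z).
Proof.
move=> zP; apply: is_interval_measurable => x y Px Py w hw.
by apply: (piece_interval zP Py); case: Px => _ [zx _]; lra.
Qed.

Lemma piece_returns z y k : z \in piece_ends -> piece z y -> no_return z k ->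
  no_return y k /\ returns y k = returns z k.
Proof.
move=> zP [Dy [zy nz]] nk.
have uncut e z' : e \in al :: be :: As -> z < z' <= y -> ~ cut_at e z'.
  by move=> eE hz' /(cut_at_piece_ends eE)/nz; rewrite hz'.
by have [_ nr eqr] := uncut_returns (piece_ends_D zP) zy Dy uncut nk (z := y) ltac:(lra).
Qed.

Lemma piece_measure z y : z \in piece_ends -> piece z y -> ((y - z)%:E <= mu (piece z))%E.
Proof.
move=> zP Py; have zy : z <= y by case: Py => _ [].
have -> : (y - z)%:E = mu `[z, y].
  rewrite lebesgue_measure_itv/= lte_fin; case: ltP => [_|yz]; first by rewrite EFinB.
  by rewrite (@le_anti _ _ z y) ?zy// subrr.
apply: le_lebesgue => //; first exact: measurable_piece.
by move=> w /=; rewrite in_itv/= => hw; exact: (piece_interval zP Py).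
Qed.

(** An end other than [al] meets some [e] no later than its return time [h], and [e] meets a cut
    within [m] more steps; slowness gives [m < h], hence the factor 2. *)
Lemma piece_ends_hit z h : z \in piece_ends -> (0 < h)%N -> returns z h ->
  exists2 k, (k < h.*2)%N & iter k T z \in As.
Proof.
move=> zP h0 rh.
have mh : (m < h)%N.
  rewrite ltnNge; apply/negP => hm.
  by have := slow (piece_ends_D zP) (k := h); rewrite h0 hm => /(_ isT)/negP.
have alhit : exists2 k, (k < h.*2)%N & iter k T al \in As.
  have [i im ia] := age (mem_head al (be :: As)); exists i => //.
  by rewrite (leq_ltn_trans im)// (leq_trans mh)// -addnn leq_addr.
move: zP rh; rewrite inE => /predU1P[->//|/mapP[e eE ->]].
case: xgetP => [w _ [_ [k k0 [ke nk]]] rw|//].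
have kh : (k <= h)%N.
  by rewrite leqNgt; apply/negP => hk; have := nk h; rewrite h0 hk rw => /(_ isT).
have [i im ia] := age eE; exists (i + k)%N; last by rewrite iterD ke.
by rewrite -addnn -addSn leq_add// (leq_ltn_trans im).
Qed.

(** [y] accompanies [z] until [z] hits a cut, unless a cut separates them earlier; in both cases [y]
    is then within [y - z] of a cut. *)
Lemma piece_close z h y : z \in piece_ends -> (0 < h)%N -> returns z h -> piece z y ->
  exists k a, [/\ (k < h.*2)%N, a \in As & `|iter k T y - a| <= y - z].
Proof.
move=> zP h0 rh [Dy [zy _]]; have Dz := piece_ends_D zP.
have [k kh kA] := piece_ends_hit zP h0 rh.
have z0 : 0 <= z by case/andP: Dz => + _; exact: le_trans.
have y1 : y < 1 by case/andP: Dy => _ h1; exact: lt_trans be1.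
have [e|[k' k'k [e [a aA ha]]]] := iter_shift_or_cut hT k z0 zy y1.
  by exists k, (iter k T z); split=> //; rewrite e ger0_norm ?subr_ge0.
exists k', a; split => //; first exact: ltn_trans kh.
by rewrite ger0_norm; lra.
Qed.

End Returns.
End CloseApproach.

Lemma mem_iota_tail n h j : (j <= n)%N -> (n < j + h)%N -> j \in iota (n.+1 - h) h.
Proof. by rewrite mem_iota; lia. Qed.

Lemma mem_iota0 n j : [set` iota 0 n.+1] j <-> (j <= n)%N.
Proof. by rewrite /mkset mem_iota add0n ltnS. Qed.

Section CloseApproachMain.
Context {R : realType} (T : R -> R) (As : seq R) (hT : cut_translation T As).
Notation mu := (@lebesgue_measure R).

(** Almost every point visits [D], so finitely many times already account for more than half of the
    mass. *)
Lemma ergodic_visits (D : set R) : ergodic_map mu `[0, 1[ T ->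
  measurable D -> D `<=` `[0, 1[ -> (0 < mu D)%E ->
  exists n, ((2^-1)%:E < mu (\bigcup_(j in [set` iota 0 n.+1]) (iter j T @^-1` D)))%E.
Proof.
move=> erg mD D01 D0; pose W n := \bigcup_(j in [set` iota 0 n.+1]) (iter j T @^-1` D).
have mpre j : measurable (iter j T @^-1` D) by exact: (measurable_preimage_iter hT).
have mW n : measurable (W n) by apply: bigcup_measurable => j _.
have mUW : measurable (\bigcup_n W n) by apply: bigcupT_measurable.
have cW : mu (W n) @[n --> \oo] --> mu (\bigcup_n W n).
  apply: nondecreasing_cvg_mu => //= m n mn; apply/subsetPset => x [j /mem_iota0 jm Dj].
  by exists j => //; apply/mem_iota0; exact: leq_trans mn.
have full : (1%:E <= mu (\bigcup_n W n))%E.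
  have mrec := measurable_recurrent hT mD D01.
  rewrite -measure_unit.
  have e : mu (`[0%R, 1%R[ : set R) = (mu (`[0%R, 1%R[ `\` recurrent T D) + mu (`[0%R, 1%R[ `&` recurrent T D))%E.
    exact: measureDI.
  rewrite e (ergodic_recurrent hT erg mD D01 D0) add0e.
  apply: le_lebesgue => //; first exact: measurableI.
  move=> x [_ [_ /(_ 0%N)[k _ Dk]]]; by exists k => //; exists k => //; exact/mem_iota0.
apply: contrapT => no; have : (mu (\bigcup_n W n) <= (2^-1)%:E)%E.
  apply: (cvge_to_le cW); near=> n; rewrite leNgt; apply/negP => h.
  by apply: no; exists n.
move=> h; have := le_trans full h; rewrite lee_fin; lra.
Unshelve. all: by end_near. Qed.

(* [al, be[ splits into at most size As + 3 pieces on which the return time is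
   constant. By pigeonhole the tower over one of them, of width l and height h,
   carries mass bounded below, and its points come within l of a cut in time 3 h. *)
Lemma ergodic_close_approach delta : ergodic_map mu `[0, 1[ T -> As != [::] -> 0 < delta ->
  exists (h : nat) (l : R) (X : set R), [/\ 0 < l <= delta,
    l * h%:R <= 1,
    measurable X /\ X `<=` `[0, 1[,
    (((2 * (size As).+3%:R)^-1)%:E <= mu X)%E &
    forall x, X x -> exists k a, [/\ (k < 3 * h)%N, a \in As & `|iter k T x - a| <= l]].
Proof.
move=> erg A0 delta0.
have [al [be [m [[/andP[al0 albe] be1] width noA [ageal agebe] slow]]]] := ergodic_slow_base hT erg A0 delta0.
have age e : e \in al :: be :: As -> exists2 i, (i <= m)%N & iter i T e \in As.
  by rewrite !inE => /or3P[/eqP->|/eqP->|eA] //; exists 0%N.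
pose D : set R := [set z | al <= z < be].
have DE : D = `[al, be[%classic by apply/seteqP; split => z /=; rewrite in_itv.
have mD : measurable D by rewrite DE; exact: measurable_itv.
have muD : mu D = (be - al)%:E by rewrite DE lebesgue_measure_itv/= lte_fin albe EFinB.
have D01 : D `<=` `[0, 1[ by move=> z /=; rewrite /D/= in_itv/=; lra.
have [n Wn] := ergodic_visits erg mD D01 ltac:(by rewrite muD lte_fin subr_gt0).
pose Z := piece_ends T As al be.
pose P := piece T As al be.
have mP z : z \in Z -> measurable (P z) by exact: (measurable_piece albe).
have P01 z : P z `<=` `[0, 1[ by move=> y [/D01].
have PD z : P z `<=` D by move=> y [].
have mpre (B : set R) j : measurable B -> measurable (iter j T @^-1` B).
  exact: (measurable_preimage_iter hT).
have mpP z j : z \in Z -> measurable (iter j T @^-1` P z).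
  by move=> zZ; apply: mpre; exact: mP.
(* Points are sorted by the piece of their last visit to [D] up to time [n]. As a visit to a piece
   is followed by a return after exactly [h] steps, the last one occurs among the last [h] times,
   which will bound [mu (Q z)] by [l h]. *)
pose Q z := \bigcup_(j in [set` iota 0 n.+1]) (iter j T @^-1` P z `\`
  \bigcup_(i in [set i | (j < i <= n)%N]) (iter i T @^-1` D)).
have mQ z : z \in Z -> measurable (Q z).
  move=> zZ; apply: bigcup_measurable => j _; apply: measurableD; first exact: mpP.
  by apply: bigcup_measurable => i _; exact: mpre.
pose c0 : R := (2 * (size As).+3%:R)^-1.
have c00 : 0 < c0 by rewrite invr_gt0 mulr_gt0 ?ltr0n.
have WQ : \bigcup_(j in [set` iota 0 n.+1]) (iter j T @^-1` D) `<=` \bigcup_(z in [set` Z]) Q z.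
  move=> x [j0 /mem_iota0 j0n Dj0].
  pose p := [pred j | (j <= n)%N && `[< D (iter j T x) >]].
  have ex : exists j, p j.
    by exists j0; apply/andP; split => //; exact/asboolP.
  have [] := @ex_maxnP p n ex; first by move=> j /andP[].
  move=> j /andP[jn /asboolP Dj] jmax.
  have [z zZ Pz] := piece_cover T As Dj.
  exists z => //; exists j; first exact/mem_iota0.
  split => // -[i /= /andP[ji ilen] Di].
  have : (i <= j)%N by apply: jmax; apply/andP; split => //; exact/asboolP.
  by rewrite leqNgt ji.
have [z zZ Qz] : exists2 z, z \in Z & (c0%:E <= mu (Q z))%E.
  apply: contrapT => no; move: Wn; apply/negP; rewrite -leNgt.
  apply: (@le_trans _ _ (mu (\bigcup_(z in [set` Z]) Q z))).
    apply: le_lebesgue => //; first by apply: bigcup_measurable => j _; exact: mpre.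
    by rewrite bigcup_seq big_seq; apply: bigsetU_measurable => z zZ; exact: mQ.
  have -> : (2^-1)%:E = (c0 *+ size Z)%:E.
    rewrite /Z /piece_ends /= size_map /= -[c0 *+ _]mulr_natr /c0; congr (_%:E).
    have : ((size As).+3%:R : R) != 0 by rewrite pnatr_eq0.
    by move: (_.+3%:R) => s s0; field.
  apply: lebesgue_bigcup_seq_const_le => // z zZ.
  by rewrite leNgt; apply/negP => h; apply: no; exists z => //; exact: ltW.
have Pfin : (mu (P z) <= 1%:E)%E.
  rewrite -measure_unit; apply: le_lebesgue => //; exact: mP.
pose l := fine (mu (P z)).
have lE : mu (P z) = l%:E.
  by rewrite /l fineK// ge0_fin_numE// (le_lt_trans Pfin)// ltry.
have l0 : 0 <= l by rewrite /l fine_ge0.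
have packed N : (forall y k, P z y -> (0 < k < N)%N -> ~ P z (iter k T y)) ->
  mu (\bigcup_(j in [set j | (j < N)%N]) (iter j T @^-1` P z)) = (l *+ N)%:E /\ l * N%:R <= 1.
  move=> hN; have e : mu (\bigcup_(j in [set j | (j < N)%N]) (iter j T @^-1` P z)) = (l *+ N)%:E.
    by rewrite (measure_disjoint_preimages hT (mP z zZ) hN) lE EFin_natmul.
  split=> //; rewrite mulr_natr -lee_fin -e -measure_unit.
  apply: le_lebesgue => //.
    by apply: bigcup_measurable => j _; exact: mpP.
  by move=> x [j _ /P01]; rewrite /= !in_itv/= (iter_unit hT).
have [h /andP[h0 rh] hmin] : exists2 h, (0 < h)%N && returns T al be z h &
    forall k, (0 < k)%N && returns T al be z k -> (h <= k)%N.
  have [ex|no] := pselect (exists h, (0 < h)%N && returns T al be z h).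
    by case: (ex_minnP ex) => h hh hmin; exists h.
  (* Without a return all preimages of the piece would be disjoint in [[0, 1[], so [l = 0] and [Q z]
     would be null. *)
  have nr k : no_return T al be z k.
    by move=> j /andP[j0 _]; apply/negP => rj; apply: no; exists j; rewrite j0.
  have lN N : l * N%:R <= 1.
    apply: (packed N _).2 => y k Py /andP[k0 _] /PD.
    have [_] := piece_returns hT al0 albe be1 noA zZ Py (nr k).
    rewrite /returns => ek /= Dk; move/negP: (nr k.+1 k ltac:(by rewrite k0 ltnSn)).
    by apply; rewrite /returns -ek.
  have l00 : l = 0.
    apply/eqP; rewrite eq_le l0 andbT leNgt; apply/negP => lpos.
    have := lN (Num.truncn l^-1).+1; apply/negP; rewrite -ltNge.
    by rewrite -ltr_pdivrMl// mulr1 truncnS_gt.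
  have : (mu (Q z) <= (0 *+ size (iota 0 n.+1))%:E)%E.
    apply: lebesgue_bigcup_seq_const_le => [j _|j _].
      apply: measurableD; first exact: mpP.
      by apply: bigcup_measurable => i _; exact: mpre.
    apply: (@le_trans _ _ (mu (iter j T @^-1` P z))).
      apply: le_lebesgue; [|exact: mpP|by move=> x []].
      apply: measurableD; first exact: mpP.
      by apply: bigcup_measurable => i _; exact: mpre.
    by rewrite (measure_preimage_iter hT) ?lE ?l00//; exact: mP.
  by rewrite mul0rn => /(le_trans Qz); rewrite lee_fin leNgt c00.
have nrh : no_return T al be z h.
  move=> j /andP[j0 jh]; apply/negP => rj; have := hmin j; rewrite j0 rj => /(_ isT).
  by rewrite leqNgt jh.
have [muX lh] := packed h ltac:(
  move=> y k Py /andP[k0 kh] /PD Dk;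
  have [nry _] := piece_returns hT al0 albe be1 noA zZ Py nrh;
  by have /negP := nry k ltac:(by rewrite k0 kh); apply).
have c0h : c0 <= l *+ h.
  rewrite -lee_fin; apply: (le_trans Qz).
  rewrite -[h in (l *+ h)](size_iota (n.+1 - h)).
  apply: (@le_trans _ _ (mu (\bigcup_(j in [set` iota (n.+1 - h) h]) (iter j T @^-1` P z)))).
    apply: le_lebesgue; first exact: mQ.
      by apply: bigcup_measurable => i _; exact: mpP.
    move=> x [j /mem_iota0 jn [Pj nj]]; exists j => //; apply: mem_iota_tail => //.
    rewrite ltnNge; apply/negP => jh; apply: nj; exists (j + h)%N => /=.
      by rewrite -addn1 leq_add2l h0 jh.
    have [_ e] := piece_returns hT al0 albe be1 noA zZ Pj nrh.
    by move: rh; rewrite -e /returns -iterD addnC.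
  apply: lebesgue_bigcup_seq_const_le => j _; [exact: mpP|].
  by rewrite (measure_preimage_iter hT) ?lE//; exact: mP.
exists h, l, (\bigcup_(j in [set j | (j < h)%N]) (iter j T @^-1` P z)); split => //.
- apply/andP; split.
    by rewrite lt_neqAle l0 andbT eq_sym; apply: contraTneq c0h => ->; rewrite mul0rn -ltNge.
  rewrite -lee_fin -lE; apply: (@le_trans _ _ (mu D)); last by rewrite muD lee_fin.
  by apply: le_lebesgue => //; exact: mP.
- split; first by apply: bigcup_measurable => j _; exact: mpP.
  by move=> x [j _ /P01]; rewrite /= !in_itv/= (iter_unit hT).
- by rewrite muX lee_fin.
- move=> x [j /= jh Pj].
  have [k [a [kh aA ka]]] := piece_close hT al0 albe be1 age slow zZ h0 rh Pj.
  (* Fewer than [h] steps lead to the piece, and fewer than 2 h more to a cut. *)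
  exists (k + j)%N, a; split => //; first by rewrite mulSn mul2n addnC -addSn leq_add // ltnW.
  rewrite iterD (le_trans ka)// -lee_fin -lE.
  exact: (piece_measure albe).
Qed.
End CloseApproachMain.

(** * Interval exchanges *)

Section IETCut.
Context {R : realType}.
Notation mu := (@lebesgue_measure R).

(* Extending T by the identity off [0, 1[ gives a total measure-preserving map
   with the same orbits in [0, 1[. *)
Definition extend_id (T : R -> R) (x : R) : R := if 0 <= x < 1 then T x else x.

Lemma iter_extend_id (T : R -> R) n x : `[0, 1[ `<=` T @^-1` `[0, 1[ -> 0 <= x < 1 ->
  iter n (extend_id T) x = iter n T x.
Proof.
move=> T01 x01; suff [] : iter n (extend_id T) x = iter n T x /\ 0 <= iter n T x < 1 by [].
elim: n => //= n [-> IH]; rewrite {1}/extend_id IH; split => //.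
by have := T01 (iter n T x); rewrite /= !in_itv/= IH => /(_ isT).
Qed.

Lemma lebesgue_bigcup_ord N (F : nat -> set R) :
  (forall i, measurable (F i)) ->
  (forall i j x, (i < N)%N -> (j < N)%N -> F i x -> F j x -> i = j) ->
  mu (\bigcup_(i in [set i | (i < N)%N]) F i) = (\sum_(i < N) mu (F i))%E.
Proof.
move=> mF dF; rewrite (_ : \bigcup_(i in _) _ = \big[setU/set0]_(i < N) F i); last exact: bigcup_mkord.
have tF : trivIset [set: 'I_N] (fun i : 'I_N => F i).
  move=> i j _ _ [x [Fi Fj]]; apply: val_inj.
  exact: (dF i j x (ltn_ord i) (ltn_ord j) Fi Fj).
exact: (measure_bigsetU_ord mu xpredT (fun i => mF i) tF).
Qed.

Context (T : R -> R) (As : seq R).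
Context (hT : is_IET T).
Context (hA : forall a, a \in As -> 0 < a < 1).
Context (hdisc : forall x, discontinuities T x -> x \in As).

Lemma IET_unit x : 0 <= x < 1 -> 0 <= T x < 1.
Proof.
by case: hT => -[] + _ _ _ => /(_ x); rewrite /= !in_itv/=.
Qed.

Lemma IET_unit_preimage : `[0, 1[ `<=` T @^-1` `[0, 1[.
Proof. by move=> x /=; rewrite !in_itv/=; exact: IET_unit. Qed.

Lemma extend_id_unit x : (0 <= extend_id T x < 1) = (0 <= x < 1).
Proof. by rewrite /extend_id; case: ifP => // /IET_unit. Qed.

Lemma extend_id_inj : injective (extend_id T).
Proof.
move=> x y e; have := extend_id_unit x; rewrite e extend_id_unit => xy.
move: e; rewrite /extend_id xy; case: ifP => // x01 e.
by case: hT => -[_ inj _] _; apply: inj => //; rewrite inE /= in_itv/= ?xy.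
Qed.

Section Pieces.
Context (N : nat) (a sigma : nat -> R).
Context (a0 : a 0%N = 0).
Context (aN : a N = 1).
Context (amono : forall i, (i < N)%N -> a i < a i.+1).
Context (Tpiece : forall i, (i < N)%N -> forall x, a i <= x < a i.+1 -> T x = x + sigma i).

Lemma breakpoints_le i j : (i <= j)%N -> (j <= N)%N -> a i <= a j.
Proof.
elim: j => [|j IH]; first by rewrite leqn0 => /eqP ->.
rewrite leq_eqVlt => /predU1P[->//|]; rewrite ltnS => ij jN.
by apply: le_trans (IH ij (ltnW jN)) _; exact/ltW/amono.
Qed.

Lemma piece_index x : 0 <= x < 1 -> exists2 i, (i < N)%N & a i <= x < a i.+1.
Proof.
rewrite -a0 -aN => /andP[x0 xN].
suff H n : (n <= N)%N -> x < a n -> exists2 i, (i < n)%N & a i <= x < a i.+1.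
  by have [i iN hi] := H N (leqnn N) xN; exists i.
elim: n => [_|n IH nN xn]; first by rewrite ltNge x0.
have [nx|] := leP (a n) x; first by exists n => //; rewrite nx.
by move=> /(IH (ltnW nN))[i ii hi]; exists i => //; exact: ltnW.
Qed.

Lemma piece_index_unique i j x : (i < N)%N -> (j < N)%N ->
  a i <= x < a i.+1 -> a j <= x < a j.+1 -> i = j.
Proof.
wlog ij : i j / (i <= j)%N.
  by move=> wl iN jN hi hj; have [ij|/ltnW ij] := leqP i j; [exact: wl|apply/esym/wl].
move=> iN jN /andP[_ h1] /andP[h2 _]; move: ij; rewrite leq_eqVlt => /predU1P[//|ij].
by have := breakpoints_le ij (ltnW jN); rewrite leNgt (le_lt_trans h2 h1).
Qed.

Lemma piece_unit i x : (i < N)%N -> a i <= x < a i.+1 -> 0 <= x < 1.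
Proof.
move=> iN /andP[h1 h2]; rewrite -a0 -aN (le_trans _ h1) ?breakpoints_le ?(ltnW iN)//=.
exact: lt_le_trans h2 (breakpoints_le iN (leqnn N)).
Qed.

(** A breakpoint outside [As] is a continuity point of [T], by [hdisc], so the translations on its
    two sides agree there. *)
Lemma sigma_continuity k : (k.+1 < N)%N -> a k.+1 \notin As -> sigma k = sigma k.+1.
Proof.
move=> kN aA; have kN' := ltnW kN; set b := a k.+1.
have b01 : 0 <= b < 1 by apply: (piece_unit kN); rewrite lexx amono.
have cont : T @ within `[0, 1[ (nbhs b) --> T b.
  by apply: contrapT => nc; move/negP: aA; apply; exact: hdisc.
apply/eqP; rewrite -subr_eq0 -normr_le0 leNgt; apply/negP.
set e := `|_|; move=> e0.
have Tb : T b = b + sigma k.+1 by apply: (Tpiece kN); rewrite lexx amono.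
have : \forall z \near within `[0, 1[ (nbhs b), `|T b - T z| < e / 2.
  by move/cvgrPdist_lt : cont => /(_ (e / 2)); apply; rewrite divr_gt0.
rewrite near_withinE => /nbhs_ballP[d /= d0 dP].
pose m := Num.min (Num.min (d / 2) (e / 2)) ((b - a k) / 2).
have ak : 0 < b - a k by rewrite subr_gt0 amono.
have m0 : 0 < m by rewrite !lt_min; apply/andP; split; [apply/andP; split|]; lra.
have md : m <= d / 2 by rewrite !ge_min lexx.
have me : m <= e / 2 by rewrite !ge_min lexx orbT.
have ma : m <= (b - a k) / 2 by rewrite ge_min lexx orbT.
have hz : a k <= b - m < a k.+1 by rewrite -/b; lra.
have := dP (b - m); rewrite /= in_itv/= (piece_unit kN' hz) (Tpiece kN' hz) Tb.
rewrite /ball/= opprB addrC subrK gtr0_norm// => /(_ ltac:(lra) isT).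
have -> : b + sigma k.+1 - (b - m + sigma k) = - (sigma k - sigma k.+1) + m by ring.
move=> h; have := ler_normB (- (sigma k - sigma k.+1) + m) m.
rewrite addrK normrN -/e (gtr0_norm m0); lra.
Qed.

Lemma extend_id_shift x y : 0 <= x -> x <= y -> y < 1 ->
  (forall a, a \in As -> ~~ (x < a <= y)) -> extend_id T y - extend_id T x = y - x.
Proof.
move=> x0 xy y1 noA.
have x01 : 0 <= x < 1 by lra.
have y01 : 0 <= y < 1 by lra.
have [i iN hi] := piece_index x01; have [j jN hj] := piece_index y01.
rewrite /extend_id x01 y01 (Tpiece iN hi) (Tpiece jN hj).
suff -> : sigma i = sigma j by lra.
have ij : (i <= j)%N.
  rewrite leqNgt; apply/negP => ji; have := breakpoints_le ji (ltnW iN); lra.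
have H d : (i + d < N)%N -> a (i + d)%N <= y -> sigma i = sigma (i + d)%N.
  elim: d => [|d IH]; rewrite ?addn0// addnS => dN dy.
  have e := breakpoints_le (leqnSn (i + d)) (ltnW dN).
  rewrite IH ?(ltnW dN)//; last by lra.
  apply: sigma_continuity => //; apply/negP => /noA/negP; apply.
  rewrite dy andbT; case/andP: hi => _ hi; apply: lt_le_trans hi _.
  by apply: breakpoints_le (ltnW dN); rewrite ltnS leq_addr.
by rewrite (H (j - i)%N) subnKC//; case/andP: hj.
Qed.

Let I i : set R := `[a i, a i.+1[%classic.
Let S i : R -> R := fun x => x + sigma i.

Lemma extend_id_preimage (B : set R) : extend_id T @^-1` B =
  (B `\` `[0, 1[) `|` \bigcup_(i in [set i | (i < N)%N]) (I i `&` S i @^-1` B).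
Proof.
apply/seteqP; split => x.
  rewrite /preimage/= /extend_id; case: ifP => x01 Bx; last first.
    by left; split => //; rewrite /= in_itv/= x01.
  right; have [i iN hi] := piece_index x01; exists i => //; split.
    by rewrite /I /= in_itv/= hi.
  by rewrite /preimage /S/= -(Tpiece iN hi).
case=> [[Bx]|[i /= iN [+ Sx]]].
  by rewrite /preimage/= in_itv/= /extend_id; case: ifP.
rewrite /I/= in_itv/= => hi.
by rewrite /preimage/= /extend_id (piece_unit iN hi) (Tpiece iN hi).
Qed.

Lemma measurable_piece_preimage i (B : set R) : measurable B -> measurable (S i @^-1` B).
Proof.
move=> mB; have mS : measurable_fun [set: R] (S i) by exact: measurable_funD.
by rewrite -[X in measurable X]setTI; exact: mS.
Qed.

Lemma measurable_extend_id : measurable_fun [set: R] (extend_id T).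
Proof.
move=> _ B mB; rewrite setTI extend_id_preimage; apply: measurableU.
  exact: measurableD.
apply: bigcup_measurable => i _; apply: measurableI; first exact: measurable_itv.
exact: measurable_piece_preimage.
Qed.

Lemma measure_extend_id (B : set R) : measurable B -> mu (extend_id T @^-1` B) = mu B.
Proof.
move=> mB; pose U : set R := `[0, 1[%classic.
have mU : measurable U by exact: measurable_itv.
have mX : measurable (extend_id T @^-1` B).
  by rewrite -[X in measurable X]setTI; exact: measurable_extend_id.
have e1 : mu (extend_id T @^-1` B) = (mu (extend_id T @^-1` B `\` U) + mu (extend_id T @^-1` B `&` U))%E.
  exact: measureDI.
have e2 : mu B = (mu (B `\` U) + mu (B `&` U))%E by exact: measureDI.
rewrite e1 e2; congr (_ + _)%E.
  congr (mu _); apply/seteqP; split => x -[+ nU]; rewrite /preimage/= /extend_id; move: (nU);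
    by rewrite /U /= in_itv/= => /negP/negbTE ->; split.
(* The images of the pieces; bijectivity of [T] makes them a partition of [[0, 1[]. *)
pose J i : set R := `[a i + sigma i, a i.+1 + sigma i[%classic.
have Jpre i x : J i x <-> I i (x - sigma i).
  by rewrite /J /I /= !in_itv/=; split; lra.
have -> : extend_id T @^-1` B `&` U = \bigcup_(i in [set i | (i < N)%N]) (S i @^-1` (J i `&` B)).
  rewrite extend_id_preimage; apply/seteqP; split => x.
    case=> -[[_ //]|[i iN [Ix Sx]] _]; exists i => //; split => //.
    by apply/Jpre; rewrite /S addrK.
  move=> [i iN [/Jpre Jx Bx]]; rewrite /S addrK in Jx; split; first by right; exists i.
  by move: Jx; rewrite /I /U /= !in_itv/=; exact: piece_unit.
have -> : B `&` U = \bigcup_(i in [set i | (i < N)%N]) (J i `&` B).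
  apply/seteqP; split => x.
    move=> [Bx Ux]; case: hT => -[_ _ surj] _; have [z z01 zx] := surj x Ux.
    have {}z01 : 0 <= z < 1 by move: z01; rewrite /= in_itv.
    have [i iN hi] := piece_index z01; exists i => //; split => //; apply/Jpre.
    by rewrite -zx (Tpiece iN hi) addrK /I/= in_itv.
  move=> [i iN [/Jpre Jx Bx]]; split => //; move: Jx; rewrite /I /= in_itv/= => hi.
  have := IET_unit (piece_unit iN hi); rewrite (Tpiece iN hi) subrK.
  by rewrite /U /= in_itv.
have mJ i : measurable (J i `&` B) by apply: measurableI => //; exact: measurable_itv.
have Jdisj i j x : (i < N)%N -> (j < N)%N -> J i x -> J j x -> i = j.
  move=> iN jN /Jpre + /Jpre; rewrite /I /= !in_itv/= => hi hj.
  have e : x - sigma i = x - sigma j.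
    apply: extend_id_inj; rewrite /extend_id (piece_unit iN hi) (piece_unit jN hj).
    by rewrite (Tpiece iN hi) (Tpiece jN hj) !subrK.
  by move: hi; rewrite e => hi; exact: (piece_index_unique iN jN hi hj).
rewrite !lebesgue_bigcup_ord => //.
- by apply: eq_bigr => i _; exact: lebesgue_measure_shift.
- by move=> i j x iN jN [Ji _] [Jj _]; exact: Jdisj Ji Jj.
- by move=> i; exact: measurable_piece_preimage.
- move=> i j x iN jN [/Jpre + _] [/Jpre + _].
  by rewrite /S !addrK /I /= !in_itv/=; exact: piece_index_unique.
Qed.
End Pieces.

Lemma IET_cut_translation : cut_translation (extend_id T) As.
Proof.
have [_ [N [a [sigma [_ a0 aN amono Tpiece]]]]] := hT.
split.
- exact: hA.
- exact: extend_id_inj.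
- exact: extend_id_unit.
- exact: (extend_id_shift a0 aN amono Tpiece).
- exact: (measurable_extend_id a0 aN amono Tpiece).
- exact: (measure_extend_id a0 aN amono Tpiece).
Qed.
End IETCut.

(** * Null sets of a product and their sections; measurability of the roof *)

Section NullSections.
Local Open Scope ereal_scope.
Context d1 d2 (X1 : measurableType d1) (X2 : measurableType d2) (R : realType).
Context (m1 : {sigma_finite_measure set X1 -> \bar R}).
Context (m2 : {sigma_finite_measure set X2 -> \bar R}).

Lemma null_xsectionP (S : set (X1 * X2)) : measurable S ->
  (m1 \x m2) S = 0 <-> {ae m1, forall x, m2 (xsection S x) = 0}.
Proof.
move=> mS; have mf : measurable_fun [set: X1] (m2 \o xsection S) by exact: measurable_fun_xsection.
have -> : (m1 \x m2) S = \int[m1]_(x in setT) `|(m2 \o xsection S) x|.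
  by apply: eq_integral => x _; rewrite gee0_abs.
split=> [/(ae_eq_integral_abs m1 measurableT mf)|h].
  by apply: filterS => x /(_ I).
by apply/(ae_eq_integral_abs m1 measurableT mf); apply: filterS h => x e _.
Qed.

Lemma null_ysectionP (S : set (X1 * X2)) : measurable S ->
  (m1 \x m2) S = 0 <-> {ae m2, forall y, m1 (ysection S y) = 0}.
Proof.
move=> mS; have mf : measurable_fun [set: X2] (m1 \o ysection S) by exact: measurable_fun_ysection.
have -> : (m1 \x m2) S = \int[m2]_(y in setT) `|(m1 \o ysection S) y|.
  transitivity ((m1 \x^ m2) S).
    by apply: product_measure_unique => // B C mB mC /=; rewrite product_measure2E.
  by apply: eq_integral => y _; rewrite gee0_abs.
split=> [/(ae_eq_integral_abs m2 measurableT mf)|h].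
  by apply: filterS => x /(_ I).
by apply/(ae_eq_integral_abs m2 measurableT mf); apply: filterS h => x e _.
Qed.
End NullSections.

Lemma measurable_set_bool d (X : measurableType d) (b : X -> bool) :
  measurable_fun [set: X] b -> measurable [set x | b x].
Proof.
move=> mb; rewrite (_ : [set x | b x] = [set: X] `&` b @^-1` [set true]); first exact: mb.
by rewrite setTI.
Qed.

Section Roof.
Context {R : realType} (As : seq R) (f : R -> R).
Notation mu := (@lebesgue_measure R).
Notation mu2 := (@lebesgue_measure R \x @lebesgue_measure R)%E.
Let A : set R := [set` As].

(* f, with the junk values on A and off [0, 1[ replaced by 0. *)
Definition roof (x : R) : R := if (0 <= x < 1) && (x \notin As) then f x else 0.

Lemma measurable_roof : (forall a, a \in As -> 0 < a < 1) ->
  C2_on (`]0, 1[ `\` A) f -> measurable_fun [set: R] roof.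
Proof.
move=> A01 fC2; pose U : set R := `]0, 1[ `\` A.
have oU : open U.
  apply: openI; first exact: interval_open.
  by rewrite openC; apply: (accessible_finite_set_closed.1 (@hausdorff_accessible _ (@Rhausdorff R))); exact: finite_seq.
have mU : measurable U by exact: open_measurable.
have mfU : measurable_fun U f.
  apply: open_continuous_measurable_fun => // x; rewrite inE => /fC2[d _ _].
  exact/differentiable_continuous/derivable1_diffP.
(* The regularity of [f] is given on the open interval only, so 0 is split off as a single point. *)
have -> : [set: R] = U `|` ([set 0] `|` ~` (U `|` [set 0])).
  apply/seteqP; split=> // x _; have [Ux|nU] := pselect (U x); first by left.
  have [->|x0] := eqVneq x 0; first by right; left.
  by right; right => -[//|/= /eqP]; rewrite (negbTE x0).
have m0 : measurable ([set 0] : set R) by [].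
have mC : measurable (~` (U `|` [set 0])) by apply: measurableC; exact: measurableU.
apply/measurable_funU => //; first exact: measurableU.
split.
  apply: eq_measurable_fun mfU => x; rewrite inE => -[/=]; rewrite in_itv/= => x01 /negP xA.
  by rewrite /roof xA andbT ifT//; lra.
apply/measurable_funU => //; split; first exact: measurable_fun_set1.
apply: (eq_measurable_fun (cst (0 : R))) => [x|]; last exact: measurable_cst.
rewrite inE => nx; rewrite /roof.
case: ifP => // /andP[x01 xA]; exfalso; apply: nx.
have [->|x0] := eqVneq x 0; [by right|left]; split; last exact/negP.
by rewrite /= in_itv/= lt_neqAle eq_sym x0.
Qed.

Lemma flow_spaceE : flow_space A f = [set p | 0 <= p.2 < roof p.1].
Proof.
apply/seteqP; split => -[x u]; rewrite /flow_space /roof /=.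
  by move=> [x01 /negP xA u0]; rewrite x01 xA.
by case: ifP => [/andP[x01 xA] ?|_ ?]; [split => //; exact/negP|exfalso; lra].
Qed.

Lemma measurable_flow_space : measurable_fun [set: R] roof -> measurable (flow_space A f).
Proof.
move=> mr; rewrite flow_spaceE.
apply: measurable_set_bool; apply: measurable_and.
  by apply: measurable_fun_ler => //; exact: measurable_snd.
apply: measurable_fun_ltr; first exact: measurable_snd.
exact: (measurableT_comp mr measurable_fst).
Qed.
End Roof.

(** * Ergodicity passes from the flow to the base *)

Section FlowErgodic.
Context {R : realType} (T0 : R -> R) (As : seq R) (f : R -> R).
Notation mu := (@lebesgue_measure R).
Notation mu2 := (@lebesgue_measure R \x @lebesgue_measure R)%E.
Notation A := [set` As].
Notation T := (extend_id T0).
Context (hT : cut_translation T As).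
Context (T01 : `[0, 1[ `<=` T0 @^-1` `[0, 1[).
Context (mr : measurable_fun [set: R] (roof As f)).

(** Forward or backward, the flow stays over one orbit of the base map, and the dummy value of
    [special_flow] is [p] itself, so no exceptional set arises. *)
Lemma special_flow_base (B : R -> Prop) t p :
  (forall x, 0 <= x < 1 -> B (T x) <-> B x) -> flow_space A f p ->
  flow_space A f (special_flow T0 A f t p) /\ (B (special_flow T0 A f t p).1 <-> B p.1).
Proof.
move=> inv Dp; rewrite /special_flow; case: xgetP => [q _|//].
have Biter n x : 0 <= x < 1 -> B (iter n T0 x) <-> B x.
  move=> x01; rewrite -iter_extend_id//; elim: n => //= n IH; rewrite inv ?(iter_unit hT)//.
have base s r r' : flows_to T0 A f s r r' ->
    [/\ flow_space A f r, flow_space A f r' & B r'.1 <-> B r.1].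
  by move=> [Dr Dr' [n [_ e _]]]; split => //; rewrite e; apply: Biter; case: Dr.
by rewrite /mkset; case: ifP => _ /base[Dr Dr' Bq]; split => //; split => ?; apply/Bq.
Qed.

Lemma measurable_over (B : set R) : measurable B -> measurable [set p | flow_space A f p /\ B p.1].
Proof.
move=> mB; apply: measurableI; first exact: measurable_flow_space.
by rewrite -[X in measurable X]setTI; exact: measurable_fst.
Qed.

(** The section over [x] is [[0, r x[], so a null set of this form constrains [B] only where the
    roof is positive. *)
Lemma over_null (B : set R) : measurable B ->
  mu2 [set p | flow_space A f p /\ B p.1] = 0%E -> mu (B `&` [set x | 0 < roof As f x]) = 0%E.
Proof.
move=> mB B0; have h := (null_xsectionP mu mu (measurable_over mB)).1 B0.
have mC : measurable (B `&` [set x | 0 < roof As f x]).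
  apply: measurableI => //; apply: measurable_set_bool.
  exact: measurable_fun_ltr.
apply/(negligibleP mu mC); apply: negligibleS h => x [Bx /= r0] /=.
have -> : xsection [set p | flow_space A f p /\ B p.1] x = `[0, roof As f x[%classic.
  apply/seteqP; split => u; rewrite /xsection /= inE /= flow_spaceE /= in_itv/=.
    by case.
  by split.
by rewrite lebesgue_measure_itv/= lte_fin r0 sube0 => -[] e; move: r0; rewrite e ltxx.
Qed.

Lemma ergodic_flow_base (K : set R) : ergodic_flow mu2 (flow_space A f) (special_flow T0 A f) ->
  measurable K -> (forall x, 0 <= x < 1 -> K (T x) <-> K x) ->
  mu (K `&` [set x | 0 < roof As f x]) = 0%E \/ mu (~` K `&` [set x | 0 < roof As f x]) = 0%E.
Proof.
move=> erg mK Kinv.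
have [||t|e|e] := erg [set p | flow_space A f p /\ K p.1].
- exact: measurable_over.
- by move=> p [].
- apply: aeW => p Dp; have [Dq Kq] := special_flow_base t Kinv Dp.
  by split=> -[_ ?]; split => //; apply/Kq.
- by left; exact: over_null.
- right; apply: over_null; first exact: measurableC.
  rewrite -e; congr (mu2 _); apply/seteqP; split => p /=.
    by move=> [Dp nK]; split => // -[].
  by move=> [Dp nK]; split => // Kp; apply: nK.
Qed.

Context (A0 : As != [::]) (eta : R) (eta0 : 0 < eta).
Context (high : forall z a, 0 <= z < 1 -> a \in As -> 0 < `|z - a| < eta -> 0 < roof As f z).

(** What [ergodic_flow_base] leaves open is [key]: an invariant set on which the roof vanishes
    almost everywhere is null. Otherwise one of its typical orbits would never enter the
    [eta]-neighbourhoods of the cuts, and [far_orbit_split] would give an invariant set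
    contradicting [ergodic_flow_base]. *)
Lemma ergodic_flow_map : ergodic_flow mu2 (flow_space A f) (special_flow T0 A f) ->
  ergodic_map mu `[0, 1[ T0.
Proof.
move=> erg B mB B01 Binv.
have inv x : 0 <= x < 1 -> B (T x) <-> B x.
  move=> x01; rewrite /extend_id x01 -{2}Binv; split => [Bx|[]//].
  by split => //; rewrite /= in_itv.
have key (C : set R) : measurable C -> C `<=` `[0, 1[ -> (forall x, 0 <= x < 1 -> C (T x) <-> C x) ->
    mu (C `&` [set x | 0 < roof As f x]) = 0%E -> mu C = 0%E.
  move=> mC C01 Cinv C0; apply/eqP; rewrite eq_le measure_ge0 andbT leNgt; apply/negP => Cpos.
  pose bad := \bigcup_k (iter k T @^-1` ((C `&` [set x | 0 < roof As f x]) `|` A)).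
  have mP : measurable (C `&` [set x | 0 < roof As f x]).
    by apply: measurableI => //; apply: measurable_set_bool; exact: measurable_fun_ltr.
  have cA : countable (A : set R) by apply: finite_set_countable; exact: finite_seq.
  have mA : measurable (A : set R).
    by apply: countable_measurable.
  have nbad : mu.-negligible bad.
    apply: negligible_bigcup => k; apply/negligibleP.
      by apply: (measurable_preimage_iter hT); exact: measurableU.
    apply: (etrans (measure_preimage_iter hT k _)); first exact: measurableU.
    apply/negligibleP; first exact: measurableU.
    apply: negligibleU; first exact/negligibleP.
    by apply/negligibleP => //; exact: countable_lebesgue_measure0.
  have [x Cx nx] : exists2 x, C x & ~ bad x.
    apply: contrapT => no; have : mu.-negligible C.
      by apply: negligibleS nbad => x Cx; apply: contrapT => nx; apply: no; exists x.
    by move/(negligibleP mu mC) => e; rewrite e ltxx in Cpos.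
  have x01 : 0 <= x < 1 by move: (C01 _ Cx); rewrite /= in_itv.
  have Ck k : C (iter k T x) by elim: k => //= k IH; apply/Cinv; rewrite ?(iter_unit hT).
  have far k a : a \in As -> eta <= `|iter k T x - a|.
    move=> aA; rewrite leNgt; apply/negP => close; apply: nx; exists k => //.
    have [e|ne] := eqVneq (iter k T x) a; first by right; rewrite /= e.
    left; split; first exact: Ck.
    by apply: (high (a := a)); rewrite ?(iter_unit hT)// close normr_gt0 subr_eq0 ne.
  have [K [J [[mK mJ] K01 Kinv Jp [JK JDK]]]] := far_orbit_split hT x01 eta0 A0 far eta0.
  have Jhigh : J `<=` [set x | 0 < roof As f x].
    by move=> z /Jp[z01 [a aA za]]; exact: (high z01 aA za).
  have mhigh : measurable [set x | 0 < roof As f x].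
    by apply: measurable_set_bool; exact: measurable_fun_ltr.
  have [K0|K0] := ergodic_flow_base erg mK Kinv.
    have : (mu (J `&` K) <= mu (K `&` [set x | (0 < roof As f x)%R]))%E.
      by apply: le_lebesgue; [exact: measurableI|exact: measurableI|move=> z [/Jhigh Jz Kz]].
    by rewrite leNgt K0 JK.
  have : (mu (J `\` K) <= mu (~` K `&` [set x | (0 < roof As f x)%R]))%E.
    apply: le_lebesgue; [exact: measurableD|apply: measurableI => //; exact: measurableC|].
    by move=> z [/Jhigh Jz Kz].
  by rewrite leNgt K0 JDK.
have [h|h] := ergodic_flow_base erg mB inv; [left|right]; first exact: key.
apply: key.
- exact: measurableD.
- by move=> x [].
- move=> x x01; have e : `[0, 1[%classic (T x) <-> `[0, 1[%classic x.
    by rewrite /= !in_itv/= (cut_unit hT).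
  by split=> -[x01' nB]; split; [exact/e| |exact/e|] => Bx; apply: nB; apply/inv.
- apply/negligibleP.
    by apply: measurableI; [exact: measurableD|apply: measurable_set_bool; exact: measurable_fun_ltr].
  apply: negligibleS ((negligibleP mu _).2 h) => [x [[]]//|].
  by apply: measurableI; [exact: measurableC|apply: measurable_set_bool; exact: measurable_fun_ltr].
Qed.
End FlowErgodic.

(** * Convex phases *)

Section VanDerCorput.
Context {R : realType}.
Notation mu := (@lebesgue_measure R).

Context (th th1 th2 : R -> R) (p q : R).
Context (d1 : forall x, p < x < q -> is_derive x (1 : R) th (th1 x)).
Context (d2 : forall x, p < x < q -> is_derive x (1 : R) th1 (th2 x)).
Context (c2 : forall x, p < x < q -> {for x, continuous th2}).

(** Integration by parts of (th' cos th) / th', with the primitive sin th - 1 instead of sin th so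
    that the remainder has a constant sign. *)
Let H x := (sin (th x) - 1) / th1 x.
Let h x := cos (th x) + (1 - sin (th x)) * th2 x / th1 x ^+ 2.

Let dH x : p < x < q -> th1 x != 0 -> is_derive x (1 : R) H (h x).
Proof.
move=> hx nz; have D1 := d1 hx; have D2 := d2 hx.
have Ds : is_derive x (1 : R) (fun x => sin (th x)) (cos (th x) * th1 x).
  by apply: is_derive_eq; rewrite /GRing.scale /= mulrC.
have Dn : is_derive x (1 : R) (fun x => sin (th x) - 1) (cos (th x) * th1 x).
  by apply: is_derive_eq; rewrite subr0.
have Dv := is_deriveV nz D2.
have -> : H = (fun x => sin (th x) - 1) * (fun x => (th1 x)^-1) by [].
apply: is_derive_eq.
by rewrite /h /GRing.scale /=; field.
Qed.

Let cdiff (g g' : R -> R) x : is_derive x (1 : R) g (g' x) -> {for x, continuous g}.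
Proof. by move=> D; apply: differentiable_continuous; apply/derivable1_diffP; case: D. Qed.

Let ch x : p < x < q -> th1 x != 0 -> {for x, continuous h}.
Proof.
move=> hx nz; have ct := cdiff (d1 hx); have ct1 := cdiff (d2 hx); have ct2 := c2 hx.
have cs : {for x, continuous (fun x => sin (th x))}.
  by apply: continuous_comp => //; exact: continuous_sin.
have cc : {for x, continuous (fun x => cos (th x))}.
  by apply: continuous_comp => //; exact: continuous_cos.
apply: cvgD => //; apply: cvgM; first apply: cvgM => //.
  by apply: cvgB => //; exact: cvg_cst.
apply: cvgV; first by rewrite expf_neq0.
exact: cvgM.
Qed.

(* The derivative of (sin th - 1) / th' dominates cos th because th'' >= 0. *)
Lemma integral_cos_le u v L : p < u -> u < v -> v < q -> 0 < L ->
  (forall x, p < x < q -> 0 <= th2 x) ->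
  (forall x, u <= x <= v -> L <= th1 x) \/ (forall x, u <= x <= v -> th1 x <= - L) ->
  (\int[mu]_(x in `[u, v]) (cos (th x))%:E <= (2 / L)%:E)%E.
Proof.
move=> pu uv vq L0 th20 steep.
have inpq x : u <= x <= v -> p < x < q by lra.
have nz x : u <= x <= v -> th1 x != 0.
  move=> hx; case: steep => /(_ x hx) st; [rewrite gt_eqF//|rewrite lt_eqF//]; lra.
have hI : {within `[u, v], continuous h}.
  apply: continuous_in_subspaceT => x; rewrite inE /= in_itv/= => hx.
  by apply: ch; [exact: inpq|exact: nz].
have cI : {within `[u, v], continuous (fun x => cos (th x))}.
  apply: continuous_in_subspaceT => x; rewrite inE /= in_itv/= => hx.
  by apply: continuous_comp; [exact: cdiff (d1 (inpq _ hx))|exact: continuous_cos].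
have uu : u <= u <= v by lra.
have vv : u <= v <= v by lra.
have int g : {within `[u, v], continuous g} -> mu.-integrable `[u, v] (EFin \o g).
  by move=> cg; apply: continuous_compact_integrable => //; exact: segment_compact.
apply: (@le_trans _ _ (\int[mu]_(x in `[u, v]) (h x)%:E)%E).
  apply: le_integral => //; [exact: int|exact: int|].
  move=> x xI; have hx : u <= x <= v by move: xI; rewrite ?inE /= ?in_itv.
  rewrite lee_fin /h lerDl.
  apply: mulr_ge0; last by rewrite invr_ge0 sqr_ge0.
  by rewrite mulr_ge0 ?subr_ge0 ?sin_le1// th20// inpq.
rewrite (@continuous_FTC2 _ h H)//; last 2 first.
- split.
  + move=> x; rewrite in_itv/= => hx.
    have hx' : u <= x <= v by lra.
    by case: (dH (inpq _ hx') (nz _ hx')).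
  + apply: cvg_at_right_filter; exact: cdiff (dH (inpq _ uu) (nz _ uu)).
  + apply: cvg_at_left_filter; exact: cdiff (dH (inpq _ vv) (nz _ vv)).
- move=> x; rewrite in_itv/= => hx; have hx' : u <= x <= v by lra.
  by rewrite derive1E; case: (dH (inpq _ hx') (nz _ hx')) => _ ->.
rewrite -EFinB lee_fin /H.
have su := sin_le1 (th u); have su' := sin_geN1 (th u).
have sv := sin_le1 (th v); have sv' := sin_geN1 (th v).
(* [H] takes values in [-2 / L, 0] or in [0, 2 / L] according to the sign of th', so its increment
   is at most 2 / L. *)
case: steep => st; have stu := st u uu; have stv := st v vv.
  have i1 : (th1 u)^-1 <= L^-1 by rewrite lef_pV2 ?posrE; lra.
  have i2 : 0 <= (th1 u)^-1 by rewrite invr_ge0; lra.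
  have i3 : 0 <= (th1 v)^-1 by rewrite invr_ge0; lra.
  by nra.
have i1 : (- th1 v)^-1 <= L^-1 by rewrite lef_pV2 ?posrE; lra.
have i2 : 0 <= (- th1 v)^-1 by rewrite invr_ge0; lra.
have i3 : 0 <= (- th1 u)^-1 by rewrite invr_ge0; lra.
by move: i1 i2 i3; rewrite !invrN => i1 i2 i3; nra.
Qed.

End VanDerCorput.

Section QuarterInterval.
Context {R : realType}.
Notation mu := (@lebesgue_measure R).

(* Depending on the sign of ph' at y, convexity gives |ph'| >= ka / (2 rho) beyond
   distance rho / 2 on the right or on the left of y. *)
Lemma convex_phase_cos_le (ph ph1 ph2 : R -> R) (y rho ka S th0 : R) :
  0 < rho -> 0 < ka -> 0 < S ->
  (forall x, y - rho < x < y + rho -> is_derive x (1 : R) ph (ph1 x)) ->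
  (forall x, y - rho < x < y + rho -> is_derive x (1 : R) ph1 (ph2 x)) ->
  (forall x, y - rho < x < y + rho -> {for x, continuous ph2}) ->
  (forall x, y - rho < x < y + rho -> ka / rho ^+ 2 <= ph2 x) ->
  exists u v, [/\ y - rho < u, v < y + rho, v - u = rho / 4 &
    (\int[mu]_(x in `[u, v]) (cos (S * ph x - th0))%:E <= (4 * rho / (S * ka))%:E)%E].
Proof.
move=> rho0 ka0 S0 D1 D2 C2 conv.
pose th x := S * ph x - th0; pose th1 x := S * ph1 x; pose th2 x := S * ph2 x.
have d1 x : y - rho < x < y + rho -> is_derive x (1 : R) th (th1 x).
  by move=> /D1 D; apply: is_derive_eq; rewrite /th1 /GRing.scale /= ?subr0 ?scaler0 ?addr0.
have d2 x : y - rho < x < y + rho -> is_derive x (1 : R) th1 (th2 x).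
  by move=> /D2 D; apply: is_derive_eq.
have c2 x : y - rho < x < y + rho -> {for x, continuous th2}.
  by move=> /C2 c; apply: cvgM => //; exact: cvg_cst.
have e0 : 0 < ka / rho ^+ 2 by rewrite divr_gt0 ?exprn_gt0.
have pos x : y - rho < x < y + rho -> 0 <= th2 x.
  by move=> /conv h; rewrite mulr_ge0 ?(ltW S0)//; lra.
have mvt a b : y - rho < a -> a < b -> b < y + rho -> ka / rho ^+ 2 * (b - a) <= ph1 b - ph1 a.
  move=> ya ab yb.
  have [z||c hc ->] := @MVT R ph1 ph2 a b ab.
  - by rewrite in_itv/= => hc; apply: D2; lra.
  - apply: continuous_in_subspaceT => c; rewrite inE /= in_itv/= => hc.
    by apply: differentiable_continuous; apply/derivable1_diffP; case: (D2 c ltac:(lra)).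
  - rewrite in_itv/= in hc; rewrite ler_wpM2r//; first by lra.
    by apply: conv; lra.
pose L := S * (ka / (2 * rho)).
have L0 : 0 < L by rewrite mulr_gt0 ?divr_gt0 ?mulr_gt0.
have LE : 4 * rho / (S * ka) = 2 / L by rewrite /L; field; lra.
have half : ka / rho ^+ 2 * (rho / 2) = ka / (2 * rho) by field; lra.
have [s|s] := leP 0 (ph1 y).
  exists (y + rho / 2), (y + 3 / 4 * rho); split; [lra|lra|lra|].
  rewrite LE; apply: (@integral_cos_le R th th1 th2 (y - rho) (y + rho)) => //; [lra|lra|lra|].
  left => x hx; rewrite /L /th1 ler_wpM2l ?(ltW S0)//.
  have := mvt y x ltac:(lra) ltac:(lra) ltac:(lra).
  have : ka / rho ^+ 2 * (rho / 2) <= ka / rho ^+ 2 * (x - y) by rewrite ler_wpM2l; lra.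
  by rewrite half; lra.
exists (y - 3 / 4 * rho), (y - rho / 2); split; [lra|lra|lra|].
rewrite LE; apply: (@integral_cos_le R th th1 th2 (y - rho) (y + rho)) => //; [lra|lra|lra|].
right => x hx; rewrite /L /th1 -mulrN ler_wpM2l ?(ltW S0)//.
have := mvt x y ltac:(lra) ltac:(lra) ltac:(lra).
have : ka / rho ^+ 2 * (rho / 2) <= ka / rho ^+ 2 * (y - x) by rewrite ler_wpM2l; lra.
by rewrite half; lra.
Qed.
End QuarterInterval.

(** * Lebesgue density, uniformly over small scales *)

Section Density.
Context {R : realType}.
Notation mu := (@lebesgue_measure R).

Lemma compact_uniform_modulus (g : R -> R) (K : set R) (e : R) : continuous g -> compact K -> 0 < e ->
  \forall r \near (0 : R)^'+, forall x z, K x -> `|z - x| < r -> `|g z - g x| < e.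
Proof.
move=> cg /compact_near_coveringP cK e0.
pose P (r x : R) := forall z, `|z - x| < r -> `|g z - g x| < e.
suff : \forall r \near (0 : R)^'+, K `<=` P r.
  by apply: filterS => r KP x z Kx; exact: KP.
apply: cK => x Kx.
have : \forall z \near nbhs x, `|g x - g z| < e / 2.
  by move/cvgrPdist_lt : (cg x) => /(_ (e / 2)); apply; rewrite divr_gt0.
move=> /nbhs_ballP[d /= d0 dP].
exists (ball x (d / 2), [set r | 0 < r < d / 2]).
  split; first by apply: nbhsx_ballx; rewrite divr_gt0.
  by near=> r => /=; apply/andP; split; near: r; [exact: nbhs_right_gt|apply: nbhs_right_lt; rewrite divr_gt0].
move=> [x' r] [/= xx' /andP[r0 rd]] z zx'.
have h1 : `|g x - g x'| < e / 2.
  by apply: dP; apply: (lt_trans xx'); lra.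
have h2 : `|g x - g z| < e / 2.
  apply: dP; rewrite /ball/=; move: xx'; rewrite /ball/= => xx'.
  rewrite (_ : x - z = (x - x') - (z - x')); last by ring.
  by apply: (le_lt_trans (ler_normB _ _)); lra.
rewrite (_ : g z - g x' = (g x - g x') - (g x - g z)); last by ring.
by apply: (le_lt_trans (ler_normB _ _)); lra.
Unshelve. all: by end_near. Qed.

(** [G] is approximated in L^1 by a continuous [g]. Uniform continuity handles [g]; the
    Hardy-Littlewood maximal inequality handles the averages of [G - g] at all radii simultaneously,
    outside one small set. *)
Lemma density_scale (G : R -> R) (e d : R) : measurable_fun [set: R] G ->
  (forall x, `|G x| <= 1) -> 0 < e -> 0 < d ->
  exists r0 (N : set R), [/\ 0 < r0, measurable N, (mu N <= d%:E)%E &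
    forall r y u v, 0 < r < r0 -> 0 <= y < 1 -> ~ N y -> y - r < u -> v < y + r -> u <= v ->
    (\int[mu]_(x in `[u, v]) (`|G x - G y|)%:E <= (e * r)%:E)%E].
Proof.
(* [E] contains the balls of radius at most 1 around points of [[0, 1[]. *)
move=> mG G1 e0 d0; pose E : set R := `[- 1, 2]%classic.
have mE : measurable E by exact: measurable_itv.
have Efin : (mu E < +oo)%E by rewrite lebesgue_measure_itv/= lte_fin ifT ?ltry//; lra.
have intG : mu.-integrable E (EFin \o G).
  apply/integrableP; split.
    by apply/measurable_EFinP; exact: measurable_funS mG.
  apply: (@le_lt_trans _ _ (1%:E * mu E)%E); last by rewrite mul1e.
  apply: integral_le_bound => //.
    by apply/measurable_EFinP; exact: measurable_funS mG.
  by apply: aeW => x _ /=; rewrite lee_fin.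
have [g_ [cg ig lim]] := approximation_continuous_integrable mE Efin intG.
(* The final bound is 2 t r from [G - g] plus 2 t times the length 2 r. The L^1 error t d / 4 costs
   3 d / 4 in the maximal inequality and d / 4 in the Markov inequality. *)
pose t := e / 6; have t0 : 0 < t by rewrite /t; lra.
have [n hn] : exists n, (\int[mu]_(z in E) `|(G z - g_ n z)%:E| < (t * d / 4)%:E)%E.
  have : \forall n \near \oo, (\int[mu]_(z in E) `|(G z - g_ n z)%:E| < (t * d / 4)%:E)%E.
    apply: (lim [set y | (y < (t * d / 4)%:E)%E]).
    by apply: open_nbhs_nbhs; split; [exact: open_ereal_lt_ereal|rewrite /= lte_fin; nra].
  by move=> [n _ /(_ n (leqnn n))]; exists n.
set g := g_ n in hn.
pose f : R -> R := (G \- g) \_ E.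
have lf : locally_integrable [set: R] f.
  apply: integrable_locally_restrict => //.
  have H : mu.-integrable E (fun x => (G x)%:E - (g x)%:E)%E.
    by apply: integrableB => //; exact: ig.
  exact: H.
have mf : measurable_fun [set: R] f by case: lf.
have nf : (\int[mu]_(x in setT) `|(f x)%:E| < (t * d / 4)%:E)%E.
  rewrite (_ : integral _ _ _ = \int[mu]_(z in E) `|(G z - g z)%:E|)%E//.
  rewrite [RHS]integral_mkcond; apply: eq_integral => x _.
  by rewrite /f !patchE; case: ifPn => // _; rewrite abse0.
have mfa : measurable_fun [set: R] (fun x => `|(f x)%:E|)%E.
  by apply: measurableT_comp => //; exact/measurable_EFinP.
pose N1 := [set x | (HL_maximal f x > t%:E)%E].
pose N2 := [set x | (`|(f x)%:E| >= t%:E)%E].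
have mN1 : measurable N1.
  rewrite -[N1]setTI; apply: emeasurable_fun_o_infty => //.
  exact: measurable_HL_maximal.
have mN2 : measurable N2.
  by rewrite -[N2]setTI; exact: emeasurable_fun_c_infty.
have muN1 : (mu N1 <= (3 / t)%:E * (t * d / 4)%:E)%E.
  apply: (le_trans (maximal_inequality lf t0)).
  by rewrite lee_wpmul2l// ?lee_fin ?divr_ge0 ?ltW.
have muN2 : (mu N2 <= (d / 4)%:E)%E.
  have mid : measurable_fun [set: \bar R] (id : \bar R -> \bar R) by exact: measurable_id.
  have := @le_integral_comp_abse _ _ _ mu setT measurableT (EFin \o f) t id mid
    (fun r h => h) (fun x y _ _ h => h) ((measurable_EFinP _ _).2 mf) t0.
  rewrite setTI => /le_lt_trans /(_ nf) /ltW; rewrite -lee_pdivlMl//.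
  by rewrite -EFinM; have -> : t^-1 * (t * d / 4) = d / 4 by field; lra.
have : \forall r \near (0 : R)^'+, forall x z, E x -> `|z - x| < r -> `|g z - g x| < t.
  by apply: compact_uniform_modulus => //; [exact: cg|exact: segment_compact].
rewrite near_withinE => /nbhs_ballP[r1 /= r10 gP].
have mN : measurable (N1 `|` N2) by exact: measurableU.
exists (Num.min r1 1), (N1 `|` N2); split => //.
- by rewrite lt_min r10 ltr01.
- apply: (le_trans (measureU2 mu mN1 mN2)); apply: (le_trans (leeD muN1 muN2)).
  rewrite -EFinM -EFinD lee_fin.
  by have -> : 3 / t * (t * d / 4) + d / 4 = d by field; lra.
move=> r y u v; rewrite lt_min => /andP[r0 /andP[rr1 r1']] y01 nN yu vy uv.
have Ey : E y by rewrite /E /= in_itv/=; lra.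
have HLy : (HL_maximal f y <= t%:E)%E by rewrite leNgt; apply/negP => h; apply: nN; left.
have fy : `|G y - g y| < t.
  rewrite ltNge; apply/negP => h; apply: nN; right.
  by rewrite /N2 /= lee_fin /f patchE mem_set.
have ballE : ball y r `<=` E.
  by rewrite ball_itv => z /=; rewrite /E /= !in_itv/=; lra.
have uvball : `[u, v] `<=` ball y r.
  by rewrite ball_itv => z /=; rewrite !in_itv/=; lra.
have mball : measurable (ball y r) by exact: measurable_ball.
have If : (\int[mu]_(x in ball y r) `|(f x)%:E| <= (t * (r *+ 2))%:E)%E.
  have : (iavg f (ball y r) <= t%:E)%E.
    apply: le_trans HLy; apply: ereal_sup_ubound; exists r => //.
    by rewrite /= in_itv/= r0.
  rewrite /iavg lebesgue_measure_ball ?(ltW r0)// inver.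
  have r2 : 0 < r *+ 2 by rewrite mulrn_wgt0.
  rewrite gt_eqF// lee_pdivrMl//.
  by rewrite EFinM muleC.
have muv : measurable (`[u, v]%classic : set R) by exact: measurable_itv.
apply: (@le_trans _ _ (\int[mu]_(x in `[u, v]) (`|(f x)%:E| + (2 * t)%:E))%E).
  apply: ge0_le_integral => //.
  - apply/measurable_EFinP; apply: measurableT_comp => //; apply: measurable_funB => //.
    exact: measurable_funS mG.
  - apply: emeasurable_funD => //; exact: measurable_funS mfa.
  move=> x xuv; have xE := ballE _ (uvball _ xuv).
  have gxy : `|g x - g y| < t.
    apply: (gP r) => //.
      by rewrite /ball/= sub0r normrN gtr0_norm.
    by have := uvball _ xuv; rewrite -ball_normE /= distrC.
  rewrite -EFinD lee_fin /f patchE mem_set//=.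
  rewrite (_ : G x - G y = (G x - g x) + ((g x - g y) - (G y - g y))); last by ring.
  apply: (le_trans (ler_normD _ _)); rewrite lerD2l.
  by apply: (le_trans (ler_normB _ _)); lra.
rewrite ge0_integralD//=; last 2 first.
- by apply: measurable_funS mfa.
- by move=> x _; rewrite lee_fin; lra.
have muI : mu `[u, v] = (v - u)%:E.
  rewrite lebesgue_measure_itv/= lte_fin; case: ltP => [_|vu]; first by rewrite EFinB.
  by rewrite (@le_anti _ _ u v) ?uv// subrr.
have -> : (\int[mu]_(x in `[u, v]) (2 * t)%:E = (2 * t)%:E * (v - u)%:E)%E.
  by rewrite -muI; exact: integral_cst.
have If' : (\int[mu]_(x in `[u, v]) `|(f x)%:E| <= (t * (r *+ 2))%:E)%E.
  apply: le_trans If; apply: ge0_subset_integral => //; exact: measurable_funS mfa.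
apply: (@le_trans _ _ ((t * (r *+ 2))%:E + (2 * t)%:E * (r *+ 2)%:E)%E).
  apply: leeD => //; rewrite lee_wpmul2l ?lee_fin//; lra.
rewrite -EFinM -EFinD lee_fin /t; lra.
Qed.
End Density.

(** * The cohomological equation *)

Section PhaseTools.
Context {R : realType}.
Notation mu := (@lebesgue_measure R).

(** In complex terms p = (c + i s) q, and the left side is half the squared distance between the
    unit numbers p / q and p' / q'. [a + i b] and [g + i d] stand for p / p' and q / q'. *)
Lemma unit_phase_dist (c s p1 p2 q1 q2 p1' p2' q1' q2' : R) :
  p1 = c * q1 - s * q2 -> p2 = s * q1 + c * q2 ->
  p1 ^+ 2 + p2 ^+ 2 = 1 -> q1 ^+ 2 + q2 ^+ 2 = 1 ->
  p1' ^+ 2 + p2' ^+ 2 = 1 -> q1' ^+ 2 + q2' ^+ 2 = 1 ->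
  1 - (c * (p1' * q1' + p2' * q2') + s * (p2' * q1' - p1' * q2')) <=
  2 * (`|p1 - p1'| + `|p2 - p2'| + `|q1 - q1'| + `|q2 - q2'|).
Proof.
move=> e1 e2 hp hq hp' hq'.
pose a := p1 * p1' + p2 * p2'; pose b := p2 * p1' - p1 * p2'.
pose g := q1 * q1' + q2 * q2'; pose d := q2 * q1' - q1 * q2'.
have ab : a ^+ 2 + b ^+ 2 = 1.
  transitivity ((p1 ^+ 2 + p2 ^+ 2) * (p1' ^+ 2 + p2' ^+ 2)); first by rewrite /a /b; ring.
  by rewrite hp hp' mulr1.
have gd : g ^+ 2 + d ^+ 2 = 1.
  transitivity ((q1 ^+ 2 + q2 ^+ 2) * (q1' ^+ 2 + q2' ^+ 2)); first by rewrite /g /d; ring.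
  by rewrite hq hq' mulr1.
have -> : c * (p1' * q1' + p2' * q2') + s * (p2' * q1' - p1' * q2') = a * g + b * d.
  have -> : a * g + b * d = (c * (p1' * q1' + p2' * q2') + s * (p2' * q1' - p1' * q2')) * (q1 ^+ 2 + q2 ^+ 2).
    by rewrite /a /b /g /d e1 e2; ring.
  by rewrite hq mulr1.
(* The inequality |z - w|^2 <= 2 |z - 1|^2 + 2 |w - 1|^2 for unit z and w. *)
have key : 1 - (a * g + b * d) <= 2 * ((1 - a) + (1 - g)).
  have := sqr_ge0 (a + g - 2); have := sqr_ge0 (b + d); rewrite !expr2 in ab gd *; nra.
have dist (x1 x2 y1 y2 : R) : x1 ^+ 2 + x2 ^+ 2 = 1 -> y1 ^+ 2 + y2 ^+ 2 = 1 ->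
    1 - (x1 * y1 + x2 * y2) <= `|x1 - y1| + `|x2 - y2|.
  move=> hx hy.
  have bound (x z : R) : x ^+ 2 + z ^+ 2 = 1 -> -1 <= x <= 1.
    by have := sqr_ge0 z; rewrite !expr2 => z0 hxz; apply/andP; split; nra.
  have bx1 := bound _ _ hx; have by1 := bound _ _ hy.
  have bx2 : -1 <= x2 <= 1 by apply: (bound _ x1); rewrite addrC.
  have by2 : -1 <= y2 <= 1 by apply: (bound _ y1); rewrite addrC.
  have sq (x z : R) : -1 <= x <= 1 -> -1 <= z <= 1 -> (x - z) ^+ 2 <= 2 * `|x - z|.
    move=> hx' hz'; rewrite -(real_normK (num_real (x - z))) expr2 ler_wpM2r//.
    by rewrite ler_norml; apply/andP; split; lra.
  have s1 := sq _ _ bx1 by1; have s2 := sq _ _ bx2 by2.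
  by rewrite !expr2 in hx hy s1 s2; lra.
have := dist _ _ _ _ hp hp'; have := dist _ _ _ _ hq hq'; rewrite -/a -/g; lra.
Qed.

Lemma unit_angle (a b : R) : a ^+ 2 + b ^+ 2 = 1 -> exists t, cos t = a /\ sin t = b.
Proof.
move=> ab; have a1 : -1 <= a <= 1.
  by have := sqr_ge0 b; rewrite !expr2 in ab *; move=> b0; apply/andP; split; nra.
have ca := acosK a1; have sa := sin_acos a1.
have sb : Num.sqrt (1 - a ^+ 2) = `|b| by rewrite -ab addrAC subrr add0r sqrtr_sqr.
have [b0|b0] := leP 0 b.
  by exists (acos a); rewrite ca sa sb ger0_norm.
by exists (- acos a); rewrite cosN sinN ca sa sb ltr0_norm// opprK.
Qed.

Lemma integral_shift (u v c : R) (g : R -> \bar R) : measurable_fun [set: R] g ->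
  (forall x, 0 <= g x)%E ->
  (\int[mu]_(x in `[u, v]) g (x + c)%R = \int[mu]_(x in `[(u + c)%R, (v + c)%R]) g x)%E.
Proof.
move=> mg g0.
pose S : R -> measurableTypeR R := fun x => x + c.
have mS : measurable_fun [set: R] S by exact: measurable_funD.
pose D : set R := `[u + c, v + c]%classic.
have mD : measurable D by exact: measurable_itv.
have e : (\int[pushforward mu S]_(x in D) g x = \int[mu]_(x in S @^-1` D) (g \o S) x)%E.
  by apply: ge0_integral_pushforward => //; exact: measurable_funS mg.
have -> : `[u, v]%classic = S @^-1` D.
  by apply/seteqP; split => x /=; rewrite /D /S /= !in_itv/=; lra.
rewrite -[LHS]e; apply: eq_measure_integral => B mB _.
exact: lebesgue_measure_shift.
Qed.

Lemma is_derive_shift (f : R -> R) (c x l : R) : is_derive (x + c) (1 : R) f l ->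
  is_derive x (1 : R) (fun z => f (z + c)) l.
Proof.
move=> D; have h : is_derive x (1 : R) (fun z : R => z + c) 1.
  by apply: is_derive_eq; rewrite addr0.
have := @is_derive1_comp R f (fun z => z + c) x l 1 D h.
by rewrite mulr1.
Qed.

Lemma is_derive_bigsum n (F : nat -> R -> R) (dF : nat -> R) x :
  (forall k, (k < n)%N -> is_derive x (1 : R) (F k) (dF k)) ->
  is_derive x (1 : R) (fun z => \sum_(k < n) F k z) (\sum_(k < n) dF k).
Proof.
elim: n => [|n IH] D.
  rewrite big_ord0 (_ : (fun z => _) = cst 0); first exact: is_derive_cst.
  by apply/funext => z; rewrite big_ord0.
rewrite big_ord_recr /= (_ : (fun z => _) = (fun z => \sum_(k < n) F k z) + F n).
  by apply: is_deriveD; [apply: IH => k kn; apply: D; exact: ltnW|exact: D].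
by apply/funext => z; rewrite big_ord_recr.
Qed.

Lemma continuous_bigsum n (F : nat -> R -> R) x :
  (forall k, (k < n)%N -> {for x, continuous (F k)}) ->
  {for x, continuous (fun z => \sum_(k < n) F k z)}.
Proof.
elim: n => [|n IH] D.
  rewrite (_ : (fun z => _) = cst 0); first exact: cvg_cst.
  by apply/funext => z; rewrite big_ord0.
rewrite (_ : (fun z => _) = (fun z => \sum_(k < n) F k z) + F n).
  by apply: cvgD; [apply: IH => k kn; apply: D; exact: ltnW|exact: D].
by apply/funext => z; rewrite big_ord_recr.
Qed.
End PhaseTools.

(** * Birkhoff sums near the singularities and their phases *)

Section NoCocycle.
Context {R : realType} (T : R -> R) (As : seq R) (hT : cut_translation T As).
Notation mu := (@lebesgue_measure R).

Lemma negligible_preimage_iter n (N : set R) :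
  mu.-negligible N -> mu.-negligible (iter n T @^-1` N).
Proof.
move=> [M [mM M0 NM]]; exists (iter n T @^-1` M); split.
- exact: (measurable_preimage_iter hT).
- by rewrite -M0; exact: (measure_preimage_iter hT).
- by move=> x; exact: NM.
Qed.

Lemma ae_iter (P : R -> Prop) : {ae mu, forall x, P x} ->
  {ae mu, forall x, forall k, P (iter k T x)}.
Proof. by move=> h; apply/ae_foralln => k; exact: negligible_preimage_iter h. Qed.

Context (f f1 f2 : R -> R) (B C : R) (B0 : 0 < B) (C0 : 0 < C).
Context (hd1 : forall x, 0 < x < 1 -> x \notin As -> is_derive x (1 : R) f (f1 x)).
Context (hd2 : forall x, 0 < x < 1 -> x \notin As -> is_derive x (1 : R) f1 (f2 x)).
Context (hc2 : forall x, 0 < x < 1 -> x \notin As -> {for x, continuous f2}).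
Context (hB : forall x, 0 < x < 1 -> x \notin As -> - B <= f2 x).
Context (hC : forall x a, 0 < x < 1 -> x \notin As -> a \in As -> C / (x - a) ^+ 2 - B <= f2 x).

(** On the ball the close visit is still within 2 l of its cut and contributes at least C / (4 l^2)
    - B, every other step at least -B; the assumption on n B leaves half of the main term. *)
Lemma birkhoff_sum_convex y rho l n : 0 < rho <= l -> 0 <= y - rho -> y + rho <= 1 ->
  (forall k a, (k < n)%N -> a \in As -> rho <= `|iter k T y - a|) ->
  (exists k a, [/\ (k < n)%N, a \in As & `|iter k T y - a| <= l]) ->
  n%:R * B <= C / (8 * l ^+ 2) ->
  exists ph ph1 ph2 : R -> R, forall x, y - rho < x < y + rho ->
    [/\ is_derive x (1 : R) ph (ph1 x), is_derive x (1 : R) ph1 (ph2 x),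
      {for x, continuous ph2}, C / (8 * l ^+ 2) <= ph2 x &
      (forall k, (k <= n)%N -> iter k T x = x + (iter k T y - y)) /\
      ph x = \sum_(k < n) roof As f (iter k T x)].
Proof.
move=> /andP[rho0 rl] y0 y1 far [k0 [a0 [k0n a0A close]]] nB.
have l0 : 0 < l by lra.
pose sg k := iter k T y - y.
have unit x : y - rho < x < y + rho -> 0 <= x < 1 by lra.
have y01 : 0 <= y < 1 by lra.
have shift x k : y - rho < x < y + rho -> (k <= n)%N -> iter k T x = x + sg k.
  move=> hx kn; have xr : `|x - y| < rho by rewrite ltr_norml; apply/andP; split; lra.
  have := iter_shift_near hT (n := k) y01 (unit x hx) xr (fun k' a k'k => far k' a (leq_trans k'k kn)).
  by rewrite /sg; lra.
have inner x k : y - rho < x < y + rho -> (k < n)%N ->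
    0 < x + sg k < 1 /\ x + sg k \notin As.
  move=> hx kn; have kn' := ltnW kn.
  (* [iter_unit] only gives a weak lower bound; applied to a point left of [x] it gives the strict
     one at [x]. *)
  pose x' := (x + (y - rho)) / 2; have hx' : y - rho < x' < y + rho by rewrite /x'; lra.
  have := unit x hx; rewrite -(iter_unit hT k) (shift x k hx kn') => /andP[_ b1].
  have := unit x' hx'; rewrite -(iter_unit hT k) (shift x' k hx' kn') => /andP[b0 _].
  split; first by rewrite /x' in b0; lra.
  apply/negP => xA; have := far k _ kn xA; rewrite /sg leNgt => /negP; apply.
  by rewrite ltr_norml; apply/andP; split; lra.
exists (fun x => \sum_(k < n) f (x + sg k)), (fun x => \sum_(k < n) f1 (x + sg k)),
  (fun x => \sum_(k < n) f2 (x + sg k)) => x hx.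
split.
- apply: (@is_derive_bigsum R n (fun k z => f (z + sg k)) (fun k => f1 (x + sg k))) => k kn.
  by apply: is_derive_shift; have [h1 h2] := inner x k hx kn; exact: hd1.
- apply: (@is_derive_bigsum R n (fun k z => f1 (z + sg k)) (fun k => f2 (x + sg k))) => k kn.
  by apply: is_derive_shift; have [h1 h2] := inner x k hx kn; exact: hd2.
- apply: (@continuous_bigsum R n (fun k z => f2 (z + sg k))) => k kn.
  have [h1 h2] := inner x k hx kn; apply: continuous_comp; last exact: hc2.
  by apply: cvgD; [exact: cvg_id|exact: cvg_cst].
- rewrite (bigD1 (Ordinal k0n))//=.
  have [h1 h2] := inner x k0 hx k0n; have := hC h1 h2 a0A.
  have d0 : 0 < (x + sg k0 - a0) ^+ 2.
    rewrite lt_neqAle sqr_ge0 andbT eq_sym sqrf_eq0 subr_eq0; apply/negP => /eqP e.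
    by rewrite e a0A in h2.
  have dl : (x + sg k0 - a0) ^+ 2 <= (2 * l) ^+ 2.
    rewrite -(real_normK (num_real (x + sg k0 - a0))) lerXn2r ?nnegrE//; first by lra.
    have -> : x + sg k0 - a0 = (x - y) + (iter k0 T y - a0) by rewrite /sg; ring.
    apply: (le_trans (ler_normD _ _)); have : `|x - y| < rho by rewrite ltr_norml; apply/andP; split; lra.
    by lra.
  have i1 : C / (2 * l) ^+ 2 <= C / (x + sg k0 - a0) ^+ 2.
    by rewrite ler_wpM2l ?(ltW C0)// lef_pV2 ?posrE// exprn_gt0//; lra.
  have e4 : C / (2 * l) ^+ 2 = 2 * (C / (8 * l ^+ 2)) by field; lra.
  have s : - (n.-1%:R * B) <= \sum_(i < n | i != Ordinal k0n) f2 (x + sg i).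
    rewrite -mulrN (_ : n.-1%:R * - B = \sum_(i < n | i != Ordinal k0n) (- B)).
      apply: ler_sum => i _; have [h1' h2'] := inner x i hx (ltn_ord i); exact: hB.
    rewrite big_const iter_addr_0 mulr_natl; congr (_ *+ _).
    by have := cardC1 (Ordinal k0n); rewrite card_ord => <-; apply: eq_card => i; rewrite !inE.
  have nn : n%:R = n.-1%:R + 1 :> R by rewrite natr1 prednK// (leq_ltn_trans _ k0n).
  rewrite nn mulrDl mul1r in nB; lra.
split; first by move=> k kn; exact: shift.
apply: eq_bigr => k _; rewrite (shift x k hx (ltnW (ltn_ord k))).
have [/andP[h1 h1'] h2] := inner x k hx (ltn_ord k).
by rewrite /roof h2 andbT (ltW h1) h1'.
Qed.

Lemma cocycle_iter (S : R) (r G1 G2 : R -> R) x n :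
  (forall k, G1 (T (iter k T x)) = cos (S * r (iter k T x)) * G1 (iter k T x) - sin (S * r (iter k T x)) * G2 (iter k T x) /\
    G2 (T (iter k T x)) = sin (S * r (iter k T x)) * G1 (iter k T x) + cos (S * r (iter k T x)) * G2 (iter k T x)) ->
  let P := S * \sum_(k < n) r (iter k T x) in
  G1 (iter n T x) = cos P * G1 x - sin P * G2 x /\ G2 (iter n T x) = sin P * G1 x + cos P * G2 x.
Proof.
move=> h; elim: n => [|n /= [e1 e2]].
  by rewrite big_ord0 mulr0 /= cos0 sin0; split; ring.
rewrite /= big_ord_recr /= mulrDr cosD sinD; have [-> ->] := h n.
by rewrite e1 e2; split; ring.
Qed.
End NoCocycle.

Section NoFastCocycle.
Context {R : realType} (T : R -> R) (As : seq R) (hT : cut_translation T As).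
Notation mu := (@lebesgue_measure R).

Lemma lebesgue_ae_mono (P Q : R -> Prop) : {ae mu, forall x, P x} ->
  (forall x, P x -> Q x) -> {ae mu, forall x, Q x}.
Proof. by move=> hP PQ; apply: negligibleS hP => x /= nQ /PQ. Qed.

Lemma lebesgue_setU_le (A B : set R) (a b : R) : measurable A /\ (mu A <= a%:E)%E ->
  measurable B /\ (mu B <= b%:E)%E -> measurable (A `|` B) /\ (mu (A `|` B) <= (a + b)%:E)%E.
Proof.
move=> [mA Aa] [mB Bb]; split; first exact: measurableU.
by apply: (le_trans (measureU2 mu mA mB)); rewrite EFinD; exact: leeD.
Qed.

Lemma orbit_near_cuts_measure (rho : R) n : 0 < rho ->
  let V := \bigcup_(k in [set` iota 0 n]) (iter k T @^-1` (\bigcup_(a in [set` As]) `]a - rho, a + rho[%classic)) in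
  measurable V /\ (mu V <= (rho * 2 * (size As)%:R * n%:R)%:E)%E.
Proof.
move=> rho0 V; pose W : set R := \bigcup_(a in [set` As]) `]a - rho, a + rho[%classic.
have mW : measurable W by rewrite /W bigcup_seq; apply: bigsetU_measurable.
have muW : (mu W <= (rho *+ 2 *+ size As)%:E)%E.
  apply: lebesgue_bigcup_seq_const_le => a _; first exact: measurable_itv.
  rewrite lebesgue_measure_itv/= lte_fin; case: ifP => _; last by rewrite lee_fin; lra.
  by rewrite -EFinB lee_fin; lra.
split; first by apply: bigcup_measurable => k _; exact: (measurable_preimage_iter hT).
rewrite !mulr_natr -[n in (_ *+ n)%:E](size_iota 0).
apply: lebesgue_bigcup_seq_const_le => k _; first exact: (measurable_preimage_iter hT).
by apply: le_trans muW; rewrite le_eqVlt (measure_preimage_iter hT k mW) eqxx.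
Qed.

(* If G1 + i G2 is nearly constant on [u, v] and on its translate, then so is the
   ratio exp (i S ph) of the two. *)
Lemma phase_integral_le (ph G1 G2 : R -> R) (S t u v sg e p1 p2 q1 q2 : R) :
  measurable_fun [set: R] G1 -> measurable_fun [set: R] G2 ->
  (forall x, G1 x ^+ 2 + G2 x ^+ 2 = 1) -> u <= v ->
  p1 ^+ 2 + p2 ^+ 2 = 1 -> q1 ^+ 2 + q2 ^+ 2 = 1 ->
  cos t = p1 * q1 + p2 * q2 -> sin t = p2 * q1 - p1 * q2 ->
  {within `[u, v], continuous ph} ->
  {ae mu, forall x, u <= x <= v ->
    G1 (x + sg) = cos (S * ph x) * G1 x - sin (S * ph x) * G2 x /\
    G2 (x + sg) = sin (S * ph x) * G1 x + cos (S * ph x) * G2 x} ->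
  (\int[mu]_(x in `[(u + sg)%R, (v + sg)%R]) (`|G1 x - p1|)%:E <= e%:E)%E ->
  (\int[mu]_(x in `[(u + sg)%R, (v + sg)%R]) (`|G2 x - p2|)%:E <= e%:E)%E ->
  (\int[mu]_(x in `[u, v]) (`|G1 x - q1|)%:E <= e%:E)%E ->
  (\int[mu]_(x in `[u, v]) (`|G2 x - q2|)%:E <= e%:E)%E ->
  ((v - u)%:E <= \int[mu]_(x in `[u, v]) (cos (S * ph x - t))%:E + (8 * e)%:E)%E.
Proof.
move=> m1 m2 unit uv hp hq ct st cph coc i1 i2 i3 i4.
have muv : measurable (`[u, v]%classic : set R) by exact: measurable_itv.
have muI : mu `[u, v] = (v - u)%:E.
  rewrite lebesgue_measure_itv/= lte_fin; case: ltP => [_|vu]; first by rewrite EFinB.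
  by rewrite (@le_anti _ _ u v) ?uv// subrr.
have mdist (G : R -> R) (c : R) : measurable_fun [set: R] G ->
    measurable_fun [set: R] (fun x => (`|G x - c|)%:E).
  by move=> mG; apply/measurable_EFinP; apply: measurableT_comp => //; exact: measurable_funB.
have msh (g : R -> \bar R) : measurable_fun [set: R] g -> measurable_fun [set: R] (fun x => g (x + sg)).
  by move=> mg; apply: (measurableT_comp mg); exact: measurable_funD.
have shifted (G : R -> R) (c : R) : measurable_fun [set: R] G ->
    (\int[mu]_(x in `[(u + sg)%R, (v + sg)%R]) (`|G x - c|)%:E <= e%:E)%E ->
    (\int[mu]_(x in `[u, v]) (`|G (x + sg)%R - c|)%:E <= e%:E)%E.
  move=> mG; rewrite -(@integral_shift R u v sg (fun x => (`|G x - c|)%:E)) //; exact: mdist.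
have {}i1 := shifted _ _ m1 i1; have {}i2 := shifted _ _ m2 i2.
have ccos : {within `[u, v], continuous (fun x => cos (S * ph x - t))}.
  move=> x; apply: continuous_comp; last exact: continuous_cos.
  by apply: cvgB; [apply: cvgM; [exact: cvg_cst|exact: cph]|exact: cvg_cst].
have icos : mu.-integrable `[u, v] (EFin \o (fun x => cos (S * ph x - t))).
  by apply: continuous_compact_integrable => //; exact: segment_compact.
have mcos : measurable_fun `[u, v] (fun x => (cos (S * ph x - t))%:E) by case/integrableP : icos.
pose F1 (x : R) : \bar R := (`|G1 (x + sg) - p1|)%:E; pose F2 (x : R) : \bar R := (`|G2 (x + sg) - p2|)%:E.
pose F3 (x : R) : \bar R := (`|G1 x - q1|)%:E; pose F4 (x : R) : \bar R := (`|G2 x - q2|)%:E.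
have M1 : measurable_fun `[u, v] F1 by apply: measurable_funS (msh _ (mdist _ p1 m1)).
have M2 : measurable_fun `[u, v] F2 by apply: measurable_funS (msh _ (mdist _ p2 m2)).
have M3 : measurable_fun `[u, v] F3 by apply: measurable_funS (mdist _ q1 m1).
have M4 : measurable_fun `[u, v] F4 by apply: measurable_funS (mdist _ q2 m2).
pose F (x : R) : \bar R := (F1 x + F2 x + F3 x + F4 x)%E.
have F0 x : (0 <= F x)%E by rewrite !adde_ge0// lee_fin.
have M12 : measurable_fun `[u, v] (fun x => F1 x + F2 x)%E by exact: emeasurable_funD.
have M123 : measurable_fun `[u, v] (fun x => F1 x + F2 x + F3 x)%E by exact: emeasurable_funD.
have MF : measurable_fun `[u, v] F by exact: emeasurable_funD.
have IF : (\int[mu]_(x in `[u, v]) F x <= (4 * e)%:E)%E.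
  rewrite ge0_integralD//; last 2 first.
  - by move=> x _; rewrite !adde_ge0// lee_fin.
  - by move=> x _; rewrite lee_fin.
  rewrite ge0_integralD//; last 2 first.
  - by move=> x _; rewrite !adde_ge0// lee_fin.
  - by move=> x _; rewrite lee_fin.
  rewrite ge0_integralD//; last 2 first.
  - by move=> x _; rewrite lee_fin.
  - by move=> x _; rewrite lee_fin.
  rewrite (_ : 4 * e = e + e + e + e); last by ring.
  by rewrite !EFinD; apply: leeD => //; apply: leeD => //; exact: leeD.
(* [unit_phase_dist] says 1 <= cos + 2 F almost everywhere; 1 is added to make both integrands
   non-negative. *)
have main : (\int[mu]_(x in `[u, v]) (2%:E) <= \int[mu]_(x in `[u, v])
    ((1%:E + (cos (S * ph x - t))%:E) + 2%:E * F x))%E.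
  apply: ae_ge0_le_integral => //.
  - move=> x _; rewrite adde_ge0// ?mule_ge0//.
    by rewrite -EFinD lee_fin; have := cos_geN1 (S * ph x - t); lra.
  - apply: emeasurable_funD; first exact: emeasurable_funD.
    exact: measurable_funeM.
  apply: (lebesgue_ae_mono coc) => x hx; rewrite /= in_itv/= => /hx[h1 h2].
  rewrite /F /F1 /F2 /F3 /F4 -!EFinD lee_fin.
  have := unit_phase_dist h1 h2 (unit _) (unit _) hp hq.
  by rewrite cosB ct st; lra.
move: main; rewrite ge0_integralD//; last 4 first.
- by move=> x _; rewrite -EFinD lee_fin; have := cos_geN1 (S * ph x - t); lra.
- exact: emeasurable_funD.
- by move=> x _; rewrite mule_ge0.
- exact: measurable_funeM.
rewrite ge0_integralZl//.
have -> : (\int[mu]_(x in `[u, v]) (1%:E + (cos (S * ph x - t))%:E) =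
    (v - u)%:E + \int[mu]_(x in `[u, v]) (cos (S * ph x - t))%:E)%E.
  rewrite integralD//; last first.
    by apply: continuous_compact_integrable => //; [exact: segment_compact|exact: cst_continuous].
  by congr (_ + _)%E; rewrite -[RHS]mul1e -muI; exact: integral_cst.
have -> : (\int[mu]_(x in `[u, v]) 2%:E = (v - u)%:E + (v - u)%:E)%E.
  transitivity (2%:E * (v - u)%:E)%E; first by rewrite -muI; exact: integral_cst.
  by rewrite -EFinM -EFinD; congr (_%:E); ring.
rewrite -addeA leeD2lE// => h; apply: (le_trans h); rewrite leeD2l//.
by rewrite (_ : 8 * e = 2 * (4 * e)); [rewrite EFinM lee_wpmul2l|ring].
Qed.
End NoFastCocycle.

(** Van der Corput leaves at most rho / 8 and the four density errors rho / 16, less than the length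
    rho / 4 of the interval. *)
Lemma phase_budget {R : realType} (rho x : R) : 0 < rho -> 32 <= x ->
  ~ rho / 4 <= 4 * rho / x + 8 * (128^-1 * rho).
Proof.
move=> rho0 x32; have : 4 * rho / x <= rho / 8.
  rewrite ler_pdivrMr; last by lra.
  by nra.
by lra.
Qed.

Definition cocycle_at {R : realType} (T : R -> R) (As : seq R) (f : R -> R) (S : R) (G1 G2 : R -> R) (x : R) :=
  G1 (T x) = cos (S * roof As f x) * G1 x - sin (S * roof As f x) * G2 x /\
  G2 (T x) = sin (S * roof As f x) * G1 x + cos (S * roof As f x) * G2 x.

(* With h, l, X from [ergodic_close_approach] and rho = eta l, there is y in X whose
   orbit up to time n = 3 h comes within l but not within rho of the cuts, and such
   that G1 and G2 are nearly constant at scale rho around y and T^n y. Around y the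
   n-th Birkhoff sum of f then has second derivative at least ka / rho^2, too large
   for its exponential to be nearly constant. *)
Lemma no_fast_cocycle {R : realType} (T : R -> R) (As : seq R) (hT : cut_translation T As)
  (f f1 f2 : R -> R) (B C : R) (B0 : 0 < B) (C0 : 0 < C)
  (hd1 : forall x, 0 < x < 1 -> x \notin As -> is_derive x (1 : R) f (f1 x))
  (hd2 : forall x, 0 < x < 1 -> x \notin As -> is_derive x (1 : R) f1 (f2 x))
  (hc2 : forall x, 0 < x < 1 -> x \notin As -> {for x, continuous f2})
  (hB : forall x, 0 < x < 1 -> x \notin As -> - B <= f2 x)
  (hC : forall x a, 0 < x < 1 -> x \notin As -> a \in As -> C / (x - a) ^+ 2 - B <= f2 x) :
  ergodic_map lebesgue_measure `[0, 1[ T -> As != [::] ->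
  exists2 S0 : R, 0 < S0 & forall (S : R) (G1 G2 : R -> R), S0 <= S ->
    measurable_fun [set: R] G1 -> measurable_fun [set: R] G2 ->
    (forall x, G1 x ^+ 2 + G2 x ^+ 2 = 1) ->
    ~ {ae (@lebesgue_measure R), forall x, 0 <= x < 1 -> cocycle_at T As f S G1 G2 x}.
Proof.
move=> erg A0; pose sz : R := (size As)%:R.
have sz0 : 0 <= sz by rewrite ler0n.
pose c0 : R := (2 * (size As).+3%:R)^-1.
have c00 : 0 < c0 by rewrite invr_gt0 mulr_gt0 ?ltr0n.
have c01 : c0 < 1.
  rewrite invf_lt1 ?mulr_gt0 ?ltr0n//; have : (1 : R) <= (size As).+3%:R by rewrite ler1n.
  by lra.
(* Orbits too close to a cut cost at most 6 eta sz and the ends of [[0, 1]] at most 2 eta, together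
   c0 / 4; the four density exceptions cost another c0 / 4, so half of [X] survives. *)
pose eta : R := c0 / (8 * (3 * sz + 1)).
have eta0 : 0 < eta by rewrite divr_gt0// mulr_gt0//; lra.
have etaE : eta * (8 * (3 * sz + 1)) = c0 by rewrite /eta divfK// gt_eqF// mulr_gt0//; lra.
have eta1 : eta <= 1.
  by rewrite ler_pdivrMr ?mul1r; [lra|rewrite mulr_gt0//; lra].
(* Chosen so that C / (8 l^2) = ka / rho^2 for rho = eta l. *)
pose ka : R := C * eta ^+ 2 / 8.
have ka0 : 0 < ka by rewrite divr_gt0// mulr_gt0// exprn_gt0.
exists (32 / ka); first by rewrite divr_gt0.
move=> S G1 G2 SS m1 m2 unit coc.
have S0 : 0 < S by apply: lt_le_trans SS; rewrite divr_gt0.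
have Ska : 32 <= S * ka by rewrite -ler_pdivrMr.
have b1 x : `|G1 x| <= 1.
  rewrite -(@ler_pXn2r _ 2) ?nnegrE// expr1n real_normK ?num_real//.
  by have := unit x; have := sqr_ge0 (G2 x); lra.
have b2 x : `|G2 x| <= 1.
  rewrite -(@ler_pXn2r _ 2) ?nnegrE// expr1n real_normK ?num_real//.
  by have := unit x; have := sqr_ge0 (G1 x); lra.
have e0 : (0 : R) < 128^-1 by rewrite invr_gt0.
have d0 : 0 < c0 / 16 by rewrite divr_gt0.
have [r1 [N1 [r10 mN1 muN1 good1]]] := density_scale m1 b1 e0 d0.
have [r2 [N2 [r20 mN2 muN2 good2]]] := density_scale m2 b2 e0 d0.
(* The bound C / (24 B), with l h <= 1, gives n B <= C / (8 l^2) for n = 3 h. Halving makes the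
   comparisons with [r1] and [r2] strict. *)
pose delta := Num.min (Num.min (Num.min r1 r2) (C / (24 * B))) 1 / 2.
have q0 : 0 < C / (24 * B) by rewrite divr_gt0// mulr_gt0.
have delta0 : 0 < delta by rewrite divr_gt0// !lt_min r10 r20 q0 ltr01.
have ldelta l : 0 < l <= delta -> [/\ l < r1, l < r2, l <= C / (24 * B) & l <= 1].
  rewrite ler_pdivlMr// !le_min => /andP[l0 /andP[/andP[/andP[h1 h2] h3] h4]].
  by clear -l0 h1 h2 h3 h4; split; lra.
have [h [l [X [hl lh [mX X01] muX near]]]] := ergodic_close_approach hT erg A0 delta0.
have [lr1 lr2 lq l1] := ldelta l hl; case/andP: hl => l0 _.
pose n := (3 * h)%N; pose rho := eta * l.
have rho0 : 0 < rho by rewrite mulr_gt0.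
have rl : rho <= l by rewrite ler_piMl// ltW.
have nh : n%:R = 3 * h%:R :> R by rewrite natrM.
have [mV muV] := orbit_near_cuts_measure hT n rho0.
set V := (\bigcup_(k in _) _) in mV muV.
have W0 : measurable (`[0, rho]%classic : set R) /\ (lebesgue_measure `[0%R, rho] <= rho%:E)%E.
  by split; [exact: measurable_itv|rewrite lebesgue_measure_itv/= lte_fin rho0 oppr0 adde0].
have W1 : measurable (`[1 - rho, 1]%classic : set R) /\ (lebesgue_measure `[(1 - rho)%R, 1%R] <= rho%:E)%E.
  split; first exact: measurable_itv.
  rewrite lebesgue_measure_itv/= lte_fin; case: ifP => _; last by rewrite lee_fin ltW.
  by rewrite -EFinB lee_fin; clear -rho0; lra.
have P1 : measurable (iter n T @^-1` N1) /\ (lebesgue_measure (iter n T @^-1` N1) <= (c0 / 16)%:E)%E.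
  split; first exact: (measurable_preimage_iter hT).
  by apply: le_trans muN1; rewrite le_eqVlt (measure_preimage_iter hT n mN1) eqxx.
have P2 : measurable (iter n T @^-1` N2) /\ (lebesgue_measure (iter n T @^-1` N2) <= (c0 / 16)%:E)%E.
  split; first exact: (measurable_preimage_iter hT).
  by apply: le_trans muN2; rewrite le_eqVlt (measure_preimage_iter hT n mN2) eqxx.
have [mU muU] := lebesgue_setU_le (lebesgue_setU_le (lebesgue_setU_le (conj mN1 muN1) (conj mN2 muN2))
  (lebesgue_setU_le P1 P2)) (lebesgue_setU_le (conj mV muV) (lebesgue_setU_le W0 W1)).
set U := (_ `|` _) in mU muU.
have [y Xy nU] : exists2 y, X y & ~ U y.
  apply: contrapT => no; have XU : X `<=` U.
    by move=> y Xy; apply: contrapT => nU; apply: no; exists y.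
  have := le_trans muX (le_trans (le_lebesgue mX mU XU) muU).
  rewrite lee_fin nh -/sz -/c0 /rho => bad.
  have e1 : eta * l * 2 * sz * (3 * h%:R) = 6 * eta * sz * (l * h%:R) by ring.
  have p6 : 0 <= 6 * eta * sz by apply: mulr_ge0 => //; apply: mulr_ge0 => //; exact: ltW.
  have b : 6 * eta * sz * (l * h%:R) <= 6 * eta * sz by exact: ler_piMr.
  have b' : eta * l <= eta by apply: ler_piMr => //; exact: ltW.
  rewrite e1 in bad; clear -bad b b' etaE eta0 sz0 c00 c01; lra.
have nN1 : ~ N1 y by move=> ?; apply: nU; left; left; left.
have nN2 : ~ N2 y by move=> ?; apply: nU; left; left; right.
have nP1 : ~ N1 (iter n T y) by move=> ?; apply: nU; left; right; left.
have nP2 : ~ N2 (iter n T y) by move=> ?; apply: nU; left; right; right.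
have nV : ~ V y by move=> ?; apply: nU; right; left.
have y01 : 0 <= y < 1 by have := X01 _ Xy; rewrite /= in_itv.
have y0 : 0 <= y - rho.
  rewrite leNgt; apply/negP => hy; apply: nU; right; right; left.
  by rewrite /= in_itv/=; clear -hy y01; lra.
have y1 : y + rho <= 1.
  rewrite leNgt; apply/negP => hy; apply: nU; right; right; right.
  by rewrite /= in_itv/=; clear -hy y01; lra.
have far k a : (k < n)%N -> a \in As -> rho <= `|iter k T y - a|.
  move=> kn aA; rewrite leNgt; apply/negP => hk; apply: nV; exists k.
    by rewrite /mkset mem_iota add0n kn.
  by exists a => //; rewrite /= in_itv/=; move: hk; rewrite ltr_norml => hk; clear -hk; lra.
have nB : n%:R * B <= C / (8 * l ^+ 2).
  rewrite nh ler_pdivlMr ?mulr_gt0 ?exprn_gt0//.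
  have e1 : 3 * h%:R * B * (8 * l ^+ 2) = (l * h%:R) * (24 * B * l) by ring.
  rewrite e1; apply: (@le_trans _ _ (24 * B * l)).
    by apply: ler_piMl => //; rewrite !mulr_ge0 // ltW.
  by move: lq; rewrite ler_pdivlMr ?mulr_gt0// mulrC.
have rr : 0 < rho <= l by rewrite rho0.
have [ph [ph1 [ph2 phP]]] := birkhoff_sum_convex hT C0 hd1 hd2 hc2 hB hC rr y0 y1 far (near y Xy) nB.
have kaE : C / (8 * l ^+ 2) = ka / rho ^+ 2 by rewrite /ka /rho; field; rewrite !gt_eqF.
pose p1 := G1 (iter n T y); pose p2 := G2 (iter n T y); pose q1 := G1 y; pose q2 := G2 y.
have up : p1 ^+ 2 + p2 ^+ 2 = 1 by exact: unit.
have uq : q1 ^+ 2 + q2 ^+ 2 = 1 by exact: unit.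
have [t [ct st]] : exists t, cos t = p1 * q1 + p2 * q2 /\ sin t = p2 * q1 - p1 * q2.
  apply: unit_angle; transitivity ((p1 ^+ 2 + p2 ^+ 2) * (q1 ^+ 2 + q2 ^+ 2)); first by ring.
  by rewrite up uq mulr1.
have [u [v [yu vy uv cosuv]]] := @convex_phase_cos_le R ph ph1 ph2 y rho ka S t rho0 ka0 S0
  (fun x hx => let: And5 a _ _ _ _ := phP x hx in a)
  (fun x hx => let: And5 _ a _ _ _ := phP x hx in a)
  (fun x hx => let: And5 _ _ a _ _ := phP x hx in a)
  (fun x hx => eq_rect _ (fun z => z <= ph2 x) (let: And5 _ _ _ a _ := phP x hx in a) _ kaE).
have uv' : u <= v by clear -uv rho0; lra.
pose sg := iter n T y - y.
have ysg : iter n T y = y + sg by rewrite /sg; ring.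
have Ty01 : 0 <= y + sg < 1 by rewrite -ysg (iter_unit hT).
have inuv x : u <= x <= v -> y - rho < x < y + rho by move=> hx; clear -yu vy hx; lra.
have cph : {within `[u, v], continuous ph}.
  apply: continuous_in_subspaceT => x; rewrite inE /= in_itv/= => hx.
  have [D _ _ _ _] := phP x (inuv x hx).
  by apply: differentiable_continuous; apply/derivable1_diffP; case: D.
have cocn : {ae (@lebesgue_measure R), forall x, u <= x <= v ->
    G1 (x + sg) = cos (S * ph x) * G1 x - sin (S * ph x) * G2 x /\
    G2 (x + sg) = sin (S * ph x) * G1 x + cos (S * ph x) * G2 x}.
  apply: (lebesgue_ae_mono (ae_iter hT coc)) => x hx xuv.
  have [_ _ _ _ [shift ->]] := phP x (inuv x xuv).
  rewrite -(shift n (leqnn n)).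
  have x01 : 0 <= x < 1 by have hx' := inuv x xuv; clear -hx' y0 y1; lra.
  apply: (@cocycle_iter R T S (roof As f) G1 G2 x n) => k.
  by apply: hx; rewrite (iter_unit hT).
have rho1 : 0 < rho < r1 by rewrite rho0 (le_lt_trans rl).
have rho2 : 0 < rho < r2 by rewrite rho0 (le_lt_trans rl).
have yu' : iter n T y - rho < u + sg by rewrite ysg addrAC ltrD2r.
have vy' : v + sg < iter n T y + rho by rewrite ysg addrAC ltrD2r.
have uvs : u + sg <= v + sg by rewrite lerD2r.
rewrite -ysg in Ty01.
have i1 : (\int[@lebesgue_measure R]_(x in `[(u + sg)%R, (v + sg)%R]) (`|G1 x - p1|)%:E <= (128^-1 * rho)%:E)%E.
  exact: good1.
have i2 : (\int[@lebesgue_measure R]_(x in `[(u + sg)%R, (v + sg)%R]) (`|G2 x - p2|)%:E <= (128^-1 * rho)%:E)%E.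
  exact: good2.
have i3 : (\int[@lebesgue_measure R]_(x in `[u, v]) (`|G1 x - q1|)%:E <= (128^-1 * rho)%:E)%E by exact: good1.
have i4 : (\int[@lebesgue_measure R]_(x in `[u, v]) (`|G2 x - q2|)%:E <= (128^-1 * rho)%:E)%E by exact: good2.
have main := phase_integral_le m1 m2 unit uv' up uq ct st cph cocn i1 i2 i3 i4.
have := le_trans main (leeD cosuv (lexx _)).
by rewrite -EFinD lee_fin uv; exact: phase_budget.
Qed.

(** * Complex phases and the cohomological equation at any nonzero frequency *)

Section UnitComplex.
Context {R : realType}.
Implicit Types (z w : R[i]).

Lemma norm1_Re_Im z : `|z| = 1 -> complex.Re z ^+ 2 + complex.Im z ^+ 2 = 1.
Proof.
case: z => a b; rewrite normc_def /= => -[] h.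
have ab0 : 0 <= a ^+ 2 + b ^+ 2 by rewrite addr_ge0 ?sqr_ge0.
by rewrite -(sqr_sqrtr ab0) h expr1n.
Qed.

Lemma Re_Im_norm1 (a b : R) : a ^+ 2 + b ^+ 2 = 1 -> `|Complex a b| = 1.
Proof. by move=> h; rewrite normc_def /= h sqrtr1. Qed.

Lemma expi_mul (t : R) z :
  complex.Re (expi t * z) = cos t * complex.Re z - sin t * complex.Im z /\
  complex.Im (expi t * z) = sin t * complex.Re z + cos t * complex.Im z.
Proof. by case: z => a b /=; split=> //; rewrite addrC. Qed.

Lemma complexP z w : complex.Re z = complex.Re w -> complex.Im z = complex.Im w -> z = w.
Proof. by case: z w => a b [c d] /= -> ->. Qed.

Lemma expiD (a b : R) : expi (a + b) = expi a * expi b.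
Proof. by apply: complexP => /=; rewrite ?cosD ?sinD // addrC. Qed.

Lemma expi0 : expi (0 : R) = 1.
Proof. by rewrite /expi cos0 sin0. Qed.

Lemma expiX (a : R) m : expi a ^+ m = expi (m%:R * a).
Proof.
elim: m => [|m IH]; first by rewrite mul0r expi0.
by rewrite exprS IH -expiD -natr1 mulrDl mul1r addrC.
Qed.

Lemma norm_expi (a : R) : `|expi a| = 1.
Proof. by apply: Re_Im_norm1; exact: cos2Dsin2. Qed.

End UnitComplex.

Section CMeasurable.
Context d (X : measurableType d) (R : realType).
Implicit Types (g h : X -> R[i]) (D : set X).

Lemma cmeasurableM D g h : cmeasurable_fun D g -> cmeasurable_fun D h ->
  cmeasurable_fun D (fun x => g x * h x).
Proof.
move=> [g1 g2] [h1 h2]; split.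
  rewrite (_ : (fun p => _) = (fun p => complex.Re (g p) * complex.Re (h p) - complex.Im (g p) * complex.Im (h p))).
    by apply: measurable_funB; exact: measurable_funM.
  by apply/funext => x; case: (g x) (h x) => a b [c e].
rewrite (_ : (fun p => _) = (fun p => complex.Re (g p) * complex.Im (h p) + complex.Im (g p) * complex.Re (h p))).
  by apply: measurable_funD; exact: measurable_funM.
by apply/funext => x; case: (g x) (h x) => a b [c e].
Qed.

Lemma cmeasurable_cst D (c : R[i]) : cmeasurable_fun D (fun=> c).
Proof. by split; exact: measurable_cst. Qed.

Lemma cmeasurableX D g m : cmeasurable_fun D g -> cmeasurable_fun D (fun x => g x ^+ m).
Proof.
move=> mg; elim: m => [|m IH]; first exact: cmeasurable_cst.
by under eq_fun do rewrite exprS; exact: cmeasurableM.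
Qed.

Lemma cmeasurable_expi D (t : X -> R) : measurable_fun D t -> cmeasurable_fun D (fun x => expi (t x)).
Proof.
move=> mt; split; apply: measurableT_comp mt; apply: continuous_measurable_fun.
  exact: continuous_cos.
exact: continuous_sin.
Qed.
End CMeasurable.

Section NoEigenvalue.
Context {R : realType} (T : R -> R) (As : seq R) (hT : cut_translation T As).
Notation mu := (@lebesgue_measure R).
Context (f f1 f2 : R -> R) (B C : R) (B0 : 0 < B) (C0 : 0 < C).
Context (hd1 : forall x, 0 < x < 1 -> x \notin As -> is_derive x (1 : R) f (f1 x)).
Context (hd2 : forall x, 0 < x < 1 -> x \notin As -> is_derive x (1 : R) f1 (f2 x)).
Context (hc2 : forall x, 0 < x < 1 -> x \notin As -> {for x, continuous f2}).
Context (hB : forall x, 0 < x < 1 -> x \notin As -> - B <= f2 x).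
Context (hC : forall x a, 0 < x < 1 -> x \notin As -> a \in As -> C / (x - a) ^+ 2 - B <= f2 x).

(* Powers of a solution of frequency s solve the equation at the multiples of s,
   so frequencies may be assumed to be large. *)
Lemma no_cocycle (s : R) (G : R -> R[i]) : ergodic_map mu `[0, 1[ T -> As != [::] ->
  s != 0 -> cmeasurable_fun [set: R] G -> (forall x, `|G x| = 1) ->
  ~ {ae mu, forall x, 0 <= x < 1 -> G (T x) = expi (s * roof As f x) * G x}.
Proof.
move=> erg A0; have [S0 S00 fast] := no_fast_cocycle hT B0 C0 hd1 hd2 hc2 hB hC erg A0.
(* Complex conjugation of [G] changes the sign of the frequency. *)
wlog s0 : s G / 0 < s.
  move=> wl s0 mG nG coc; have [sp|] := ltP 0 s; first exact: (wl s G).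
  rewrite le_eqVlt (negbTE s0) /= => sn.
  apply: (wl (- s) (fun x => Complex (complex.Re (G x)) (- complex.Im (G x)))).
  - by rewrite oppr_gt0.
  - by rewrite oppr_eq0.
  - by case: mG => mG1 mG2; split => //=; exact: measurable_funN.
  - by move=> x; apply: Re_Im_norm1; rewrite sqrrN; exact: norm1_Re_Im.
  - apply: (lebesgue_ae_mono coc) => x h x01; rewrite h//.
    have [-> ->] := expi_mul (s * roof As f x) (G x).
    have [e1 e2] := expi_mul (- s * roof As f x) (Complex (complex.Re (G x)) (- complex.Im (G x))).
    apply: complexP; rewrite ?e1 ?e2 /= mulNr cosN sinN; ring.
move=> _ mG nG coc; pose m := (Num.truncn (S0 / s)).+1.
have ms : S0 <= m%:R * s by rewrite -ler_pdivrMr// ltW// truncnS_gt.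
have [m1 m2] := cmeasurableX m mG.
apply: (fast (m%:R * s) _ _ ms m1 m2).
- by move=> x; apply: norm1_Re_Im; rewrite normrX nG expr1n.
apply: (lebesgue_ae_mono coc) => x h x01; rewrite /cocycle_at h// exprMn expiX.
by rewrite mulrA; exact: expi_mul.
Qed.
End NoEigenvalue.

(** * Eigenfunctions of the special flow *)

Section SuspensionMap.
Context {R : realType} (T0 : R -> R) (As : seq R) (f : R -> R).
Notation mu := (@lebesgue_measure R).
Notation mu2 := (@lebesgue_measure R \x @lebesgue_measure R)%E.
Notation A := [set` As].
Notation T := (extend_id T0).
Notation r := (roof As f).
Notation D := (flow_space A f).
Context (hT : cut_translation T As).
Context (T01 : `[0, 1[ `<=` T0 @^-1` `[0, 1[).
Context (mr : measurable_fun [set: R] r).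
Context (f0 : forall x, 0 <= x < 1 -> x \notin As -> 0 <= f x).

Lemma roof_ge0 x : 0 <= r x.
Proof. by rewrite /roof; case: ifP => // /andP[x01 xA]; exact: f0. Qed.

Lemma roof_f k x : 0 <= x < 1 -> iter k T x \notin As -> f (iter k T x) = r (iter k T x).
Proof. by move=> x01 kA; rewrite /roof (iter_unit hT) x01 kA. Qed.

Definition height n x := \sum_(k < n) r (iter k T x).

Lemma height_le m n x : (m <= n)%N -> height m x <= height n x.
Proof.
elim: n => [|n IH]; first by rewrite leqn0 => /eqP ->.
rewrite leq_eqVlt => /predU1P[->//|]; rewrite ltnS => /IH h; apply: le_trans h _.
by rewrite /height big_ord_recr /= lerDl roof_ge0.
Qed.

Lemma heightS n x : height n.+1 x = r x + height n (T x).
Proof.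
rewrite /height big_ord_recl; congr (_ + _); apply: eq_bigr => k _.
by rewrite lift0 iterSr.
Qed.

Lemma measurable_height n : measurable_fun [set: R] (height n).
Proof.
elim: n => [|n IH].
  by apply: (eq_measurable_fun (cst (0 : R))) => [x _|]; [rewrite /height big_ord0|exact: measurable_cst].
apply: (eq_measurable_fun (fun x => height n x + r (iter n T x))) => [x _|].
  by rewrite /height big_ord_recr.
by apply: measurable_funD => //; exact: (measurableT_comp mr (measurable_iter hT n)).
Qed.

(* (x, t) in [stage n]: moving up for time t from (x, 0) crosses the roof n
   times and ends at [land n (x, t)]. *)
Definition stage n : set (R * R) :=
  [set p | 0 <= p.1 < 1 /\ height n p.1 <= p.2 < height n.+1 p.1].

Definition land n (p : R * R) : R * R := (iter n T p.1, p.2 - height n p.1).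

(** Since f >= 0 the heights are nondecreasing; a zero of the roof only makes a stage empty over
    that point. *)
Lemma stage_unique m n p : stage m p -> stage n p -> m = n.
Proof.
wlog mn : m n / (m <= n)%N.
  by move=> wl hm hn; have [mn|/ltnW mn] := leqP m n; [exact: wl|apply/esym/wl].
move=> [_ /andP[_ h1]] [_ /andP[h2 _]]; move: mn; rewrite leq_eqVlt => /predU1P[//|mn].
by have := height_le p.1 mn; rewrite leNgt (le_lt_trans h2 h1).
Qed.

Lemma stage_land n p : stage n p -> D (land n p).
Proof.
move=> [p01 /andP[h1 h2]]; rewrite flow_spaceE /=.
by move: h2; rewrite /height big_ord_recr /= -/(height n p.1); lra.
Qed.

Lemma measurable_land n : measurable_fun [set: R * R] (land n).
Proof.
apply: measurable_fun_pair; first exact: (measurableT_comp (measurable_iter hT n) measurable_fst).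
apply: measurable_funB; first exact: measurable_snd.
exact: (measurableT_comp (measurable_height n) measurable_fst).
Qed.

Lemma measurable_stage n : measurable (stage n).
Proof.
rewrite (_ : stage n = [set p | (0 <= p.1) && (p.1 < 1) && ((height n p.1 <= p.2) && (p.2 < height n.+1 p.1))]).
  apply: measurable_set_bool.
  have mh m : measurable_fun [set: R * R] (fun p : R * R => height m p.1).
    exact: (measurableT_comp (measurable_height m) measurable_fst).
  apply: measurable_and; apply: measurable_and.
  - by apply: measurable_fun_ler => //; exact: measurable_fst.
  - by apply: measurable_fun_ltr => //; exact: measurable_fst.
  - by apply: measurable_fun_ler => //; exact: measurable_snd.
  - by apply: measurable_fun_ltr => //; exact: measurable_snd.
by apply/seteqP; split => p /=; [move=> [-> ->]|move=> /andP[]].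
Qed.

(** Over each [x], [land n] is a vertical translation onto the section over [iter n T x], and almost
    every orbit avoids the base points with non-null sections. *)
Lemma negligible_land n (N : set (R * R)) : mu2.-negligible N -> mu2.-negligible (land n @^-1` N).
Proof.
move=> [M [mM M0 NM]].
have mP : measurable (land n @^-1` M).
  by rewrite -[X in measurable X]setTI; exact: measurable_land.
exists (land n @^-1` M); split; [exact: mP| |by move=> p; exact: NM].
apply/(null_xsectionP mu mu mP).
have h := (null_xsectionP mu mu mM).1 M0.
apply: (lebesgue_ae_mono (ae_iter hT h)) => x hx.
rewrite -(hx n).
have -> : xsection (land n @^-1` M) x = (fun t => t + - height n x) @^-1` (xsection M (iter n T x)).
  by apply/seteqP; split => t; rewrite /xsection /land /preimage /= !inE.
by apply: lebesgue_measure_shift; exact: measurable_xsection.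
Qed.

Lemma negligible_fst (Z : set R) : mu.-negligible Z -> mu2.-negligible [set p | Z p.1].
Proof.
move=> [M [mM M0 ZM]].
have mP : measurable [set p : R * R | M p.1].
  by rewrite -[X in measurable X]setTI; exact: measurable_fst.
exists [set p | M p.1]; split; [exact: mP| |by move=> p; exact: ZM].
apply/(null_xsectionP mu mu mP); exists M; split => // x /= nx.
apply: contrapT => nM; apply: nx.
rewrite (_ : xsection _ x = set0) ?measure0//.
by apply/seteqP; split => t //; rewrite /xsection /= inE.
Qed.

(** Base points whose forward flow line exists for all times. *)
Definition regular x := [/\ 0 <= x < 1, forall k, iter k T x \notin As &
  forall M, exists n, M < height n x].

Lemma regular_stage x t : regular x -> 0 <= t -> exists n, stage n (x, t).
Proof.
move=> [x01 _ unb] t0; have [n0 hn0] := unb t.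
have ex : exists n, t < height n x by exists n0.
case: (ex_minnP ex) => -[|n] hn nmin; first by move: hn; rewrite /height big_ord0 ltNge t0.
exists n; split => //=; rewrite hn andbT leNgt; apply/negP => /nmin.
by rewrite ltnn.
Qed.

(** Crossing the roof once more than needed would put the end point below height 0, because the
    remaining roofs are non-negative. *)
Lemma flows_to_unique t q q1 q2 : flows_to T0 A f t q q1 -> flows_to T0 A f t q q2 -> q1 = q2.
Proof.
move=> [Dq D1 [n1 [a1 e1 h1]]] [_ D2 [n2 [a2 e2 h2]]].
suff e : n1 = n2 by rewrite (surjective_pairing q1) (surjective_pairing q2) e1 e2 h1 h2 e.
have q01 : 0 <= q.1 < 1 by case: Dq.
have key m1 m2 (p1 p2 : R * R) : D p1 -> D p2 ->
    (forall k, (k < m2)%N -> ~ A (iter k T0 q.1)) ->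
    p1.1 = iter m1 T0 q.1 ->
    p1.2 = q.2 + t - \sum_(0 <= k < m1) f (iter k T0 q.1) ->
    p2.2 = q.2 + t - \sum_(0 <= k < m2) f (iter k T0 q.1) -> ~ (m1 < m2)%N.
  move=> [_ _ p1D] [_ _ /andP[p2D _]] na i1 i2 i3 lt.
  have fpos k : (k < m2)%N -> 0 <= f (iter k T0 q.1).
    move=> km; apply: f0; last by apply/negP; exact: na.
    by rewrite -iter_extend_id// (iter_unit hT).
  move: p2D; rewrite i3 (big_cat_nat (n := m1))//=; last exact: ltnW.
  rewrite (@big_ltn _ _ _ m1 m2)// opprD addrA -i2 opprD addrA.
  have : 0 <= \sum_(m1.+1 <= i < m2) f (iter i T0 q.1).
    by rewrite big_nat; apply: sumr_ge0 => i /andP[_ im]; exact: fpos.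
  by move: p1D; rewrite i1; lra.
apply/eqP; rewrite eqn_leq; apply/andP; split; rewrite leqNgt; apply/negP.
  exact: (key n2 n1 q2 q1).
exact: (key n1 n2 q1 q2).
Qed.

(** In the unfolded coordinates [(x, t)] the flow is simply the translation of [t]. *)
Lemma special_flow_land x t t' n n' : regular x -> 0 <= t' -> stage n (x, t) -> stage n' (x, t + t') ->
  special_flow T0 A f t' (land n (x, t)) = land n' (x, t + t').
Proof.
move=> [x01 nA _] t'0 hn hn'.
have nn' : (n <= n')%N.
  rewrite leqNgt; apply/negP => n'n; case: hn hn' => _ /= /andP[h1 _] [_ /= /andP[_ h2]].
  by have := height_le x n'n; lra.
have iterE k : iter k T0 (iter n T x) = iter (k + n) T x.
  by rewrite -iter_extend_id ?(iter_unit hT)// -iterD.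
have fl : flows_to T0 A f t' (land n (x, t)) (land n' (x, t + t')).
  split; [exact: stage_land hn|exact: stage_land hn'|exists (n' - n)%N; split].
  - by move=> k _; rewrite /land /= iterE; apply/negP; exact: nA.
  - by rewrite /land /= iterE subnK.
  - rewrite /land /=.
    have -> : \sum_(0 <= k < n' - n) f (iter k T0 (iter n T x)) = height n' x - height n x.
      rewrite /height -!(big_mkord xpredT (fun k => r (iter k T x))).
      rewrite [in RHS](big_cat_nat (n := n))//= addrAC subrr add0r.
      transitivity (\sum_(0 <= k < n' - n) r (iter (k + n) T x)).
        by apply: eq_bigr => k _; rewrite iterE roof_f.
      by rewrite -(big_addn 0 n' n xpredT (fun k => r (iter k T x))) add0n.
    by ring.
rewrite /special_flow; case: xgetP => [q _ /=|/(_ (land n' (x, t + t')))/=]; rewrite t'0; last by [].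
by move=> fl'; exact: flows_to_unique fl' fl.
Qed.

(** Almost every orbit visits {r > 1} infinitely often, and each visit raises the height by at least
    1. *)
Lemma regular_ae : ergodic_map mu `[0, 1[ T -> (0 < mu [set x | (1 < r x)%R])%E ->
  {ae mu, forall x, 0 <= x < 1 -> regular x}.
Proof.
move=> erg F0; pose F : set R := [set x | 1 < r x].
have mF : measurable F by apply: measurable_set_bool; exact: measurable_fun_ltr.
have F01 : F `<=` `[0, 1[.
  by move=> x; rewrite /F /= /roof in_itv/=; case: ifP => [/andP[]//|_]; rewrite ltr10.
have rec := ergodic_recurrent hT erg mF F01 F0.
have cA : countable (A : set R) by apply: finite_set_countable; exact: finite_seq.
have mA : measurable (A : set R) by exact: countable_measurable.
have nA : mu.-negligible (A : set R).
  by apply/negligibleP => //; exact: countable_lebesgue_measure0.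
have n1 : mu.-negligible (\bigcup_k (iter k T @^-1` A)).
  by apply: negligible_bigcup => k; exact: (negligible_preimage_iter hT).
have n2 : mu.-negligible (`[0, 1[ `\` recurrent T F).
  by apply/negligibleP => //; apply: measurableD => //; exact: (measurable_recurrent hT).
apply: negligibleS (negligibleU n1 n2) => x /= /not_implyP[x01 nreg].
apply: contrapT => /not_orP[h1 h2]; apply: nreg; split => //.
  by move=> k; apply/negP => kA; apply: h1; exists k.
have [_ rx] : recurrent T F x.
  by apply: contrapT => nr; apply: h2; split => //; rewrite /= in_itv.
have unb (m : nat) : exists n, m%:R <= height n x.
  elim: m => [|m [n hn]]; first by exists 0%N; rewrite /height big_ord0.
  have [k nk Fk] := rx n; exists k.+1; rewrite /height big_ord_recr /= -natr1.
  by apply: lerD; [exact: le_trans hn (height_le x nk)|exact: ltW].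
move=> M; have [n hn] := unb (Num.truncn M).+1; exists n.
by apply: lt_le_trans hn; exact: truncnS_gt.
Qed.

Lemma negligible_avoid (N : set R) (a : R) : mu.-negligible N -> exists2 t, a <= t & ~ N t.
Proof.
move=> nN; apply: contrapT => no.
have : mu.-negligible (`[a, a + 1]%classic : set R).
  apply: negligibleS nN => t /=; rewrite in_itv/= => /andP[at_ _].
  by apply: contrapT => nNt; apply: no; exists t.
move=> /(negligibleP mu (measurable_itv _)) /=; rewrite lebesgue_measure_itv/= lte_fin ltrDl ltr01.
by rewrite -EFinB addrAC subrr add0r => -[] /eqP; rewrite oner_eq0.
Qed.
End SuspensionMap.

Section NullProductSections.
Local Open Scope ereal_scope.
Context d1 d2 d3 (X1 : measurableType d1) (X2 : measurableType d2) (X3 : measurableType d3) (R : realType).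
Context (m1 : {sigma_finite_measure set X1 -> \bar R}).
Context (m2 : {sigma_finite_measure set X2 -> \bar R}).
Context (m3 : {sigma_finite_measure set X3 -> \bar R}).

Lemma sigma_finite_product : sigma_finite [set: (X1 * X2)%type] (m1 \x m2).
Proof.
have /sigma_finiteP[F [TF ndF Foo]] := sigma_finiteT m1.
have /sigma_finiteP[G [TG ndG Goo]] := sigma_finiteT m2.
exists (fun n => F n `*` G n).
  apply/seteqP; split => // -[x y] _.
  have [n _ Fn] : (\bigcup_n F n) x by rewrite -TF.
  have [k _ Gk] : (\bigcup_n G n) y by rewrite -TG.
  exists (maxn n k) => //; split => /=.
    by move: x Fn; exact/subsetPset/ndF/leq_maxl.
  by move: y Gk; exact/subsetPset/ndG/leq_maxr.
move=> k; have [mF Fk] := Foo k; have [mG Gk] := Goo k.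
split; first exact: measurableX.
by rewrite product_measure1E// lte_mul_pinfty// ge0_fin_numE.
Qed.

(** Exchange of quantifiers: from almost every p for almost every z, to almost every z for almost
    every p. *)
Lemma null_ysections_xsections (S : set ((X1 * X2) * X3)) : measurable S ->
  {ae m3, forall z, (m1 \x m2) (ysection S z) = 0} ->
  {ae (m1 \x m2), forall p, m3 (xsection S p) = 0}.
Proof.
move=> mS h.
pose m12 : {measure set (X1 * X2)%type -> \bar R} := m1 \x m2.
pose M : {sigma_finite_measure set (X1 * X2)%type -> \bar R} := HB.pack (m1 \x m2) m12 (Measure_isSigmaFinite.Build _ _ _ m12 sigma_finite_product).
exact: (null_xsectionP M m3 mS).1 ((null_ysectionP M m3 mS).2 h).
Qed.
End NullProductSections.

Lemma negligible_shift {R : realType} (c : R) (N : set R) : (@lebesgue_measure R).-negligible N ->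
  (@lebesgue_measure R).-negligible [set u | N (u + c)].
Proof.
move=> [M [mM M0 NM]].
exists ((fun x => x + c) @^-1` M); split; last by move=> u; exact: NM.
- have mS : measurable_fun [set: R] (fun x : R => x + c : measurableTypeR R) by exact: measurable_funD.
  by rewrite -[X in measurable X]setTI; exact: mS.
- exact: etrans (lebesgue_measure_shift c mM) M0.
Qed.

Section EigenCocycle.
Context {R : realType} (T0 : R -> R) (As : seq R) (f : R -> R).
Notation mu := (@lebesgue_measure R).
Notation mu2 := (@lebesgue_measure R \x @lebesgue_measure R)%E.
Notation A := [set` As].
Notation T := (extend_id T0).
Notation r := (roof As f).
Notation D := (flow_space A f).
Notation stage := (stage T0 As f).
Notation land := (land T0 As f).
Notation height := (height T0 As f).
Notation regular := (regular T0 As f).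
Context (hT : cut_translation T As).
Context (T01 : `[0, 1[ `<=` T0 @^-1` `[0, 1[).
Context (mr : measurable_fun [set: R] r).
Context (f0 : forall x, 0 <= x < 1 -> x \notin As -> 0 <= f x).
Context (s : R) (g : R * R -> R[i]).
Context (eig : is_eigenfunction mu2 D (special_flow T0 A f) s g).

Let om := 2 * pi * s.
Let g1 p : R[i] := if `[< D p >] then g p else 1.
Let k_ n (p : R * R) : R[i] := expi (- (om * p.2)) * g1 (land n p).
(* g along the orbit of (x, 0), with the factor of the eigenvalue removed: for
   almost every x this does not depend on t. *)
Let K p : R[i] := if `[< exists n, stage n p >] then k_ (xget 0%N [set n | stage n p]) p else 1.

Let K_stage n p : stage n p -> K p = k_ n p.
Proof.
move=> hn; rewrite /K; have -> : `[< exists n, stage n p >] by apply/asboolP; exists n.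
congr (k_ _ _); case: xgetP => [m _ hm|/(_ n)//].
exact: (stage_unique f0 hm hn).
Qed.

Let norm_g1 p : `|g1 p| = 1.
Proof. by case: eig => _ ng _; rewrite /g1; case: asboolP => [/ng|_]; rewrite ?normr1. Qed.

Let norm_K p : `|K p| = 1.
Proof.
by rewrite /K; case: ifP => _; rewrite ?normr1// /k_ normrM norm_g1 norm_expi mulr1.
Qed.

Let cmeasurable_g1 : cmeasurable_fun [set: R * R] g1.
Proof.
case: eig => -[mg mg'] _ _.
have mD := measurable_flow_space mr.
have mCD := measurableC mD.
rewrite (_ : [set: R * R] = D `|` ~` D); last by rewrite setUv.
split; apply/measurable_funU => //; split.
- by apply: eq_measurable_fun mg => p; rewrite inE => Dp; rewrite /g1 asboolT.
- apply: (eq_measurable_fun (cst (1 : R))) => [p|]; last exact: measurable_cst.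
  by rewrite inE => Dp; rewrite /g1 asboolF.
- by apply: eq_measurable_fun mg' => p; rewrite inE => Dp; rewrite /g1 asboolT.
- apply: (eq_measurable_fun (cst (0 : R))) => [p|]; last exact: measurable_cst.
  by rewrite inE => Dp; rewrite /g1 asboolF.
Qed.

Let cmeasurable_k n : cmeasurable_fun [set: R * R] (k_ n).
Proof.
apply: cmeasurableM.
  apply: cmeasurable_expi; apply: measurable_funN; apply: measurable_funM; first exact: measurable_cst.
  exact: measurable_snd.
have ml := measurable_land hT mr n.
by case: cmeasurable_g1 => m1 m2; split; [exact: (measurableT_comp m1 ml)|exact: (measurableT_comp m2 ml)].
Qed.

Let cmeasurable_K : cmeasurable_fun [set: R * R] K.
Proof.
pose F n := if n is m.+1 then stage m else ~` \bigcup_n stage n.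
have mst n : measurable (stage n) by exact: (measurable_stage hT mr).
have mF n : measurable (F n).
  by case: n => [|n] //=; apply: measurableC; exact: bigcupT_measurable.
have UF : [set: R * R] = \bigcup_n F n.
  apply/seteqP; split => // p _; have [[n _ hn]|nh] := pselect ((\bigcup_n stage n) p).
    by exists n.+1.
  by exists 0%N.
have e0 p : F 0%N p -> K p = 1.
  by move=> /= np; rewrite /K asboolF// => -[n hn]; apply: np; exists n.
rewrite UF; split; apply/measurable_fun_bigcup => // -[|n].
- apply: (eq_measurable_fun (cst (1 : R))) => [p|]; last exact: measurable_cst.
  by rewrite inE => /e0 ->.
- case: (cmeasurable_k n) => m1 _; apply: (eq_measurable_fun (fun p => complex.Re (k_ n p))) => [p|].
    by rewrite inE => /K_stage ->.
  exact: measurable_funS m1.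
- apply: (eq_measurable_fun (cst (0 : R))) => [p|]; last exact: measurable_cst.
  by rewrite inE => /e0 ->.
- case: (cmeasurable_k n) => _ m2; apply: (eq_measurable_fun (fun p => complex.Im (k_ n p))) => [p|].
    by rewrite inE => /K_stage ->.
  exact: measurable_funS m2.
Qed.

Let K_flow x t t' : regular x -> 0 <= t -> 0 <= t' ->
  (forall n, stage n (x, t) -> g (special_flow T0 A f t' (land n (x, t))) = expi (2 * pi * s * t') * g (land n (x, t))) ->
  K (x, t + t') = K (x, t).
Proof.
move=> rx t0 t'0 h; have [n hn] := regular_stage rx t0.
have [n' hn'] := regular_stage rx (addr_ge0 t0 t'0).
rewrite (K_stage hn) (K_stage hn') /k_ /g1.
rewrite !asboolT; [|exact: (stage_land hn)|exact: (stage_land hn')].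
rewrite -(special_flow_land hT T01 f0 rx t'0 hn hn') (h n hn) mulrA -expiD.
by congr (expi _ * _) => /=; rewrite /om; ring.
Qed.

(** The flow line of [(T x, 0)] is that of [(x, 0)] started [r x] later, and the removed factor
    changes accordingly. *)
Let K_base x t : regular x -> regular (T x) -> 0 <= t ->
  K (T x, t) = expi (om * r x) * K (x, t + r x).
Proof.
move=> rx rTx t0; have [n hn] := regular_stage rTx t0.
have e := heightS T0 As f n x; have e' := heightS T0 As f n.+1 x.
have hn' : stage n.+1 (x, t + r x).
  by case: rx hn => x01 _ _ [_ /= hn]; split => //=; rewrite e e'; lra.
rewrite (K_stage hn) (K_stage hn') /k_ mulrA -expiD; congr (expi _ * g1 _) => /=.
  by ring.
by rewrite /land /= -iterSr e; congr pair; ring.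
Qed.

Context (erg : ergodic_map mu `[0, 1[ T) (high : (0 < mu [set x | (1 < r x)%R])%E).

(** The exceptional set of the eigenvalue equation depends on the time, so [K] cannot be compared
    pointwise at two given times. Fubini on the triples (x, t, t') provides one time [t0] with
    [K (x, t0 + t') = K (x, t0)] for almost all [x] and [t'], and [G] is [K] at [t0]. *)
Lemma eigenfunction_cocycle : exists G : R -> R[i], [/\ cmeasurable_fun [set: R] G,
  forall x, `|G x| = 1,
  {ae mu, forall x, 0 <= x < 1 -> G (T x) = expi (om * r x) * G x} &
  {ae mu2, forall p, D p -> g p = expi (om * p.2) * G p.1}].
Proof.
have reg := regular_ae hT mr f0 erg high.
have reg2 : {ae mu2, forall p : R * R, 0 <= p.1 < 1 -> regular p.1} by exact: (negligible_fst reg).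
have C1 t' : 0 <= t' -> {ae mu2, forall p : R * R, 0 <= p.1 < 1 -> 0 <= p.2 -> K (p.1, p.2 + t') = K p}.
  move=> t'0; case: eig => _ _ /(_ t') et.
  have nl : mu2.-negligible (\bigcup_n (land n @^-1` [set p | ~ (D p -> g (special_flow T0 A f t' p) = expi (2 * pi * s * t') * g p)])).
    by apply: negligible_bigcup => n; exact: (negligible_land hT mr n et).
  apply: negligibleS (negligibleU reg2 nl) => -[x t] /=.
  move=> /not_implyP[x01 /not_implyP[t0 nK]]; apply: contrapT => /not_orP[h1 h2].
  have rx : regular x by apply: contrapT => nr; apply: h1 => /(_ x01).
  apply: nK; apply: K_flow => // n hn; apply: contrapT => ne; apply: h2; exists n => //= h.
  by apply: ne; apply: h; exact: (stage_land hn).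
pose S : set ((R * R) * R) := [set q | ([&& 0 <= q.1.1, q.1.1 < 1, 0 <= q.1.2 & 0 <= q.2]) &&
  ~~ ((complex.Re (K (q.1.1, q.1.2 + q.2)) == complex.Re (K q.1)) &&
      (complex.Im (K (q.1.1, q.1.2 + q.2)) == complex.Im (K q.1)))].
have mf11 : measurable_fun [set: (R * R) * R] (fun q : (R * R) * R => q.1.1).
  exact: (measurableT_comp measurable_fst measurable_fst).
have mf12 : measurable_fun [set: (R * R) * R] (fun q : (R * R) * R => q.1.2).
  exact: (measurableT_comp measurable_snd measurable_fst).
have mf2 : measurable_fun [set: (R * R) * R] (fun q : (R * R) * R => q.2) by exact: measurable_snd.
have mpt : measurable_fun [set: (R * R) * R] (fun q : (R * R) * R => (q.1.1, q.1.2 + q.2)).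
  by apply: measurable_fun_pair => //; exact: measurable_funD.
have [mK1 mK2] := cmeasurable_K.
have mS : measurable S.
  apply: measurable_set_bool; apply: measurable_and.
    apply: measurable_and; first by apply: measurable_fun_ler.
    apply: measurable_and; first by apply: measurable_fun_ltr.
    by apply: measurable_and; apply: measurable_fun_ler.
  apply: measurable_neg; apply: measurable_and; apply: measurable_fun_eqr.
  - exact: (measurableT_comp mK1 mpt).
  - exact: (measurableT_comp mK1 measurable_fst).
  - exact: (measurableT_comp mK2 mpt).
  - exact: (measurableT_comp mK2 measurable_fst).
have sec : {ae mu2, forall p, mu (xsection S p) = 0%E}.
  apply: (@null_ysections_xsections _ _ _ _ _ _ R mu mu mu S mS); apply: aeW => t' /=.
  apply/negligibleP; first exact: measurable_ysection.
  have [t'0|t'n] := leP 0 t'; last first.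
    rewrite (_ : ysection S t' = set0); first exact: negligible_set0.
    apply/seteqP; split => p //; rewrite /ysection /= inE /S /= => /andP[/and4P[_ _ _]].
    by rewrite leNgt t'n.
  apply: negligibleS (C1 t' t'0) => p; rewrite /ysection /= inE /S /= => /andP[/and4P[h1 h2 h3 _] ne] h.
  by move: ne; rewrite h ?h1 ?h2// -?surjective_pairing !eqxx.
have [M [mM M0 N1M]] := sec.
have [t0 t00 nt0] := negligible_avoid 0 ((null_ysectionP mu mu mM).1 M0).
have {}nt0 : mu (ysection M t0) = 0%E by exact: contrapT.
pose bad t x := [set t' | 0 <= t' /\ K (x, t + t') <> K (x, t)].
have negS x t : mu (xsection S (x, t)) = 0%E -> 0 <= x < 1 -> 0 <= t -> mu.-negligible (bad t x).
  move=> h /andP[x0 x1] t0'; exists (xsection S (x, t)); split => //; first exact: measurable_xsection.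
  move=> t' [t'0 ne]; rewrite /xsection /= inE /S /= x0 x1 t0' t'0 /=; apply/negP => /andP[/eqP e1 /eqP e2].
  by apply: ne; apply/complexP.
pose good x := regular x /\ mu.-negligible (bad t0 x).
have gae : {ae mu, forall x, 0 <= x < 1 -> good x}.
  have n1 : mu.-negligible (ysection M t0) by apply/negligibleP => //; exact: measurable_ysection.
  apply: negligibleS (negligibleU reg n1) => x /= /not_implyP[x01 ng].
  apply: contrapT => /not_orP[h1 h2]; apply: ng; split.
    by apply: contrapT => nr; apply: h1 => /(_ x01).
  apply: negS => //; apply: contrapT => ne; apply: h2; rewrite /ysection /= inE; exact: N1M.
pose G x := K (x, t0).
have KG x t' : good x -> 0 <= t' -> ~ bad t0 x t' -> K (x, t0 + t') = G x.
  by move=> _ h1 h2; apply: contrapT => h; apply: h2.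
exists G; split => [||| ].
- have mp : measurable_fun [set: R] (fun x : R => (x, t0)).
    by apply: measurable_fun_pair; [exact: measurable_id|exact: measurable_cst].
  by split; [exact: (measurableT_comp mK1 mp)|exact: (measurableT_comp mK2 mp)].
- by move=> x; exact: norm_K.
- apply: (lebesgue_ae_mono (ae_iter hT gae)) => x h x01.
  have gx := h 0%N x01.
  have gTx : good (T x) by apply: (h 1%N); rewrite (iter_unit hT).
  (* A time that is good for [T x] and, delayed by [r x], for [x]. *)
  have [t' t'0] := negligible_avoid 0 (negligibleU gTx.2 (negligible_shift (r x) gx.2)).
  move=> /not_orP[b1 b2].
  rewrite -(KG (T x) t') // (K_base gx.1 gTx.1 (addr_ge0 t00 t'0)) -addrA KG //.
  by rewrite addr_ge0 // roof_ge0.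
- have gae2 : {ae mu2, forall p : R * R, 0 <= p.1 < 1 -> good p.1} by exact: (negligible_fst gae).
  apply: negligibleS (negligibleU gae2 sec) => -[x t] /= /not_implyP[Dp ne].
  apply: contrapT => /not_orP[h1 h2].
  have [x01 _ _] := Dp; move: (Dp); rewrite flow_spaceE /= => /andP[t_ge t_lt].
  have gx : good x by apply: contrapT => ng; apply: h1 => /(_ x01).
  have nb : mu.-negligible (bad t x) by apply: negS => //; exact: contrapT.
  (* A common later time [u] at which [K] agrees with its values at both [t] and [t0]. *)
  have [u] := negligible_avoid (`|t| + `|t0|) (negligibleU (negligible_shift (- t) nb) (negligible_shift (- t0) gx.2)).
  rewrite !ger0_norm // => hu /not_orP[b1 b2].
  have tu : 0 <= u - t by lra.
  have t0u : 0 <= u - t0 by lra.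
  have e1 : K (x, u) = K (x, t).
    by apply: contrapT => h; apply: b1; split => //=; rewrite addrC subrK.
  have e2 : K (x, u) = G x.
    by apply: contrapT => h; apply: b2; split => //=; rewrite addrC subrK.
  have s0 : stage 0 (x, t).
    have h0 y : height 0 y = 0 by exact: big_ord0.
    by split => //=; rewrite heightS !h0 addr0 t_ge.
  apply: ne; rewrite -e2 e1 (K_stage s0) /k_ mulrA -expiD subrr expi0 mul1r /g1.
  have -> : land 0 (x, t) = (x, t) by rewrite /land /= (_ : height 0 x = 0) ?subr0//; exact: big_ord0.
  by rewrite asboolT.
Qed.
End EigenCocycle.

(** * Ergodicity passes from the base to the flow *)

Section WeakMixing.
Context {R : realType} (T0 : R -> R) (As : seq R) (f : R -> R).
Notation mu := (@lebesgue_measure R).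
Notation mu2 := (@lebesgue_measure R \x @lebesgue_measure R)%E.
Notation A := [set` As].
Notation T := (extend_id T0).
Notation r := (roof As f).
Notation D := (flow_space A f).
Context (hT : cut_translation T As).
Context (T01 : `[0, 1[ `<=` T0 @^-1` `[0, 1[).
Context (mr : measurable_fun [set: R] r).
Context (f0 : forall x, 0 <= x < 1 -> x \notin As -> 0 <= f x).
Context (erg : ergodic_map mu `[0, 1[ T) (high : (0 < mu [set x | (1 < r x)%R])%E).

(** Almost every point visits [F] if [F] is not null, and along almost every orbit a visit can be
    traced back to the starting point. *)
Lemma ergodic_ae_invariant (F : set R) : measurable F -> F `<=` `[0, 1[ ->
  {ae mu, forall x, 0 <= x < 1 -> (F (T x) <-> F x)} ->
  mu F = 0%E \/ mu (`[0, 1[ `\` F) = 0%E.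
Proof.
move=> mF F01 inv; have [F0|nF0] := pselect (mu F = 0%E); [by left|right].
have Fpos : (0 < mu F)%E by rewrite lt_neqAle measure_ge0 andbT eq_sym; apply/eqP.
have rec0 := ergodic_recurrent hT erg mF F01 Fpos.
have mrec : measurable (`[0, 1[ `\` recurrent T F).
  by apply: measurableD => //; exact: (measurable_recurrent hT).
have mUF : measurable (`[0, 1[ `\` F) by exact: measurableD.
have nrec : mu.-negligible (`[0, 1[ `\` recurrent T F) by apply/(negligibleP mu mrec).
apply/(negligibleP mu mUF).
apply: negligibleS (negligibleU nrec (ae_iter hT inv)) => x [x01 nF] /=.
apply: contrapT => /not_orP[h1 /contrapT h2].
have /contrapT[_ /(_ 0%N) [k _ Fk]] : ~ ~ recurrent T F x by move=> nr; exact: h1.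
apply: nF; move: x01; rewrite /= in_itv /= => x01.
elim: k Fk => // k IH Fk; apply: IH; apply/(h2 k) => //.
by rewrite (iter_unit hT).
Qed.

(** The function equal to 1 on [B] and -1 off it is an eigenfunction of frequency 0. Its [G] is
    invariant almost everywhere, and [B] lies, up to a null set, over the base set where [G = 1]. *)
Lemma special_flow_ergodic : ergodic_flow mu2 D (special_flow T0 A f).
Proof.
move=> B mB BD inv; pose g (p : R * R) : R[i] := Complex (2 * \1_B p - 1) 0.
have gB p : B p -> g p = 1 by move=> Bp; rewrite /g indicE mem_set //= mulr1; congr Complex; ring.
have gnB p : ~ B p -> g p = -1.
  by move=> Bp; rewrite /g indicE memNset //= mulr0 sub0r; apply/complexP => /=; rewrite ?oppr0.
have eig : is_eigenfunction mu2 D (special_flow T0 A f) 0 g.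
  split.
  - split => /=; last exact: measurable_cst.
    apply: measurable_funB; last exact: measurable_cst.
    by apply: measurable_funM; [exact: measurable_cst|exact: measurable_indic].
  - by move=> p _; have [/gB ->|/gnB ->] := pselect (B p); rewrite ?normrN normr1.
  - move=> t; apply: negligibleS (inv t) => p /= ne h; apply: ne => /h Bp.
    rewrite mulr0 mul0r expi0 mul1r.
    by have [/[dup] /Bp /gB -> /gB ->|/[dup] nB /gnB ->] := pselect (B p); rewrite ?gnB // => /Bp.
have [G [[mG _] _ GT gG]] := eigenfunction_cocycle hT T01 mr f0 eig erg high.
pose F : set R := `[0, 1[ `&` [set x | complex.Re (G x) == 1].
have mF : measurable F.
  by apply: measurableI => //; apply: measurable_set_bool; exact: measurable_fun_eqr.
have F01 : F `<=` `[0, 1[ by move=> x [].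
have {}gG : {ae mu2, forall p, D p -> (B p <-> F p.1)}.
  apply: negligibleS gG => p /= ne h; apply: ne => Dp.
  have := h Dp; rewrite mulr0 mul0r expi0 mul1r => {}h.
  have [x01 _ _] := Dp.
  have [Bp|nBp] := pselect (B p); split => //.
    by move=> _; split; [rewrite /= in_itv|rewrite /= -h gB].
  by move=> [_ /=]; rewrite -h gnB //= => /eqP; lra.
have [|||F0|F1] := @ergodic_ae_invariant F => //.
- apply: (lebesgue_ae_mono GT) => x h x01; rewrite /F /= !in_itv /= (cut_unit hT) x01.
  by rewrite h // mulr0 mul0r expi0 mul1r.
- left; apply/negligibleP => //.
  have nF : mu.-negligible F by apply/(negligibleP mu mF).
  apply: negligibleS (negligibleU gG (negligible_fst nF)) => p Bp /=.
  by apply: contrapT => /not_orP[/contrapT h]; apply; apply/h => //; exact: BD.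
- right; have mD := measurable_flow_space mr.
  apply/negligibleP; first exact: measurableD.
  have nF : mu.-negligible (`[0, 1[ `\` F).
    by apply/(negligibleP mu _) => //; exact: measurableD.
  apply: negligibleS (negligibleU gG (negligible_fst nF)) => p [Dp nB] /=.
  apply: contrapT => /not_orP[/contrapT h]; apply; split; first by case: Dp => /=; rewrite in_itv.
  by move=> Fp; apply: nB; apply/h.
Qed.
End WeakMixing.

(** * Growth of the roof near the singularities, and conclusion *)

Section DistanceToCuts.
Context {R : realType} (As : seq R).
Notation A := [set` As].

Lemma dist_to_le x a : a \in As -> dist_to A x <= `|x - a|.
Proof. by move=> aA; apply: ge_inf; [exists 0 => _ [b _ <-]|exists a]. Qed.

Lemma dist_to_gt0 x : As != [::] -> x \notin As -> 0 < dist_to A x.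
Proof.
move=> A0 xA; have [b bA bmin] := seq_min (fun b => `|x - b|) A0.
apply: (@lt_le_trans _ _ `|x - b|).
  by rewrite normr_gt0 subr_eq0; apply: contraNneq xA => ->.
by apply: lb_le_inf; [exists `|x - b|, b|move=> _ [c cA <-]; exact: bmin].
Qed.

Lemma log_growth_le (C x a : R) : 0 < C -> As != [::] -> x \notin As -> a \in As ->
  C / (x - a) ^+ 2 <= C / dist_to A x ^+ 2.
Proof.
move=> C0 A0 xA aA; have d0 := dist_to_gt0 A0 xA; have dle := dist_to_le x aA.
have xa : 0 < `|x - a| by exact: lt_le_trans d0 dle.
rewrite ler_pM2l // -[(x - a) ^+ 2]real_normK ?num_real //.
by rewrite lef_pV2 ?posrE ?exprn_gt0 // lerXn2r ?nnegrE // ltW.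
Qed.
End DistanceToCuts.

Lemma high_roof_near_cuts {R : realType} (As : seq R) (f : R -> R) : As != [::] ->
  (forall a, a \in As -> f y @[y --> a^'-] --> +oo /\ f y @[y --> a^'+] --> +oo) ->
  exists2 eta, 0 < eta & forall z a, 0 <= z < 1 -> a \in As -> 0 < `|z - a| < eta -> 1 < roof As f z.
Proof.
move=> A0 hsing.
have /choice[e he] : forall a, exists e : R, a \in As ->
    0 < e /\ forall z, 0 < `|z - a| < e -> 1 < f z.
  move=> a; have [aA|aA] := boolP (a \in As); last by exists 0.
  have [/cvgryPgt /(_ 1) /nbhs_ballP[e1 /= e10 h1] /cvgryPgt /(_ 1) /nbhs_ballP[e2 /= e20 h2]] := hsing a aA.
  exists (Num.min e1 e2) => _; split; first by rewrite lt_min e10.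
  move=> z /andP[z0]; rewrite lt_min => /andP[z1 z2].
  have [za|az|za] := ltgtP z a.
  - by apply: h1 => //; rewrite /ball /= distrC.
  - by apply: h2 => //; rewrite /ball /= distrC.
  - by move: z0; rewrite za subrr normr0 ltxx.
have [a1 a1A e1min] := seq_min e A0.
have s0 : [seq (a, b) | a <- As, b <- As] != [::].
  by case: (As) A0.
(* [roof] is 0 on every cut, so the neighbourhood of a cut must not contain another one; the value 1
   on diagonal pairs keeps the minimum positive. *)
have [[a2 b2] _ /= e2min] := seq_min (fun p : R * R => if p.1 == p.2 then 1 else `|p.1 - p.2|) s0.
move: e2min; set e2 := (if _ then _ else _) => e2min.
have e20 : 0 < e2 by rewrite /e2; case: eqVneq => // ne; rewrite normr_gt0 subr_eq0.
exists (Num.min (e a1) e2); first by rewrite lt_min e20 (he _ a1A).1.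
move=> z a z01 aA /andP[z0]; rewrite lt_min => /andP[z1 z2].
have zA : z \notin As.
  apply/negP => zA; have := e2min (z, a); rewrite allpairs_f // => /(_ isT) /=.
  case: eqVneq => [za|_]; first by move: z0; rewrite za subrr normr0 ltxx.
  by rewrite leNgt z2.
rewrite /roof z01 zA; apply: (he a aA).2.
by rewrite z0 (lt_le_trans z1) // e1min.
Qed.

Lemma ergodic_extend_id {R : realType} (T : R -> R) :
  ergodic_map (@lebesgue_measure R) `[0, 1[ T -> ergodic_map (@lebesgue_measure R) `[0, 1[ (extend_id T).
Proof.
move=> erg B mB B01 inv; apply: erg => //; rewrite -[RHS]inv.
have e x : `[0, 1[%classic x -> extend_id T x = T x by rewrite /extend_id /= in_itv /= => ->.
by apply/seteqP; split => x [x01 Bx]; split => //; move: Bx; rewrite /= e.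
Qed.

Theorem mainTheorem2 (R : realType) (T : R -> R) (A : set R) (f : R -> R)
  (hT : is_IET T)
  (hAfin : finite_set A) (hA0 : A !=set0) (hA01 : A `<=` `]0, 1[)
  (hf0 : forall x, (`[0, 1[ `\` A) x -> 0 <= f x)
  (hfC2 : C2_on (`]0, 1[ `\` A) f)
  (hsing : forall x, A x ->
     f y @[y --> x^'-] --> +oo /\ f y @[y --> x^'+] --> +oo)
  (hdisc : discontinuities T `<=` A)
  (hlog : exists B C : R, [/\ 0 < B, 0 < C &
     forall x, (`]0, 1[ `\` A) x ->
       C / dist_to A x ^+ 2 - B <= (f^`()^`())%classic x]) :
  ergodic_map (@lebesgue_measure R) `[0, 1[ T <->
  weakly_mixing_flow (@lebesgue_measure R \x @lebesgue_measure R)%E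
    (flow_space A f) (special_flow T A f).
Proof.
have [As AE] := (finite_seqP A).1 hAfin; subst A.
have A0 : As != [::] by case: hA0 => a /=; case: (As).
have hA a : a \in As -> 0 < a < 1 by move=> aA; have := hA01 a aA; rewrite /= in_itv.
have cT := IET_cut_translation hT hA hdisc.
have T01 := IET_unit_preimage hT.
have mr := measurable_roof hA hfC2.
have f0 x : 0 <= x < 1 -> x \notin As -> 0 <= f x.
  by move=> x01 /negP xA; apply: hf0; split => //; rewrite /= in_itv.
have unc x : 0 < x < 1 -> x \notin As -> (`]0, 1[ `\` [set` As]) x.
  by move=> x01 /negP xA; split => //; rewrite /= in_itv.
have [eta eta0 high] := high_roof_near_cuts A0 hsing.
split=> [erg|[ergf _]]; last first.
  apply: (ergodic_flow_map cT T01 mr A0 eta0) ergf => z a z01 aA za.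
  exact: lt_trans ltr01 (high z a z01 aA za).
have ergT := ergodic_extend_id erg.
have high0 : (0 < lebesgue_measure [set x | (1 < roof As f x)%R])%E.
  have [a aA] : exists a, a \in As by case: hA0 => a; exists a.
  have a01 := hA a aA.
  (* A one-sided neighbourhood of a cut inside [[0, 1[] supplies positive measure. *)
  pose b := Num.min (a + eta) 1.
  have ab : a < b by rewrite lt_min; move: a01; lra.
  apply: (@lt_le_trans _ _ (lebesgue_measure (`]a, b[%classic : set R))).
    by rewrite lebesgue_measure_itv /= lte_fin ab -EFinB lte_fin subr_gt0.
  apply: le_lebesgue => //.
    by apply: measurable_set_bool; exact: measurable_fun_ltr.
  move=> z; rewrite /= in_itv /= => /andP[az]; rewrite lt_min => /andP[zb z1].
  apply: (high z a) => //; first by rewrite z1 andbT; move: a01; lra.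
  by rewrite gtr0_norm ?subr_gt0 // az /=; lra.
split; first exact: (special_flow_ergodic cT T01 mr f0 ergT high0).
move=> [s [g [s0 eig]]].
have [G [mG nG GT _]] := eigenfunction_cocycle cT T01 mr f0 eig ergT high0.
have [B [C [B0 C0 hBC]]] := hlog.
have hC x a : 0 < x < 1 -> x \notin As -> a \in As -> C / (x - a) ^+ 2 - B <= (f^`()^`())%classic x.
  move=> x01 xA aA; apply: le_trans (hBC x (unc x x01 xA)).
  by rewrite lerD2r; exact: log_growth_le.
apply: (@no_cocycle _ _ _ cT f (f^`())%classic (f^`()^`())%classic B C B0 C0 _ _ _ _ hC _ G ergT A0 _ mG nG GT).
- by move=> x x01 xA; have [df _ _] := hfC2 x (unc x x01 xA); exact: (DeriveDef df (esym (derive1E _ _))).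
- by move=> x x01 xA; have [_ df _] := hfC2 x (unc x x01 xA); exact: (DeriveDef df (esym (derive1E _ _))).
- by move=> x x01 xA; have [_ _] := hfC2 x (unc x x01 xA).
- move=> x x01 xA; apply: le_trans (hBC x (unc x x01 xA)).
  by rewrite lerDr divr_ge0 ?sqr_ge0 // ltW.
- by rewrite !mulf_neq0 // ?pnatr_eq0 // gt_eqF // pi_gt0.
Qed.
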